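(* Let $\varphi$ be a hyperbolic automorphism of the closed unit disk $\mathbb{D}$ which fixes $1$ and $-1$. Let $\mathcal{C}$ be the orbit space of $\varphi$ restricted to $\mathbb{D}\setminus\{-1,1\}$, with its quotient topology. Endow $\mathcal{C}\cup(\mathbb{T}\times\{-1,1\})$ (disjoint union) with the topology $\mathfrak{C}$ in which a set $F$ is closed if and only if either $F$ is contained in, and closed in, $\mathbb{T}\times\{-1,1\}$, or $F=F'\cup(\mathbb{T}\times\{-1,1\})$ with $F'$ closed in $\mathcal{C}$. Then the map $q$ given by $q(\pi_x)=\mathcal{O}_\varphi(x)\in\mathcal{C}$ and $q(\pi_{\theta,\varepsilon})=(e^{2i\pi\theta},\varepsilon)\in\mathbb{T}\times\{-1,1\}$ is a homeomorphism from the spectrum of the C*-crossed product $C(\mathbb{D})\rtimes_\varphi\mathbb{Z}$ onto $\left(\mathcal{C}\cup(\mathbb{T}\times\{-1,1\}),\mathfrak{C}\right)$.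
   Context: $\mathbb{D}=\{z\in\mathbb{C}:|z|\le 1\}$, $\mathbb{T}=\{|z|=1\}$. Conformal automorphisms of $\mathbb{D}$ are the maps $z\mapsto e^{2i\pi\theta}\frac{z-z_0}{1-\overline{z_0}z}$ with $|z_0|<1$; such a map is hyperbolic if it has exactly two distinct fixed points in $\mathbb{D}$ (they then lie on $\mathbb{T}$). $\mathcal{O}_\varphi(x)=\{\varphi^n(x):n\in\mathbb{Z}\}$. For a homeomorphism $\varphi$ of $\mathbb{D}$, $C(\mathbb{D})\rtimes_\varphi\mathbb{Z}$ is the universal C*-algebra generated by $C(\mathbb{D})$ and a unitary $U_\varphi$ with $U_\varphi^*fU_\varphi=f\circ\varphi$ for all $f\in C(\mathbb{D})$; $A_\varphi$ denotes the function $z\mapsto z$ in $C(\mathbb{D})$. For $\varepsilon\in\{-1,1\}$ and $\theta\in[0,1)$, $\pi_{\theta,\varepsilon}$ is the one-dimensional representation with $\pi_{\theta,\varepsilon}(A_\varphi)=\varepsilon$, $\pi_{\theta,\varepsilon}(U_\varphi)=e^{2i\pi\theta}$. For $x\in\mathbb{D}\setminus\{-1,1\}$, $\pi_x$ is the representation on $l^2(\mathbb{Z})$ with $\pi_x(A_\varphi)e_n=\varphi^n(x)e_n$ and $\pi_x(U_\varphi)e_n=e_{n+1}$, where $(e_n)_{n\in\mathbb{Z}}$ is the canonical basis. The spectrum of a C*-algebra is the set of unitary equivalence classes of irreducible representations with the hull-kernel (Jacobson) topology. Every irreducible representation of $C(\mathbb{D})\rtimes_\varphi\mathbb{Z}$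 is unitarily equivalent to some $\pi_x$ or $\pi_{\theta,\varepsilon}$, where $\pi_x$ and $\pi_y$ are equivalent if and only if $\mathcal{O}_\varphi(x)=\mathcal{O}_\varphi(y)$ and the $\pi_{\theta,\varepsilon}$ are pairwise inequivalent; the spectrum is identified as a set with these classes, on which $q$ is defined. *)

(* Defs.v *)
From HB Require Import structures.
From mathcomp Require Import all_boot all_order all_algebra.
From mathcomp Require Import all_classical all_reals all_analysis.
From mathcomp Require Import complex lra ring.

Set Implicit Arguments.
Unset Strict Implicit.
Unset Printing Implicit Defensive.

Import Order.TTheory GRing.Theory Num.Def Num.Theory numFieldNormedType.Exports.

Local Open Scope classical_set_scope.
Local Open Scope ring_scope.
Local Open Scope complex_scope.

HB.instance Definition _ (R : realType) := NormedModule.copy R[i] R[i]^o.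

Local Notation Re := complex.Re.
Local Notation Im := complex.Im.

Section ComplexComplete.
Variable R : realType.
Implicit Types z w : R[i].

Lemma normc_ge_Im z : `|Im z|%:C <= `|z|.
Proof.
by have := normc_ge_Re (z * 'i%C); rewrite ReiNIm normrN normrM complexiE normCi mulr1.
Qed.

Lemma le_normc_ReIm z : `|z| <= (`|Re z| + `|Im z|)%:C.
Proof.
rewrite {1}[z]complexE (le_trans (ler_normD _ _))// rmorphD/= lerD//.
  by rewrite normc_def/= expr0n/= addr0 sqrtr_sqr.
by rewrite normrM complexiE normCi mul1r normc_def/= expr0n/= addr0 sqrtr_sqr.
Qed.

Lemma gt0_complex (e : R[i]) : 0 < e -> 0 < Re e /\ e = (Re e)%:C.
Proof. by case: e => a b; rewrite ltcE/= => /andP[/eqP -> ?]. Qed.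

Lemma continuous_Re : continuous (@Re R : R[i] -> R).
Proof.
move=> z; have FF := nbhs_filter z.
apply/(@cvgrPdist_lt _ _ _ _ FF) => e e0; near=> w.
rewrite -ltcR -raddfB (le_lt_trans (normc_ge_Re _))//.
near: w; apply: (@nbhsx_ballx _ R[i] z e%:C); rewrite ltcR.
Unshelve. all: by end_near. Qed.

Lemma continuous_Im : continuous (@Im R : R[i] -> R).
Proof.
move=> z; have FF := nbhs_filter z.
apply/(@cvgrPdist_lt _ _ _ _ FF) => e e0; near=> w.
rewrite -ltcR -raddfB (le_lt_trans (normc_ge_Im _))//.
near: w; apply: (@nbhsx_ballx _ R[i] z e%:C); rewrite ltcR.
Unshelve. all: by end_near. Qed.

Lemma cvg_complex T (F : set_system T) (FF : Filter F) (u v : T -> R) (a b : R) :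
  u @ F --> a -> v @ F --> b -> (fun t => u t +i* v t : R[i]) @ F --> a +i* b.
Proof.
move=> ua vb; apply/cvgrPdist_lt => e /gt0_complex[e0 ->].
have e2 : 0 < Re e / 2 by rewrite divr_gt0.
move/cvgrPdist_lt : ua => /(_ _ e2) ua; move/cvgrPdist_lt : vb => /(_ _ e2).
apply: filterS2 ua => t ta tb.
by rewrite (le_lt_trans (le_normc_ReIm _))//= ltcR (splitr (Re e)) ltrD.
Qed.

Lemma complex_complete (F : set_system R[i]) :
  ProperFilter F -> cauchy F -> cvg F.
Proof.
move=> FF /cauchy_ballP Fc.
have h (p : R[i] -> R) : (forall x y, `|p x - p y|%:C <= `|x - y|) -> cvg (p @ F).
  move=> pl; apply: R_complete; apply/cauchy_ballP => e e0.
  have e0' : 0 < e%:C by rewrite ltcR.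
  have [/= [A B] [FA FB] AB] := Fc _ e0'.
  exists (p @` A, p @` B) => /=.
    split; [apply: filterS FA|apply: filterS FB] => x ?; by exists x.
  move=> [_ _] /= [[x Ax <-] [y By <-]].
  have := AB (x, y) (conj Ax By).
  rewrite /ball/= /ball_/= => xy.
  by rewrite -ltcR (le_lt_trans _ xy)// pl.
have cR : cvg (@Re R @ F).
  by apply: h => x y; rewrite -raddfB normc_ge_Re.
have cI : cvg (@Im R @ F).
  by apply: h => x y; rewrite -raddfB normc_ge_Im.
apply/cvg_ex; exists (lim (@Re R @ F) +i* lim (@Im R @ F)).
have := cvg_complex FF cR cI.
by rewrite [X in X @ F --> _](_ : _ = id)//; apply/funext => -[].
Qed.

HB.instance Definition _ := Uniform_isComplete.Build R[i] complex_complete.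

End ComplexComplete.

Section zseries.

(* The series of g over the integers, with partial sums over -n <= k < n
   ([Negz i] is - (i + 1)). *)
Definition zseries (V : zmodType) (g : int -> V) : V ^nat :=
  series (fun i => g (Posz i) + g (Negz i)).

Variable R : realType.

Definition sqnorm (z : R[i]) : R := Re z ^+ 2 + Im z ^+ 2.

Lemma sqnorm_ge0 z : 0 <= sqnorm z.
Proof. by rewrite addr_ge0 ?sqr_ge0. Qed.

Lemma sqnormE z : (sqnorm z)%:C = z * z^*%R.
Proof. by rewrite add_Re2_Im2 normCK. Qed.

Lemma sqnormD z w : sqnorm (z + w) <= 2 * sqnorm z + 2 * sqnorm w.
Proof. by rewrite /sqnorm; case: z w => [a b] [c d] /=; have := sqr_ge0 (a - c); have := sqr_ge0 (b - d); lra. Qed.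

Lemma sqnormM z w : sqnorm (z * w) = sqnorm z * sqnorm w.
Proof. by rewrite /sqnorm; case: z w => [a b] [c d] /=; ring. Qed.

Lemma le_zseries (g h : int -> R) n :
  (forall k, g k <= h k) -> zseries g n <= zseries h n.
Proof. by move=> gh; apply: ler_sum => i _; rewrite lerD. Qed.

Lemma zseriesD (V : zmodType) (g h : int -> V) n :
  zseries (fun k => g k + h k) n = zseries g n + zseries h n.
Proof. by rewrite /zseries /series/= -big_split/=; apply: eq_bigr => i _; rewrite addrACA. Qed.

Lemma zseriesZ (K : pzRingType) (V : lmodType K) (c : K) (g : int -> V) n :
  zseries (fun k => c *: g k) n = c *: zseries g n.
Proof. by rewrite /zseries /series/= scaler_sumr; apply: eq_bigr => i _; rewrite scalerDr. Qed.

Lemma zseries_morph (V W : zmodType) (p : {additive V -> W}) (g : int -> V) n :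
  p (zseries g n) = zseries (p \o g) n.
Proof. by rewrite /zseries /series/= raddf_sum; apply: eq_bigr => i _; rewrite raddfD. Qed.

Lemma nondecreasing_zseries (g : int -> R) :
  (forall k, 0 <= g k) -> nondecreasing_seq (zseries g).
Proof. by move=> g0; apply: nondecreasing_series => i _ _; rewrite addr_ge0. Qed.

Lemma cvg_zseries_pos (g : int -> R) M :
  (forall k, 0 <= g k) -> (forall n, zseries g n <= M) -> cvgn (zseries g).
Proof.
move=> g0 gM; apply: nondecreasing_is_cvgn; first exact: nondecreasing_zseries.
by exists M => _ [n _ <-].
Qed.

Lemma cvg_zseries_abs (g : int -> R) M :
  (forall n, zseries (fun k => `|g k|) n <= M) -> cvgn (zseries g).
Proof.
move=> gM; apply: normed_cvg.
apply: (@series_le_cvg _ _ (fun i => `|g (Posz i)| + `|g (Negz i)|)).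
- by move=> n; exact: normr_ge0.
- by move=> n; rewrite addr_ge0.
- by move=> n; exact: ler_normD.
- exact: (@cvg_zseries_pos (fun k => `|g k|) M).
Qed.

Lemma zseries_ReIm (g : int -> R[i]) n :
  zseries g n = zseries (fun k => Re (g k)) n +i* zseries (fun k => Im (g k)) n.
Proof.
have Rg := zseries_morph (@Re R : {additive R[i] -> R}) g n.
have Ig := zseries_morph (@Im R : {additive R[i] -> R}) g n.
by rewrite -[RHS]/(zseries (@Re R \o g) n +i* zseries (@Im R \o g) n) -Rg -Ig; case: (zseries g n).
Qed.

Lemma cvg_zseriesP (g : int -> R[i]) a b :
  zseries (fun k => Re (g k)) @ \oo --> a ->
  zseries (fun k => Im (g k)) @ \oo --> b -> zseries g @ \oo --> a +i* b.
Proof.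
move=> ga gb; rewrite (funext (zseries_ReIm g)).
by apply: cvg_complex.
Qed.

Definition sqsummable (f : int -> R[i]) :=
  exists M : R, forall n, zseries (fun k => sqnorm (f k)) n <= M.

Lemma cvg_zseries_sqnorm f : sqsummable f -> cvgn (zseries (fun k => sqnorm (f k))).
Proof. by move=> [M fM]; apply: (@cvg_zseries_pos _ M) => // k; exact: sqnorm_ge0. Qed.

Lemma cvg_zseries_dot f g : sqsummable f -> sqsummable g ->
  cvgn (zseries (fun k => f k * (g k)^*%R)).
Proof.
move=> [M fM] [N gN].
have h (p : R[i] -> R) : (forall z w : R[i], `|p (z * w^*%R)| <= sqnorm z + sqnorm w) ->
    cvgn (zseries (fun k => p (f k * (g k)^*%R))).
  move=> ph; apply: (@cvg_zseries_abs _ (M + N)) => n.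
  apply: (@le_trans _ _ (zseries (fun k => sqnorm (f k) + sqnorm (g k)) n)).
    exact: le_zseries.
  by rewrite zseriesD lerD.
have cR : cvgn (zseries (fun k => Re (f k * (g k)^*%R))).
  apply: (h (@Re R)) => -[a b] [c d]; rewrite /sqnorm ler_norml /=.
  have := sqr_ge0 (a - c); have := sqr_ge0 (b - d).
  have := sqr_ge0 (a + c); have := sqr_ge0 (b + d).
  by move=> *; apply/andP; split; nra.
have cI : cvgn (zseries (fun k => Im (f k * (g k)^*%R))).
  apply: (h (@Im R)) => -[a b] [c d]; rewrite /sqnorm ler_norml /=.
  have := sqr_ge0 (a - d); have := sqr_ge0 (b - c).
  have := sqr_ge0 (a + d); have := sqr_ge0 (b + c).
  by move=> *; apply/andP; split; nra.
by apply/cvg_ex; eexists; exact: cvg_zseriesP cR cI.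
Qed.

Lemma sqsummable_submod :
  submod_closed [pred f : int -> R[i] | `[< sqsummable f >]].
Proof.
split.
  apply/asboolP; exists 0 => n.
  by rewrite /zseries /series/= big1// => i _; rewrite /sqnorm/= expr0n/= !addr0.
move=> c f g /asboolP[M fM] /asboolP[N gN]; apply/asboolP.
exists (2 * sqnorm c * M + 2 * N) => n.
apply: (@le_trans _ _ (zseries (fun k => (2 * sqnorm c) *: (sqnorm (f k) : R^o) + (2 : R) *: (sqnorm (g k) : R^o)) n)).
  apply: le_zseries => k; apply: le_trans (sqnormD _ _) _.
  by rewrite sqnormM mulrA.
rewrite zseriesD !zseriesZ lerD// ler_wpM2l// ?mulr_ge0 ?sqnorm_ge0//.
Qed.

End zseries.

Section DotNorm.
Variables (C : numClosedFieldType) (V : lmodType C) (d : {dot V for conjC}).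

Lemma dot_CauchySchwarz u v : `|d u v| <= sqrtC (d u u) * sqrtC (d v v).
Proof.
have [->|v0] := eqVneq v 0.
  by rewrite !linear0r normr0 sqrtC0 mulr0.
rewrite -ler_sqr ?nnegrE ?mulr_ge0 ?sqrtC_ge0 ?dnorm_ge0//.
rewrite exprMn !sqrtCK -ler_pdivrMr ?dnorm_gt0//.
pose a := d u v / d v v; have ou : d (u - a *: v) v = 0.
  by rewrite linearBl/= linearZl_LR/= divfK ?dnorm_eq0// subrr.
have -> : d u u = `|d u v| ^+ 2 / d v v + d (u - a *: v) (u - a *: v).
  rewrite -[X in d X X = _](subrK (a *: v)) hnormDd/=; last first.
    by rewrite linearZr_LR/= ou mulr0.
  rewrite addrC; congr (_ + _); rewrite dnormZ /a normrM exprMn normfV.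
  by rewrite (ger0_norm (dnorm_ge0 _ _)); field; rewrite dnorm_eq0.
by rewrite lerDl dnorm_ge0.
Qed.

Lemma dot_triangle u v :
  sqrtC (d (u + v) (u + v)) <= sqrtC (d u u) + sqrtC (d v v).
Proof.
rewrite -ler_sqr ?nnegrE ?addr_ge0 ?sqrtC_ge0 ?dnorm_ge0//.
rewrite sqrrD !sqrtCK dnormD [leRHS]addrAC lerD2l.
have := leif_Re_Creal (d u v); rewrite ReE => -[+ _].
move=> /le_trans /(_ (dot_CauchySchwarz u v)).
by rewrite ler_pdivrMr ?ltr0n// mulr_natr.
Qed.

End DotNorm.

Section l2Z.
Variable R : realType.

Record l2Z := L2Z { l2val :> int -> R[i]; _ : l2val \in [pred f : int -> R[i] | `[< sqsummable f >]] }.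

HB.instance Definition _ := [isSub for l2val].
HB.instance Definition _ := [Choice of l2Z by <:].
HB.instance Definition _ := GRing.isSubmodClosed.Build _ _
  [pred f : int -> R[i] | `[< sqsummable f >]] (@sqsummable_submod R).
HB.instance Definition _ := [SubChoice_isSubLmodule of l2Z by <:].

Lemma l2P (f : l2Z) : sqsummable f.
Proof. by have /asboolP := valP f. Qed.

Definition l2dot (f g : l2Z) : R[i] :=
  limn (zseries (fun k => f k * (g k)^*%R)).

Lemma l2dot_cvg (f g : l2Z) : zseries (fun k => f k * (g k)^*%R) @ \oo --> l2dot f g.
Proof. exact: (cvg_zseries_dot (l2P f) (l2P g)). Qed.

Lemma l2dot_bilinear : bilinear_for
  (GRing.Scale.Law.clone _ _ *%R _) (GRing.Scale.Law.clone _ _ (@conjC _ \; *%R) _) l2dot.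
Proof.
split=> [h|h] a f g.
  apply: cvg_lim => //; rewrite /=.
  rewrite (_ : zseries _ = (fun n => a *: zseries (fun k => f k * (h k)^*%R) n + zseries (fun k => g k * (h k)^*%R) n)).
    by apply: cvgD; [apply: cvgZr|]; exact: l2dot_cvg.
  apply/funext => n; rewrite -zseriesZ -zseriesD; congr zseries.
  by apply/funext => k /=; rewrite mulrDl -mulrA.
apply: cvg_lim => //=.
rewrite (_ : zseries _ = (fun n => a^*%R *: zseries (fun k => h k * (f k)^*%R) n + zseries (fun k => h k * (g k)^*%R) n)).
  by apply: cvgD; [apply: cvgZr|]; exact: l2dot_cvg.
apply/funext => n; rewrite -zseriesZ -zseriesD; congr zseries; apply/funext => k /=.
by rewrite rmorphD rmorphM mulrDr/= mulrCA.
Qed.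

HB.instance Definition _ := @bilinear_isBilinear.Build _ _ _ _ _ _ l2dot l2dot_bilinear.

Lemma l2dot_herm (f g : l2Z) : l2dot f g = (-1) ^+ false * (l2dot g f)^*%R.
Proof.
rewrite mul1r; apply: cvg_lim => //.
have /= gf := @l2dot_cvg g f.
have cR := cvg_comp _ _ gf (@continuous_Re R (l2dot g f)).
have cI := cvgN (cvg_comp _ _ gf (@continuous_Im R (l2dot g f))).
have -> : (l2dot g f)^*%R = Re (l2dot g f) +i* - Im (l2dot g f).
  by case: (l2dot g f).
have -> : zseries (fun k => f k * (g k)^*%R) =
    (fun n => Re (zseries (fun k => g k * (f k)^*%R) n)
           +i* - Im (zseries (fun k => g k * (f k)^*%R) n)).
  apply/funext => n.
  transitivity ((zseries (fun k => g k * (f k)^*%R) n)^*%R); last first.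
    by case: (zseries (fun k => g k * (f k)^*%R) n).
  rewrite (zseries_morph (@conjC R[i] : {additive _ -> _})).
  congr (zseries _ n); apply/funext => k.
  by rewrite -[RHS]/((g k * (f k)^*%R)^*%R) rmorphM/= conjCK mulrC.
exact: cvg_complex cR (cI _).
Qed.

HB.instance Definition _ := @isHermitianSesquilinear.Build _ _ false (@conjC _) l2dot l2dot_herm.

Definition l2sq (f : l2Z) : R := limn (zseries (fun k => sqnorm (f k))).

Lemma l2dotE (f : l2Z) : l2dot f f = (l2sq f)%:C.
Proof.
apply: cvg_lim => //; rewrite -complexr0; apply: cvg_zseriesP.
  rewrite [X in X @ _](_ : _ = zseries (fun k => sqnorm (f k))).
    exact: cvg_zseries_sqnorm (l2P f).
  by congr zseries; apply/funext => k; rewrite -sqnormE.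
rewrite [X in X @ _](_ : _ = cst 0); first exact: cvg_cst.
apply/funext => n; rewrite /zseries /series/= big1// => i _.
by rewrite -!sqnormE/= addr0.
Qed.

Lemma l2sq_ge (f : l2Z) n : zseries (fun k => sqnorm (f k)) n <= l2sq f.
Proof.
apply: (nondecreasing_cvgn_le (nondecreasing_zseries _)).
  by move=> k; exact: sqnorm_ge0.
exact: cvg_zseries_sqnorm (l2P f).
Qed.

Lemma l2sq_ge_coord (f : l2Z) k : sqnorm (f k) <= l2sq f.
Proof.
pose n := `|k|%N.+1.
apply: le_trans (l2sq_ge f n); rewrite /zseries /series/= big_mkord.
have h i : 0 <= sqnorm (f (Posz i)) + sqnorm (f (Negz i)).
  by rewrite addr_ge0 ?sqnorm_ge0.
case: k @n => m n.
  rewrite (bigD1 (Ordinal (ltnSn m)))//= -addrA lerDl addr_ge0 ?sqnorm_ge0//.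
  by rewrite sumr_ge0.
rewrite (bigD1 (Ordinal (ltnW (ltnSn m.+1) : (m < n)%N)))//= addrAC lerDr addr_ge0 ?sqnorm_ge0//.
by rewrite sumr_ge0.
Qed.

Lemma l2dot_gt0 (f : l2Z) : f != 0 -> 0 < l2dot f f.
Proof.
move=> f0; rewrite l2dotE ltcR.
have [k fk] : exists k, f k <> 0.
  apply: contra_notP (negP f0) => /forallNP f0'; apply/eqP/val_inj/funext => k /=.
  exact: contrapT (f0' k).
apply: lt_le_trans (l2sq_ge_coord f k).
by rewrite -ltcR sqnormE -normCK exprn_gt0// normr_gt0; apply/eqP.
Qed.

HB.instance Definition _ := @isDotProduct.Build _ _ l2dot l2dot_gt0.

Lemma l2norm_normZ (l : R[i]) (f : l2Z) : sqrtC (l2dot (l *: f) (l *: f)) = `|l| * sqrtC (l2dot f f).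
Proof. by rewrite dnormZ sqrtCM ?nnegrE ?exprn_ge0 ?dnorm_ge0// sqrCK. Qed.

Lemma l2norm_eq0 (f : l2Z) : sqrtC (l2dot f f) = 0 -> f = 0.
Proof. by move=> /eqP; rewrite sqrtC_eq0 dnorm_eq0 => /eqP. Qed.

HB.instance Definition _ := @Lmodule_isNormed.Build R[i] l2Z (fun f => sqrtC (l2dot f f))
  (dot_triangle (l2dot : {dot l2Z for conjC})) l2norm_normZ l2norm_eq0.

Lemma l2dot_norm (f : l2Z) : l2dot f f = `|f| ^+ 2.
Proof. by rewrite sqrtCK. Qed.

Lemma l2norm_coord (f : l2Z) k : `|f k| <= `|f|.
Proof.
rewrite -ler_sqr ?nnegrE// -l2dot_norm l2dotE normCK -sqnormE lecR.
exact: l2sq_ge_coord.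
Qed.

Lemma l2_complete (F : set_system l2Z) : ProperFilter F -> cauchy F -> cvg F.
Proof.
move=> FF /cauchy_ballP Fc.
have coord k : cvg ((fun f : l2Z => f k) @ F).
  apply: complex_complete; apply/cauchy_ballP => e e0.
  have [/= [A B] [FA FB] AB] := Fc _ e0.
  exists ((fun f : l2Z => f k) @` A, (fun f : l2Z => f k) @` B) => /=.
    split; [apply: filterS FA|apply: filterS FB] => x ?; by exists x.
  move=> [_ _] /= [[x Ax <-] [y By <-]].
  have := AB (x, y) (conj Ax By).
  rewrite -!ball_normE /ball_/= => xy.
  exact: le_lt_trans (l2norm_coord (x - y) k) xy.
pose h k := lim ((fun f : l2Z => f k) @ F).
have key (e : R) : 0 < e -> \forall u \near F, forall n,
    zseries (fun k => sqnorm ((u : l2Z) k - h k)) n <= e ^+ 2.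
  move=> e0; have e0' : 0 < e%:C by rewrite ltcR.
  have [/= [A B] [FA FB] AB] := Fc _ e0'.
  apply: filterS FA => u Au n.
  have cv : (fun v : l2Z => zseries (fun k => sqnorm (u k - v k)) n) @ F -->
      zseries (fun k => sqnorm (u k - h k)) n.
    rewrite /zseries /series/=; apply: cvg_big; first exact: add_continuous.
    have uk k : (fun v : l2Z => u k - v k) @ F --> u k - h k.
      by apply: cvgB; [exact: cvg_cst|exact: coord].
    have sk k : (fun v : l2Z => sqnorm (u k - v k)) @ F --> sqnorm (u k - h k).
      apply: cvgD; rewrite !expr2; apply: cvgM.
      - exact: cvg_comp _ _ (uk k) (@continuous_Re R _).
      - exact: cvg_comp _ _ (uk k) (@continuous_Re R _).
      - exact: cvg_comp _ _ (uk k) (@continuous_Im R _).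
      - exact: cvg_comp _ _ (uk k) (@continuous_Im R _).
    by move=> i _; apply: cvgD; exact: sk.
  apply: (cvgr_to_le cv).
  apply: filterS FB => v Bv; have := AB (u, v) (conj Au Bv).
  rewrite -ball_normE /ball_/= => uv.
  apply: le_trans (l2sq_ge (u - v) n) _.
  rewrite -lecR -l2dotE l2dot_norm rmorphXn/= ler_sqr ?nnegrE//; last exact: ltW.
  exact: ltW.
have hP : h \in [pred f : int -> R[i] | `[< sqsummable f >]].
  have /filter_ex[u uP] := key 1 ltr01.
  have -> : h = (u : int -> R[i]) - (fun k => u k - h k).
    by apply/funext => k /=; rewrite opprB addrCA subrr addr0.
  by apply: rpredB; [exact: valP|apply/asboolP; exists (1 ^+ 2)].
apply/cvg_ex; exists (L2Z hP); apply/cvgrPdist_le => e /gt0_complex[e0 ->].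
apply: filterS (key _ e0) => u uP; rewrite distrC.
rewrite -ler_sqr ?nnegrE//; last by rewrite lecR ltW.
rewrite -l2dot_norm l2dotE -rmorphXn/= lecR.
apply: limr_le; first exact: cvg_zseries_sqnorm (l2P _).
by apply: nearW => n; exact: uP.
Qed.

HB.instance Definition _ := Uniform_isComplete.Build l2Z l2_complete.

Lemma l2basis_subproof (n : int) :
  (fun k => (k == n)%:R : R[i]) \in [pred f : int -> R[i] | `[< sqsummable f >]].
Proof.
apply/asboolP; exists (1 + 1) => N; rewrite /zseries /series/= big_split/=.
have h (p : nat -> int) : injective p ->
    \sum_(0 <= i < N) sqnorm ((p i == n)%:R : R[i]) <= 1.
  move=> pI; have [[m [mN pm]]|no] := pselect (exists m, (m < N)%N /\ p m = n).
    rewrite big_mkord (bigD1 (Ordinal mN))//= big1.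
      by rewrite pm eqxx addr0 /sqnorm/= expr1n expr0n/= addr0.
    move=> i im; case: eqP => [pin|_]; last by rewrite /sqnorm/= !expr0n/= addr0.
    by move: im; rewrite -val_eqE/= -(inj_eq pI) pin pm eqxx.
  rewrite big_mkord big1 ?ler01// => i _; case: eqP => [pin|_].
    by case: no; exists i.
  by rewrite /sqnorm/= !expr0n/= addr0.
by apply: lerD; apply: h => i j [].
Qed.

Definition l2basis (n : int) : l2Z := L2Z (l2basis_subproof n).

End l2Z.

Section ComplexHilbert.
Variable R : realType.

Definition Cdot (z w : R[i]) : R[i] := z * w^*%R.

Lemma Cdot_bilinear : bilinear_for
  (GRing.Scale.Law.clone _ _ *%R _) (GRing.Scale.Law.clone _ _ (@conjC _ \; *%R) _) Cdot.
Proof.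
split=> [w|w] a u v; rewrite /Cdot/=; first by rewrite mulrDl mulrA.
by rewrite rmorphD rmorphM mulrDr mulrCA.
Qed.

HB.instance Definition _ := @bilinear_isBilinear.Build _ _ _ _ _ _ Cdot Cdot_bilinear.

Lemma Cdot_herm (z w : R[i]) : Cdot z w = (-1) ^+ false * (Cdot w z)^*%R.
Proof. by rewrite mul1r /Cdot rmorphM/= conjCK mulrC. Qed.

HB.instance Definition _ := @isHermitianSesquilinear.Build _ _ false (@conjC _) Cdot Cdot_herm.

Lemma Cdot_gt0 (z : R[i]) : z != 0 -> 0 < Cdot z z.
Proof. by move=> z0; rewrite /Cdot -normCK exprn_gt0// normr_gt0. Qed.

HB.instance Definition _ := @isDotProduct.Build _ _ Cdot Cdot_gt0.

Lemma Cdot_norm (z : R[i]) : Cdot z z = `|z| ^+ 2.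
Proof. by rewrite normCK. Qed.

End ComplexHilbert.

(* Inner products are linear in the first argument. *)
Record hilbert (R : realType) := Hilbert {
  hsort :> completeNormedModType R[i];
  hdot : {dot hsort for conjC};
  hdot_norm : forall v : hsort, hdot v v = `|v| ^+ 2
}.

Definition hilbert_C (R : realType) : hilbert R :=
  @Hilbert R R[i] (@Cdot R) (@Cdot_norm R).

Definition hilbert_l2Z (R : realType) : hilbert R :=
  @Hilbert R (l2Z R) (@l2dot R) (@l2dot_norm R).

Record cstarAlg (R : realType) := CStarAlg {
  csort :> completeNormedModType R[i];
  cmul : csort -> csort -> csort;
  cone : csort;
  cstar : csort -> csort;
  cmulA : associative cmul;
  cmul1l : left_id cone cmul;
  cmul1r : right_id cone cmul;
  cmulDl : left_distributive cmul +%R;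
  cmulDr : right_distributive cmul +%R;
  cmulZl : forall (c : R[i]) a b, cmul (c *: a) b = c *: cmul a b;
  cmulZr : forall (c : R[i]) a b, cmul a (c *: b) = c *: cmul a b;
  cstarK : involutive cstar;
  cstarD : {morph cstar : a b / a + b};
  cstarZ : forall (c : R[i]) a, cstar (c *: a) = c^*%R *: cstar a;
  cstarM : forall a b, cstar (cmul a b) = cmul (cstar b) (cstar a);
  cnormM : forall a b, `|cmul a b| <= `|a| * `|b|;
  cnorm_star : forall a, `|cmul (cstar a) a| = `|a| ^+ 2
}.

Declare Scope cstar_scope.
Delimit Scope cstar_scope with cstar.
Notation "a ** b" := (cmul a b) (at level 40, left associativity) : cstar_scope.
Local Open Scope cstar_scope.

Record star_hom (R : realType) (A B : cstarAlg R) (h : A -> B) : Prop := {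
  star_homD : {morph h : a b / a + b};
  star_homZ : forall (c : R[i]) a, h (c *: a) = c *: h a;
  star_homM : {morph h : a b / a ** b};
  star_hom1 : h (cone A) = cone B;
  star_hom_star : forall a, h (cstar a) = cstar (h a)
}.

Record star_subalgebra (R : realType) (A : cstarAlg R) (S : set A) : Prop := {
  subalgD : forall a b, S a -> S b -> S (a + b);
  subalgZ : forall (c : R[i]) a, S a -> S (c *: a);
  subalgM : forall a b, S a -> S b -> S (a ** b);
  subalg1 : S (cone A);
  subalg_star : forall a, S a -> S (cstar a)
}.

Section ContinuousFunctions.
Variables (R : realType) (X : topologicalType).
Local Notation CX := (continuousType X R[i]).

Lemma continuous_conj : continuous (@conjC R[i]).
Proof.
have -> : @conjC R[i] = fun w : R[i] => Re w +i* - Im w.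
  by apply/funext => -[].
move=> z; have FF := nbhs_filter z; apply: cvg_complex.
  exact: (@continuous_Re R z).
exact: (cvgN (@continuous_Im R z)).
Qed.

Lemma ctsD_subproof (f g : CX) : continuous (f \+ g).
Proof. by move=> x; apply: cvgD; exact: cts_fun. Qed.
Lemma ctsZ_subproof (c : R[i]) (f : CX) : continuous (fun x => c * f x).
Proof. by move=> x; apply: (@cvgM R[i]); [exact: cvg_cst|exact: cts_fun]. Qed.
Lemma ctsM_subproof (f g : CX) : continuous (f \* g).
Proof. by move=> x; apply: (@cvgM R[i]); exact: cts_fun. Qed.
Lemma cts_conj_subproof (f : CX) : continuous (fun x => (f x)^*%R).
Proof. move=> x; exact: cvg_comp _ _ (@cts_fun _ _ f x) (@continuous_conj (f x)). Qed.

Definition ctsD (f g : CX) : CX := mkcts (@ctsD_subproof f g).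
Definition ctsZ (c : R[i]) (f : CX) : CX := mkcts (@ctsZ_subproof c f).
Definition ctsM (f g : CX) : CX := mkcts (@ctsM_subproof f g).
Definition cts_conj (f : CX) : CX := mkcts (@cts_conj_subproof f).
Definition cts1 : CX := cst 1.

End ContinuousFunctions.

Section CrossedProduct.
Variables (R : realType) (X : topologicalType) (phi : continuousType X X).
Local Notation CX := (continuousType X R[i]).

Record covariant_pair (B : cstarAlg R) (j : CX -> B) (V : B) : Prop := {
  covD : forall f g, j (ctsD f g) = j f + j g;
  covZ : forall c f, j (ctsZ c f) = c *: j f;
  covM : forall f g, j (ctsM f g) = j f ** j g;
  cov1 : j (cts1 R X) = cone B;
  cov_star : forall f, j (cts_conj f) = cstar (j f);
  cov_unitaryl : cstar V ** V = cone B;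
  cov_unitaryr : V ** cstar V = cone B;
  cov_rel : forall f, cstar V ** j f ** V = j (f \o phi)
}.

(* The generation clause makes the morphism of [cp_universal] unique. *)
Record is_crossed_product (A : cstarAlg R) (iota : CX -> A) (U : A) : Prop := {
  cp_covariant : covariant_pair iota U;
  cp_generated : forall S : set A, closed S -> star_subalgebra S ->
    (forall f, S (iota f)) -> S U -> S = setT;
  cp_universal : forall (B : cstarAlg R) (j : CX -> B) (V : B),
    covariant_pair j V ->
    exists2 h : A -> B, star_hom h & (forall f, h (iota f) = j f) /\ h U = V
}.

End CrossedProduct.

Section Spectrum.
Variables (R : realType) (A : cstarAlg R).

Record representation (H : hilbert R) := Representation {
  rop :> A -> {linear H -> H};
  rop_continuous : forall a, continuous (rop a);
  ropD : forall a b v, rop (a + b) v = rop a v + rop b v;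
  ropZ : forall (c : R[i]) a v, rop (c *: a) v = c *: rop a v;
  ropM : forall a b v, rop (a ** b) v = rop a (rop b v);
  rop1 : forall v, rop (cone A) v = v;
  rop_star : forall a u v, hdot H (rop (cstar a) u) v = hdot H u (rop a v)
}.

Record closed_subspace (H : hilbert R) (W : set H) : Prop := {
  csub_closed : closed W;
  csub0 : W 0;
  csub_lin : forall (c : R[i]) u v, W u -> W v -> W (c *: u + v)
}.

Definition irreducible (H : hilbert R) (p : representation H) :=
  (exists v : H, v <> 0) /\
  forall W : set H, closed_subspace W -> (forall a v, W v -> W (p a v)) ->
    W = [set 0] \/ W = setT.

Record irrep := Irrep {
  irr_space : hilbert R;
  irr_rep :> representation irr_space;
  irr_irreducible : irreducible irr_rep
}.

Definition unitary_equiv (p r : irrep) : Prop :=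
  exists T : {linear irr_space p -> irr_space r},
    [/\ bijective T,
        forall u v, hdot _ (T u) (T v) = hdot _ u v &
        forall a v, T (p a v) = r a (T v)].

(* [irrep] is a large type, on which no [topologicalType] structure can be put
   (universes); hence the topology of the spectrum is given by its closed sets,
   as a predicate. *)
Definition spectrum := {c : irrep -> Prop | exists p, c = unitary_equiv p}.

Definition spec_class (p : irrep) : spectrum :=
  exist _ (unitary_equiv p) (ex_intro _ p erefl).

Definition spec_ker (c : spectrum) (a : A) : Prop :=
  forall p, sval c p -> forall v, p a v = 0.

(* Hull-kernel topology: F contains the hull of the intersection of the kernels
   of its elements. *)
Definition jacobson_closed (F : spectrum -> Prop) : Prop :=
  forall c, (forall a, (forall c', F c' -> spec_ker c' a) -> spec_ker c a) -> F c.

End Spectrum.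

(* [clX] and [clY] are the families of closed sets of X and Y. *)
Definition homeomorphism (X Y : Type) (clX : (X -> Prop) -> Prop)
    (clY : (Y -> Prop) -> Prop) (q : X -> Y) : Prop :=
  bijective q /\ forall F : Y -> Prop, clY F <-> clX (fun x => F (q x)).

Section Disk.
Variable R : realType.

Definition disk : set R[i] := [set z | `|z| <= 1].
Definition circle : set R[i] := [set z | `|z| = 1].

Definition cis (t : R) : R[i] := cos t +i* sin t.

Lemma circle_cis t : cis t \in circle.
Proof. by rewrite inE /circle/= normc_def/= cos2Dsin2 sqrtr1. Qed.

Definition circle_pt (theta : R) : circle := SigSub (circle_cis (2 * pi * theta)).

Lemma disk_sign_subproof (b : bool) : (-1) ^+ b \in disk.
Proof. by rewrite inE /disk/= normr_sign. Qed.

(* [b : bool] encodes the sign (-1) ^+ b in {-1, 1}. *)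
Definition disk_sign (b : bool) : disk := SigSub (disk_sign_subproof b).

Definition punctured_disk : set disk := [set z | forall b, z <> disk_sign b].

Lemma disk_coord_subproof : continuous (set_val : disk -> R[i]).
Proof. exact: initial_continuous. Qed.

Definition disk_coord : continuousType disk R[i] := mkcts disk_coord_subproof.

Definition conformal_automorphism (phi : disk -> disk) :=
  exists theta z0, `|z0| < 1 /\ forall z : disk,
    set_val (phi z) = cis (2 * pi * theta) *
      ((set_val z - z0) / (1 - z0^*%R * set_val z)).

Definition hyperbolic_automorphism (phi : disk -> disk) :=
  conformal_automorphism phi /\
  exists a b : disk, a <> b /\ forall z, phi z = z <-> z = a \/ z = b.

End Disk.

Arguments disk : clear implicits.
Arguments circle : clear implicits.
Arguments punctured_disk : clear implicits.
Arguments disk_coord : clear implicits.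

Local Open Scope quotient_scope.

Section Orbits.
Variables (R : realType) (phi : continuousType (disk R) (disk R)).

(* The n-th iterate for n in Z; for f bijective, the [xget] is the inverse of f. *)
Definition iterz (T : choiceType) (f : T -> T) (n : int) (x : T) : T :=
  match n with
  | Posz k => iter k f x
  | Negz k => iter k.+1 (fun y => xget y [set z | f z = y]) x
  end.

Definition orbit (x : disk R) : set (disk R) :=
  [set y | exists n : int, y = iterz phi n x].

Definition same_orbit (x y : punctured_disk R) : bool :=
  `[< orbit (set_val x) = orbit (set_val y) >].

Lemma same_orbit_refl : reflexive same_orbit.
Proof. by move=> x; apply/asboolP. Qed.
Lemma same_orbit_sym : symmetric same_orbit.
Proof. by move=> x y; apply/asboolP/asboolP => ->. Qed.
Lemma same_orbit_trans : transitive same_orbit.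
Proof. by move=> y x z /asboolP xy /asboolP yz; apply/asboolP; rewrite xy. Qed.

Canonical same_orbit_equiv :=
  EquivRel same_orbit same_orbit_refl same_orbit_sym same_orbit_trans.

Definition orbit_space : topologicalType :=
  quotient_topology {eq_quot same_orbit}.

Definition orbit_class (x : punctured_disk R) : orbit_space :=
  (\pi_({eq_quot same_orbit}) x).

Definition spectrum_model := (orbit_space + circle R * bool)%type.

Definition frakC_closed (F : set spectrum_model) : Prop :=
  (exists2 K : set (circle R * bool), closed K & F = inr @` K) \/
  (exists2 K : set orbit_space, closed K & F = inl @` K `|` range inr).

Variables (A : cstarAlg R) (iota : continuousType (disk R) R[i] -> A) (U : A).

(* pi_x, acting on l^2(Z); it is determined by its values on generators. *)
Definition is_pi_x (x : disk R) (p : representation A (hilbert_l2Z R)) :=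
  forall n : int,
    p (iota (disk_coord R)) (l2basis R n) = set_val (iterz phi n x) *: l2basis R n /\
    p U (l2basis R n) = l2basis R (n + 1).

Definition is_pi_theta (theta : R) (b : bool) (p : representation A (hilbert_C R)) :=
  forall v : R[i],
    p (iota (disk_coord R)) v = (-1) ^+ b * v /\
    p U v = cis (2 * pi * theta) * v.

Definition is_q (q : spectrum A -> spectrum_model) : Prop :=
  (forall (x : punctured_disk R) (p : representation A (hilbert_l2Z R))
      (irr : irreducible p),
    is_pi_x (set_val x) p -> q (spec_class (Irrep irr)) = inl (orbit_class x)) /\
  (forall theta b (p : representation A (hilbert_C R)) (irr : irreducible p),
    0 <= theta < 1 -> is_pi_theta theta b p ->
    q (spec_class (Irrep irr)) = inr (circle_pt theta, b)).
End Orbits.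

(* Main.v *)
Require Import Defs.
From HB Require Import structures.
From mathcomp Require Import all_boot all_order all_algebra.
From mathcomp Require Import all_classical all_reals all_analysis.
From mathcomp Require Import complex lra ring.

(** The automorphism fixing 1 and -1 has the form [z |-> (z + r) / (1 + r z)]
    with [r] real and nonzero. In the coordinate [(1 + z) / (1 - z)] it is
    multiplication by a positive number different from 1, so away from the
    fixed points it translates the height (the logarithm of the modulus) and
    preserves the direction (the argument): orbits are discrete, their space is
    Hausdorff, and each orbit accumulates exactly at the two fixed points.

    Classification. For an irreducible representation, the closed set on which
    all functions acting as zero vanish is invariant. Functions supported near
    two different orbits have disjoint invariant supports and annihilate each
    other, so irreducibility leaves at most one orbit in this set
    ([support_one_orbit]). If there is one, a function isolating a point of it
    produces an eigenvector of the coordinate function; its translates by the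
    unitary form an orthonormal family, and the coefficients along this family
    intertwine the representation with [pi_x] ([eigenvector_orbit_equiv]).
    Otherwise only the fixed points remain, functions commute with the unitary,
    and Schur's lemma ([central_scalar]) makes everything scalar. Hence a
    representation is determined up to equivalence by an orbit or by a point of
    the circle together with a sign, and this is the map [spec_param].

    Topology. The kernels of [pi_x] and of the characters depend continuously on
    the parameters, because the matrix coefficients of a fixed element of the
    algebra do ([coef_continuous], [chi_continuous]); so Jacobson closed sets
    have closed traces on the orbit space and on the circles. Since an orbit
    accumulates at both fixed points, long packets of basis vectors far along it
    are approximate eigenvectors for any character, and the kernel of [pi_x] is
    contained in that of the character ([pi_ker_chi]): a closed set containing
    an orbit contains all the characters. Conversely, bump functions separate
    orbits from closed sets, and continuous functions of the unitary separate
    characters ([separating_element]).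

    No spectral theory is presupposed. Square roots of [1 - b] are obtained by a
    fixed point iteration ([csqrt]); they yield the contractivity of
    representations, absolute values ([cabs]), and through these Schur's lemma
    and the functions of the unitary. Density arguments are replaced by an
    induction principle for the crossed product ([crossed_product_ind]), and
    functional calculus on functions by the domination of continuous functions
    on a compact space ([compact_domination]). *)

Set Implicit Arguments.
Unset Strict Implicit.
Unset Printing Implicit Defensive.

Import Order.TTheory GRing.Theory Num.Theory numFieldNormedType.Exports.

Local Open Scope classical_set_scope.
Local Open Scope ring_scope.
Local Open Scope complex_scope.
Local Open Scope cstar_scope.
Local Notation Re := complex.Re.
Local Notation Im := complex.Im.

(** * Square roots and absolute values in a C*-algebra *)

Section MetricComplements.
Variable R : realType.

(** Completeness in the form used for the square root: a real sequence that
    controls the increments replaces the summation of a power series. *)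
Lemma dominated_cauchy_cvg (V : completeNormedModType R[i]) (Y : nat -> V) (y : nat -> R) :
  (forall n m, (n <= m)%N -> `|Y m - Y n| <= (y m - y n)%:C) ->
  cvgn y -> cvgn Y.
Proof.
move=> Yy cy; apply: cauchy_cvg; apply/cauchy_ballP => e /gt0_complex[e0 ee].
have e2 : 0 < Re e / 2 by rewrite divr_gt0.
move: cy => /cvgrPdist_lt/(_ _ e2)[N _ hN].
have yN n m : (N <= n)%N -> (N <= m)%N -> `|y n - y m| < Re e.
  move=> Nn Nm; rewrite -(subrKA (limn y)) (le_lt_trans (ler_normD _ _))//.
  by rewrite (splitr (Re e)) ltrD// ?hN// distrC hN.
exists (Y @` [set n | (N <= n)%N], Y @` [set n | (N <= n)%N]) => /=.
  by split; exists N => // n Nn; exists n.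
move=> [_ _] /= [[n Nn <-] [m Nm <-]].
rewrite -ball_normE/= ee; wlog nm : n m Nn Nm / (n <= m)%N.
  move=> h; have [nm|/ltnW mn] := leqP n m; first exact: h.
  by rewrite distrC; exact: h.
rewrite distrC; apply: le_lt_trans (Yy _ _ nm) _; rewrite ltcR.
by apply: le_lt_trans (ler_norm _) _; exact: yN.
Qed.

Lemma dist_continuous (V W : normedModType R[i]) (f : V -> W) (c : R[i]) :
  (forall a b, `|f a - f b| <= c * `|a - b|) -> continuous f.
Proof.
move=> fc a; have FF := nbhs_filter a; apply/cvgrPdist_lt => e e0.
have p0 : 0 < `|c| + 1 by rewrite ltr_wpDl.
apply/nbhs_normP; exists (e / (`|c| + 1)) => /=; first by rewrite divr_gt0.
move=> b /=; rewrite ltr_pdivlMr// => ab.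
have h : `|f a - f b| <= `|a - b| * `|c|.
  have h := fc a b; have h0 := le_trans (normr_ge0 _) h.
  by rewrite (le_trans h)// -(ger0_norm h0) normrM normr_id mulrC.
by apply: le_lt_trans h _; apply: le_lt_trans ab; rewrite ler_wpM2l// lerDl.
Qed.

Lemma ge0_complex (z : R[i]) : 0 <= z -> z = (Re z)%:C.
Proof. by case: z => a b; rewrite lecE/= => /andP[/eqP -> _]. Qed.

(** Norms take values in the partially ordered field [R[i]]; their real
    counterpart is accessible to real arithmetic. *)
Definition rnorm (V : normedModType R[i]) (v : V) : R := Re `|v|.

Lemma rnormE (V : normedModType R[i]) (v : V) : `|v| = (rnorm v)%:C.
Proof. by apply: ge0_complex; rewrite normr_ge0. Qed.

Lemma rnorm_ge0 (V : normedModType R[i]) (v : V) : 0 <= rnorm v.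
Proof. by rewrite -lecR -rnormE normr_ge0. Qed.

Lemma rnorm_continuous (V : normedModType R[i]) : continuous (@rnorm V).
Proof.
move=> v; apply: (@continuous_comp _ _ _ (@Num.norm _ V) (@Re R)).
  exact: norm_continuous.
exact: continuous_Re.
Qed.

Lemma closed_norm_le (V W : normedModType R[i]) (f : V -> W) (c : R) :
  continuous f -> closed [set v | `|f v| <= c%:C].
Proof.
move=> cf; rewrite (_ : [set v | _] = (@rnorm W \o f) @^-1` [set x | x <= c]).
  have /continuous_closedP : continuous (@rnorm W \o f).
    by move=> v; apply: continuous_comp; [exact: cf|exact: rnorm_continuous].
  by apply; exact: closed_le.
by apply/seteqP; split => v /=; rewrite rnormE lecR.
Qed.

Lemma closed_eq_continuous (V W : normedModType R[i]) (f g : V -> W) :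
  continuous f -> continuous g -> closed [set v | f v = g v].
Proof.
move=> cf cg; rewrite (_ : [set v | _] = [set v | `|f v - g v| <= 0%:C]).
  by apply: closed_norm_le => v; apply: cvgB; [exact: cf|exact: cg].
apply/seteqP; split => v /=; first by move=> ->; rewrite subrr normr0.
by rewrite normr_le0 subr_eq0 => /eqP.
Qed.

End MetricComplements.

Section CstarTheory.
Variables (R : realType) (A : cstarAlg R).
Implicit Types a b c k : A.

Lemma cmul0l a : (0 : A) ** a = 0.
Proof. by have := cmulZl 0 0 a; rewrite !scale0r. Qed.
Lemma cmulNl a b : (- a) ** b = - (a ** b).
Proof. by rewrite -scaleN1r cmulZl scaleN1r. Qed.
Lemma cmulNr a b : a ** (- b) = - (a ** b).
Proof. by rewrite -scaleN1r cmulZr scaleN1r. Qed.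
Lemma cmulBl a b c : (a - b) ** c = a ** c - b ** c.
Proof. by rewrite cmulDl cmulNl. Qed.
Lemma cmulBr a b c : a ** (b - c) = a ** b - a ** c.
Proof. by rewrite cmulDr cmulNr. Qed.
Lemma cstar0 : cstar (0 : A) = 0.
Proof. by have := @cstarZ _ A 0 0; rewrite conjC0 !scale0r. Qed.
Lemma cstarN a : cstar (- a) = - cstar a.
Proof. by rewrite -scaleN1r cstarZ rmorphN1 scaleN1r. Qed.
Lemma cstarB a b : cstar (a - b) = cstar a - cstar b.
Proof. by rewrite cstarD cstarN. Qed.
Lemma cstar1 : cstar (cone A) = cone A.
Proof. by rewrite -[LHS](cmul1l) -{1}[cone A]cstarK -cstarM cmul1l cstarK. Qed.

Lemma cnorm_cstar a : `|cstar a| = `|a|.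
Proof.
have h b : `|b| <= `|cstar b|.
  have [->|b0] := eqVneq b 0; first by rewrite cstar0.
  by rewrite -(@ler_pM2r _ `|b|) ?normr_gt0// -expr2 -cnorm_star cnormM.
by apply/eqP; rewrite eq_le h andbT -{2}[a]cstarK h.
Qed.

Lemma cstar_continuous : continuous (@cstar R A).
Proof.
by apply: (@dist_continuous _ _ _ _ 1) => a b; rewrite mul1r -cstarB cnorm_cstar.
Qed.

Lemma cmul_sqr_le a b : `|a ** a - b ** b| <= `|a - b| * (`|a| + `|b|).
Proof.
have -> : a ** a - b ** b = a ** (a - b) + (a - b) ** b.
  by rewrite cmulBl cmulBr addrA subrK.
apply: le_trans (ler_normD _ _) _; rewrite mulrDr lerD//; last exact: cnormM.
by rewrite mulrC; exact: cnormM.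
Qed.

Lemma cmul_continuous_l c : continuous (fun a => a ** c).
Proof.
apply: (@dist_continuous _ _ _ _ `|c|) => a b.
by rewrite -cmulBl mulrC; exact: cnormM.
Qed.

Lemma cmul_continuous_r c : continuous (fun a => c ** a).
Proof.
have -> : (fun a => c ** a) = @cstar R A \o (fun a => a ** cstar c) \o @cstar R A.
  by apply/funext => a /=; rewrite cstarM !cstarK.
by move=> a; apply: continuous_comp; [exact: cstar_continuous|];
  apply: continuous_comp; [exact: cmul_continuous_l|exact: cstar_continuous].
Qed.

End CstarTheory.

Section SquareRoots.
Variables (R : realType) (A : cstarAlg R).
Implicit Types a b c k : A.

Fixpoint sqrt_iter b n : A :=
  if n is m.+1 then 2^-1 *: (b + sqrt_iter b m ** sqrt_iter b m) else 0.

Fixpoint sqrt_bound n : R :=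
  if n is m.+1 then (1 + sqrt_bound m ^+ 2) / 2 else 0.

Lemma sqrt_bound01 n : 0 <= sqrt_bound n <= 1.
Proof.
elim: n => [|n /andP[h0 h1]] /=; first by rewrite lexx ler01.
by apply/andP; split; nra.
Qed.

Lemma sqrt_boundS n : sqrt_bound n <= sqrt_bound n.+1.
Proof.
have /andP[h0 h1] := sqrt_bound01 n; rewrite /=.
by have := sqr_ge0 (sqrt_bound n - 1); nra.
Qed.

Lemma sqrt_bound_nd : nondecreasing_seq sqrt_bound.
Proof. by apply/nondecreasing_seqP => n; exact: sqrt_boundS. Qed.

Lemma sqrt_bound_cvg : cvgn sqrt_bound.
Proof.
apply: nondecreasing_is_cvgn; first exact: sqrt_bound_nd.
by exists 1 => _ [n _ <-]; case/andP: (sqrt_bound01 n).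
Qed.

Lemma sqrt_iter_bound b n : `|b| <= 1 -> `|sqrt_iter b n| <= (sqrt_bound n)%:C.
Proof.
move=> b1; elim: n => [|n IH] /=; first by rewrite normr0.
rewrite normrZ ger0_norm ?invr_ge0//.
have -> : ((1 + sqrt_bound n ^+ 2) / 2)%:C = 2^-1 * (1 + (sqrt_bound n)%:C ^+ 2).
  by rewrite mulrC rmorphM rmorphD rmorphXn fmorphV rmorph_nat.
rewrite ler_wpM2l ?invr_ge0//.
apply: le_trans (ler_normD _ _) _; rewrite lerD//.
apply: le_trans (cnormM _ _) _; rewrite expr2.
by rewrite ler_pM.
Qed.

(** [Y^2 - Z^2 = Y (Y - Z) + (Y - Z) Z] holds without commutation, so the
    increments obey the same recursion as those of the scalar sequence. *)
Lemma sqrt_iterB b n : `|b| <= 1 ->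
  `|sqrt_iter b n.+1 - sqrt_iter b n| <= (sqrt_bound n.+1 - sqrt_bound n)%:C.
Proof.
move=> b1; elim: n => [|n IH].
  have -> : (sqrt_bound 1 - sqrt_bound 0) = 2^-1 by rewrite /=; lra.
  rewrite fmorphV rmorph_nat /= cmul0l addr0 subr0 normrZ ger0_norm ?invr_ge0//.
  by rewrite ler_piMr ?invr_ge0.
have -> : sqrt_iter b n.+2 - sqrt_iter b n.+1 =
   2^-1 *: (sqrt_iter b n.+1 ** sqrt_iter b n.+1 - sqrt_iter b n ** sqrt_iter b n).
  by rewrite [in LHS]/= -scalerBr opprD addrACA subrr add0r.
have -> : sqrt_bound n.+2 - sqrt_bound n.+1 = 2^-1 *
   ((sqrt_bound n.+1 - sqrt_bound n) * (sqrt_bound n.+1 + sqrt_bound n)).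
  by rewrite /=; ring.
rewrite normrZ ger0_norm ?invr_ge0// rmorphM fmorphV rmorph_nat.
rewrite ler_wpM2l ?invr_ge0//; apply: le_trans (cmul_sqr_le _ _) _.
by rewrite rmorphM ler_pM// ?addr_ge0// rmorphD lerD// sqrt_iter_bound.
Qed.

Lemma sqrt_iter_cvg b : `|b| <= 1 -> cvgn (sqrt_iter b).
Proof.
move=> b1; apply: dominated_cauchy_cvg sqrt_bound_cvg => n m nm.
rewrite -(subnK nm); elim: (m - n)%N => [|k IH]; first by rewrite !subrr normr0.
rewrite addSn -(subrKA (sqrt_iter b (k + n))) -(subrKA (sqrt_bound (k + n))).
apply: le_trans (ler_normD _ _) _; rewrite rmorphD lerD//.
exact: sqrt_iterB.
Qed.

(** The fixed points of [y |-> (b + y^2) / 2] are the solutions of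
    [(1 - y)^2 = 1 - b]. The iteration from 0 is dominated by the scalar one for
    [b = 1], which increases to 1; hence it converges, inside any closed
    subalgebra containing [b], without any functional calculus. *)
Lemma csqrt (S : set A) b : closed S -> star_subalgebra S -> S b ->
  cstar b = b -> `|b| <= 1 ->
  exists y, [/\ S y, cstar y = y, `|y| <= 1 &
    (cone A - y) ** (cone A - y) = cone A - b].
Proof.
move=> cS aS Sb bs b1; have cy := sqrt_iter_cvg b1.
pose y := limn (sqrt_iter b); exists y.
have Yy : sqrt_iter b @ \oo --> y by [].
have Yh n : [/\ S (sqrt_iter b n) & cstar (sqrt_iter b n) = sqrt_iter b n].
  elim: n => [|n [S1 S2]] /=.
    by split; [rewrite -(scale0r b); exact: (subalgZ aS)|exact: cstar0].
  split; last by rewrite cstarZ cstarD cstarM bs S2 fmorphV rmorph_nat.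
  by apply: (subalgZ aS); apply: (subalgD aS) => //; exact: (subalgM aS).
split.
- by apply: (closed_cvg S cS _ _ Yy); apply: nearW => n; case: (Yh n).
- apply: (@cvg_unique _ (@norm_hausdorff _ A) (sqrt_iter b @ \oo)) => //.
  rewrite (_ : sqrt_iter b = @cstar R A \o sqrt_iter b); last first.
    by apply/funext => n /=; case: (Yh n).
  by apply: cvg_comp Yy _; exact: cstar_continuous.
- have nY n : `|sqrt_iter b n| <= 1.
    apply: le_trans (sqrt_iter_bound _ b1) _; rewrite lecR.
    by case/andP: (sqrt_bound01 n).
  have cB : closed [set a : A | `|a| <= 1%:C] by apply: (@closed_norm_le R A A id 1) => v; exact: cvg_id.
  by apply: (closed_cvg _ cB _ _ Yy); apply: nearW.
have e : y = 2^-1 *: (b + y ** y).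
  apply: (@cvg_unique _ (@norm_hausdorff _ A) ((fun n => sqrt_iter b n.+1) @ \oo)) => //.
    by have := cvg_shiftS (sqrt_iter b) (nbhs y); rewrite /= => ->.
  apply: cvgZr; apply: cvgD; first exact: cvg_cst.
  have nY n : `|sqrt_iter b n| <= 1.
    apply: le_trans (sqrt_iter_bound _ b1) _; rewrite lecR.
    by case/andP: (sqrt_bound01 n).
  apply/cvgrPdist_le => e e0.
  have p0 : 0 < `|y| + 1 by rewrite ltr_wpDl.
  move/cvgrPdist_le : Yy => /(_ (e / (`|y| + 1))) /(_ (divr_gt0 e0 p0)).
  apply: filterS => n; rewrite ler_pdivlMr// => yn.
  apply: le_trans (cmul_sqr_le _ _) _; apply: le_trans yn.
  by rewrite ler_wpM2l// lerD2l.
have {}e : y + y = b + y ** y.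
  by rewrite {1 2}e -scalerDl (_ : 2^-1 + 2^-1 = 1 :> R[i]) ?scale1r//; field.
have e' : y ** y = y + y - b by rewrite e addrAC subrr add0r.
by rewrite cmulBl cmul1l cmulBr cmul1r e' opprB [y + y - b]addrAC addrK addrA subrK.
Qed.

(** Here [1 - y] plays the part of the absolute value of [k], the bound on [y]
    being its positivity. The square root [s] of [1 - k^2] makes [k + i s]
    unitary, so that [s], and then [1 - k^2], has norm at most 1: this is what
    the square root of [k^2 = 1 - (1 - k^2)] requires. *)
Lemma cabs (S : set A) k : closed S -> star_subalgebra S -> S k ->
  cstar k = k -> `|k| <= 1 ->
  exists y, [/\ S y, cstar y = y, `|y| <= 1 &
    (cone A - y) ** (cone A - y) = k ** k].
Proof.
move=> cS aS Sk ks k1.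
pose S' := [set a : A | a ** k = k ** a].
have cS' : closed S'.
  by apply: closed_eq_continuous; [exact: cmul_continuous_l|exact: cmul_continuous_r].
have aS' : star_subalgebra S'.
  split => [a b ak bk|c a ak|a b ak bk||a ak]; rewrite /S'/=.
  - by rewrite cmulDl cmulDr ak bk.
  - by rewrite cmulZl cmulZr ak.
  - by rewrite -cmulA bk cmulA ak cmulA.
  - by rewrite cmul1l cmul1r.
  - by rewrite -{1}ks -cstarM -ak cstarM ks.
have kk1 : `|k ** k| <= 1.
  by apply: le_trans (cnormM _ _) _; rewrite mulr_ile1.
have kks : cstar (k ** k) = k ** k by rewrite cstarM ks.
have [|y0 [S'y y0s _ y0E]] := csqrt cS' aS' _ kks kk1; first by rewrite /S'/= cmulA.
pose s := cone A - y0.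
have ss : cstar s = s by rewrite cstarB cstar1 y0s.
have sk : s ** k = k ** s by rewrite cmulBl cmulBr cmul1l cmul1r S'y.
(* [k] and [s] commute and [k^2 + s^2 = 1] *)
pose u := k + 'i *: s; have us : cstar u = k - 'i *: s.
  by rewrite cstarD ks cstarZ ss conjCi scaleNr.
have u1 : cstar u ** u = cone A.
  rewrite us cmulDr !cmulBl !cmulZr !cmulZl sk scalerA -expr2 sqrCi scaleN1r opprK.
  by rewrite y0E addrA addrNK addrC subrK.
have one1 : `|cone A| <= 1.
  have [->|n0] := eqVneq (`|cone A|) 0; first exact: ler01.
  rewrite -(@ler_pM2r _ `|cone A|) ?mul1r; last by rewrite lt_def n0 normr_ge0.
  by rewrite -expr2 -cnorm_star cstar1 cmul1l.
have nu : `|u| <= 1.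
  by rewrite -(@ler_pXn2r _ 2) ?nnegrE// expr1n -cnorm_star u1.
have ns : `|s| <= 1.
  have -> : s = (2 * 'i)^-1 *: (u - cstar u).
    rewrite us /u opprD opprK addrACA subrr add0r -scalerDl.
    have -> : 'i + 'i = 2 * 'i :> R[i] by rewrite mulr_natl mulr2n.
    by rewrite scalerA mulVf ?scale1r// mulf_neq0 ?neq0Ci// pnatr_eq0.
  rewrite normrZ normfV normrM normCi mulr1 normr_nat ler_pdivrMl// mulr1.
  by rewrite (le_trans (ler_normB _ _))// cnorm_cstar -[2]/(1 + 1) lerD.
have b1 : `|cone A - k ** k| <= 1.
  by rewrite -y0E (le_trans (cnormM _ _))// mulr_ile1.
have [||y [? ? ? yE]] := @csqrt S (cone A - k ** k) cS aS _ _ b1.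
- rewrite -scaleN1r; apply: (subalgD aS); first exact: subalg1.
  by apply: (subalgZ aS); exact: (subalgM aS).
- by rewrite cstarB cstar1 kks.
by exists y; split => //; rewrite yE opprB addrC subrK.
Qed.

End SquareRoots.

(** * Representations, invariant subspaces and Schur's lemma *)

Section Representations.
Variables (R : realType) (A : cstarAlg R) (H : hilbert R).
Implicit Types (p : representation A H) (u v w : H).

Lemma rop0 p v : p 0 v = 0.
Proof. by have := ropZ p 0 0 v; rewrite !scale0r. Qed.

Lemma ropN p a v : p (- a) v = - p a v.
Proof. by rewrite -scaleN1r ropZ scaleN1r. Qed.

Lemma ropB p a b v : p (a - b) v = p a v - p b v.
Proof. by rewrite ropD ropN. Qed.

Lemma hdot_starr p a u v : hdot H (p a u) v = hdot H u (p (cstar a) v).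
Proof. by rewrite -{1}(cstarK a) rop_star. Qed.

Lemma hdot_selfadjoint p a v : hdot H (p (cstar a ** a) v) v = `|p a v| ^+ 2.
Proof. by rewrite ropM rop_star hdot_norm. Qed.

(** A square root of [1 - a^* a] shows that [|v|^2 - |p a v|^2] is a squared
    norm when [|a| = 1]. *)
Lemma rop_contraction p a v : `|p a v| <= `|a| * `|v|.
Proof.
have [->|a0] := eqVneq a 0; first by rewrite rop0 !normr0 mul0r.
have na : 0 < `|a| by rewrite normr_gt0.
pose a' := `|a|^-1 *: a.
have a'1 : `|a'| = 1.
  by rewrite normrZ normfV normr_id mulVf// gt_eqF.
have aE : a = `|a| *: a' by rewrite scalerA divff ?scale1r// gt_eqF.
rewrite {1}aE ropZ normrZ normr_id ler_wpM2l//.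
have bs : cstar (cstar a' ** a') = cstar a' ** a' by rewrite cstarM cstarK.
have b1 : `|cstar a' ** a'| <= 1 by rewrite cnorm_star a'1 expr1n.
have [||y [_ ys _ yE]] := csqrt _ _ (I : [set: A] _) bs b1.
- exact: closedT.
- by [].
rewrite -(@ler_pXn2r _ 2) ?nnegrE// -hdot_selfadjoint -subr_ge0 -hdot_norm.
have : 0 <= hdot H (p (cstar (cone A - y) ** (cone A - y)) v) v.
  by rewrite hdot_selfadjoint exprn_ge0.
by rewrite cstarB cstar1 ys yE ropB rop1 linearBl.
Qed.

Lemma rop_continuous_alg p v : continuous (fun a => p a v).
Proof.
apply: (@dist_continuous _ _ _ _ `|v|) => a b.
by rewrite -ropB mulrC; exact: rop_contraction.
Qed.

Lemma hdot_CauchySchwarz u v : `|hdot H u v| <= `|u| * `|v|.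
Proof.
by have := dot_CauchySchwarz (hdot H) u v; rewrite !hdot_norm !sqrCK.
Qed.

Lemma hdot_continuous_l v : continuous (fun u => hdot H u v).
Proof.
apply: (@dist_continuous _ _ _ _ `|v|) => a b.
by rewrite -linearBl mulrC; exact: hdot_CauchySchwarz.
Qed.

Lemma hdot_continuous_r v : continuous (fun u => hdot H v u).
Proof.
apply: (@dist_continuous _ _ _ _ `|v|) => a b.
by rewrite -linearBr; exact: hdot_CauchySchwarz.
Qed.

Lemma hdotC u v : hdot H u v = (hdot H v u)^*%R.
Proof. by rewrite hermC/= expr0 mul1r. Qed.

End Representations.

Section ContinuousFunctionsTheory.
Variables (R : realType) (X : topologicalType).
Local Notation CX := (continuousType X R[i]).

Lemma cts_ext (f g : CX) : (forall x, f x = g x) -> f = g.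
Proof.
by move=> fg; apply/continuousEP.
Qed.

Lemma mkctsE (f : X -> R[i]) (cf : continuous f) x : (mkcts cf : CX) x = f x.
Proof. by []. Qed.
Lemma ctsDE (f g : CX) x : ctsD f g x = f x + g x. Proof. by []. Qed.
Lemma ctsZE c (f : CX) x : ctsZ c f x = c * f x. Proof. by []. Qed.
Lemma ctsME (f g : CX) x : ctsM f g x = f x * g x. Proof. by []. Qed.
Lemma cts_conjE (f : CX) x : cts_conj f x = (f x)^*%R. Proof. by []. Qed.
Lemma cts1E x : cts1 R X x = 1. Proof. by []. Qed.
Definition ctsE := (mkctsE, ctsDE, ctsZE, ctsME, cts_conjE, cts1E).

End ContinuousFunctionsTheory.

Section CovariantPairs.
Variables (R : realType) (X : topologicalType) (phi : continuousType X X).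
Variables (A : cstarAlg R) (iota : continuousType X R[i] -> A) (U : A).
Local Notation CX := (continuousType X R[i]).
Hypothesis cov : covariant_pair phi iota U.

(** Moving functions across the unitary reduces invariance under the whole
    algebra to statements about functions and their translates by [phi]. *)
Lemma cov_U (f : CX) : iota f ** U = U ** iota (f \o phi).
Proof. by rewrite -(cov_rel cov) !cmulA (cov_unitaryr cov) cmul1l. Qed.

Lemma cov_Ustar (f : CX) : iota (f \o phi) ** cstar U = cstar U ** iota f.
Proof. by rewrite -(cov_rel cov) -!cmulA (cov_unitaryr cov) cmul1r. Qed.

Lemma covB f g : iota (ctsD f (ctsZ (-1) g)) = iota f - iota g.
Proof. by rewrite (covD cov) (covZ cov) scaleN1r. Qed.

Section OneRepresentation.
Variables (H : hilbert R) (p : representation A H).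

(** [f = |sqrt f|^2], so the form is a squared norm. Order relations between
    functions thus become operator inequalities. *)
Lemma iota_ge0 (f : CX) v : (forall x, 0 <= f x) -> 0 <= hdot H (p (iota f) v) v.
Proof.
move=> f0; pose s (x : X) : R[i] := (Num.sqrt (Re (f x)))%:C.
have cs : continuous s.
  move=> x; rewrite /s; have FF := nbhs_filter x.
  apply: cvg_complex; last exact: cvg_cst.
  apply: continuous_cvg; first exact: sqrt_continuous.
  by apply: (@continuous_comp _ _ _ f (@Re R)); [exact: cts_fun|exact: continuous_Re].
have -> : f = ctsM (cts_conj (mkcts cs)) (mkcts cs).
  apply: cts_ext => x; rewrite !ctsE /s mulrC -normCK ger0_norm ?lecR ?sqrtr_ge0//.
  by rewrite -rmorphXn/= sqr_sqrtr -?ge0_complex//; have := f0 x; rewrite lecE => /andP[].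
by rewrite (covM cov) (cov_star cov) hdot_selfadjoint exprn_ge0.
Qed.

Lemma iota_mono (f g : CX) v : (forall x, f x <= g x) ->
  hdot H (p (iota f) v) v <= hdot H (p (iota g) v) v.
Proof.
move=> fg; rewrite -subr_ge0 -linearBl -ropB -covB; apply: iota_ge0 => x.
by rewrite !ctsE mulN1r subr_ge0.
Qed.

Lemma iota_sqr (f : CX) v :
  hdot H (p (iota (ctsM (cts_conj f) f)) v) v = `|p (iota f) v| ^+ 2.
Proof. by rewrite (covM cov) (cov_star cov) hdot_selfadjoint. Qed.

Lemma hdot_iota (f : CX) u v :
  hdot H (p (iota f) u) v = hdot H u (p (iota (cts_conj f)) v).
Proof. by rewrite (cov_star cov) hdot_starr. Qed.

Lemma ropU_norm v : `|p U v| = `|v|.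
Proof.
apply/eqP; rewrite -(@eqrXn2 _ 2)// -!hdot_norm; apply/eqP.
rewrite hdot_starr. rewrite -(ropM p).
by rewrite (cov_unitaryl cov) rop1.
Qed.

Lemma ropUstar_norm v : `|p (cstar U) v| = `|v|.
Proof. by rewrite -(ropU_norm (p (cstar U) v)) -ropM (cov_unitaryr cov) rop1. Qed.

Lemma ropU_inj u v : p U u = p U v -> u = v.
Proof.
by move=> /(congr1 (p (cstar U))); rewrite -!ropM (cov_unitaryl cov) !rop1.
Qed.

End OneRepresentation.

End CovariantPairs.

Section Generation.
Variables (R : realType) (X : topologicalType) (phi : continuousType X X).
Variables (A : cstarAlg R) (iota : continuousType X R[i] -> A) (U : A).
Hypothesis cp : is_crossed_product phi iota U.

(** The left multipliers of [S] form a closed *-algebra once the adjoint is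
    built in, so no multiplicative property of [S] has to be checked. *)
Lemma crossed_product_ind (S : set A) : closed S ->
  (forall (c : R[i]) a b, S a -> S b -> S (c *: a + b)) ->
  S (cone A) ->
  (forall f a, S a -> S (iota f ** a)) ->
  (forall a, S a -> S (U ** a)) ->
  (forall a, S a -> S (cstar U ** a)) ->
  forall a, S a.
Proof.
move=> cS lS S1 Sf SU SUs.
have S0 : S 0 by have := lS (-1) _ _ S1 S1; rewrite scaleN1r addNr.
pose M := [set a | forall b, S b -> S (a ** b)].
have cM : closed M.
  have -> : M = \bigcap_(b in S) ((fun a => a ** b) @^-1` S).
    by apply/seteqP; split => a aM b; exact: aM.
  apply: closed_bigI => b _.
  by move/continuous_closedP : (@cmul_continuous_l R A b); apply.
pose T := M `&` (@cstar R A @^-1` M).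
have cT : closed T.
  apply: closedI => //.
  by move/continuous_closedP : (@cstar_continuous R A); apply.
have Mlin (c : R[i]) a b : M a -> M b -> M (c *: a + b).
  by move=> aM bM d Sd; rewrite cmulDl cmulZl; apply: lS; [exact: aM|exact: bM].
have M0 : M 0 by move=> d _; rewrite cmul0l.
have M1 : M (cone A) by move=> d; rewrite cmul1l.
have MM a b : M a -> M b -> M (a ** b).
  by move=> aM bM d Sd; rewrite -cmulA; apply: aM; exact: bM.
have aT : star_subalgebra T.
  split => [a b [aM aM'] [bM bM']|c a [aM aM']|a b [aM aM'] [bM bM']||a [aM aM']];
    split; rewrite /= ?cstarD ?cstarM ?cstarZ ?cstar1 ?cstarK//.
  - by rewrite -[a]scale1r; exact: Mlin.
  - by rewrite -[cstar a]scale1r; exact: Mlin.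
  - by rewrite -[_ *: a]addr0; exact: Mlin.
  - by rewrite -[_ *: cstar a]addr0; exact: Mlin.
  - exact: MM.
  - exact: MM.
have TT : T = setT.
  apply: (cp_generated cp cT aT) => [f|]; split => //= b Sb.
  - exact: Sf.
  - by rewrite -(cov_star (cp_covariant cp)); exact: Sf.
by move=> a; have [aM _] : T a; [rewrite TT|rewrite -[a]cmul1r; exact: aM].
Qed.

Section InvariantSubspaces.
Variables (H : hilbert R) (p : representation A H).

Lemma invariant_crossed_product (W : set H) : closed_subspace W ->
  (forall f v, W v -> W (p (iota f) v)) ->
  (forall v, W v -> W (p U v)) -> (forall v, W v -> W (p (cstar U) v)) ->
  forall a v, W v -> W (p a v).
Proof.
move=> Wsub Wf WU WUs a v Wv.
apply: (@crossed_product_ind [set a | W (p a v)]) => /=.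
- move/continuous_closedP : (@rop_continuous_alg _ _ _ p v); apply.
  exact: csub_closed.
- by move=> c a1 a2 W1 W2; rewrite ropD ropZ; exact: csub_lin.
- by rewrite rop1.
- by move=> f b Wb; rewrite ropM; exact: Wf.
- by move=> b Wb; rewrite ropM; exact: WU.
- by move=> b Wb; rewrite ropM; exact: WUs.
Qed.

Lemma commute_crossed_product c :
  (forall f v, p c (p (iota f) v) = p (iota f) (p c v)) ->
  (forall v, p c (p U v) = p U (p c v)) ->
  forall a v, p c (p a v) = p a (p c v).
Proof.
have cov := cp_covariant cp => cf cU a v.
apply: (@crossed_product_ind [set a | p c (p a v) = p a (p c v)]) => /=.
- apply: closed_eq_continuous; last exact: rop_continuous_alg.
  move=> b; apply: (continuous_comp (@rop_continuous_alg _ _ _ p v b)).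
  exact: rop_continuous.
- by move=> z b1 b2 e1 e2; rewrite !ropD !ropZ linearD linearZ/= e1 e2.
- by rewrite !rop1.
- by move=> f b e; rewrite !ropM cf e.
- by move=> b e; rewrite !ropM cU e.
- move=> b e; rewrite !ropM -e; apply: (ropU_inj cov (p := p)).
  by rewrite -[LHS]cU -[p U (p (cstar U) _)]ropM -[p U (p (cstar U) (p c _))]ropM
       (cov_unitaryr cov) !rop1.
Qed.

End InvariantSubspaces.

End Generation.

Section SchurLemma.
Variables (R : realType) (A : cstarAlg R) (H : hilbert R).
Variable p : representation A H.
Hypothesis irr : irreducible p.

(** Centrality is required only of the image of [c]: in the crossed product
    itself the unitary does not commute with the functions. *)
Definition central (c : A) := forall a v, p c (p a v) = p a (p c v).

Lemma central_closed : closed [set c | central c].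
Proof.
rewrite (_ : [set c | _] =
    \bigcap_(av in [set: A * H]) [set c | p c (p av.1 av.2) = p av.1 (p c av.2)]).
  apply: closed_bigI => -[a v] _ /=; apply: closed_eq_continuous.
    exact: rop_continuous_alg.
  move=> b; apply: (continuous_comp (@rop_continuous_alg _ _ _ p v b)).
  exact: rop_continuous.
by apply/seteqP; split => c h; [move=> [a v] _; exact: h|move=> a v; exact: (h (a, v))].
Qed.

Lemma hdot_eqP (u v : H) : (forall w, hdot H w u = hdot H w v) -> u = v.
Proof.
move=> uv; apply/eqP; rewrite -subr_eq0 -normr_eq0 -sqrf_eq0.
by rewrite -hdot_norm linearBr/= uv subrr.
Qed.

Lemma central_subalgebra : star_subalgebra [set c | central c].
Proof.
split => [a b ha hb|z a ha|a b ha hb||a ha] c v /=.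
- by rewrite !ropD ha hb linearD.
- by rewrite !ropZ ha linearZ.
- by rewrite !ropM hb ha.
- by rewrite !rop1.
- apply: hdot_eqP => w.
  by rewrite -(hdot_starr p a w) -(rop_star p c) -ha hdot_starr (rop_star p c).
Qed.

Lemma irreducible_central_ker c v0 : central c -> v0 <> 0 -> p c v0 = 0 ->
  forall v, p c v = 0.
Proof.
move=> cc v00 pv0; have [_ irrp] := irr.
have [||W0|WT] := irrp [set v | p c v = 0].
- split => [||z u v /= pu pv].
  + apply: closed_eq_continuous; last exact: cst_continuous.
    exact: rop_continuous.
  + by rewrite /= linear0.
  + by rewrite linearD linearZ/= pu pv scaler0 addr0.
- by move=> a v /= pv; rewrite cc pv linear0.
- by have : [set v | p c v = 0] v0 by []; rewrite W0 => /v00.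
- by move=> v; have : [set v | p c v = 0] v by rewrite WT.
Qed.

(** With [s] the absolute value of [k], the product of the central operators
    [s - k] and [s + k] is zero, and a central operator that is not injective
    vanishes. So [k = s] or [k = - s], and [s] is positive. *)
Lemma central_sign k : cstar k = k -> central k ->
  (forall v, 0 <= hdot H (p k v) v) \/ (forall v, hdot H (p k v) v <= 0).
Proof.
move=> ks kc.
wlog k1 : k ks kc / `|k| <= 1.
  move=> h; have [k0|k0] := eqVneq k 0.
    by left => v; rewrite k0 rop0 linear0l.
  have nk : 0 < `|k| by rewrite normr_gt0.
  have [|||hk|hk] := h (`|k|^-1 *: k).
  - by rewrite cstarZ ks geC0_conj// invr_ge0.
  - by move=> a v; rewrite !ropZ kc linearZ.
  - by rewrite normrZ normfV normr_id mulVf// gt_eqF.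
  - left => v; have := hk v; rewrite ropZ linearZl_LR/= pmulr_rge0//.
    by rewrite invr_gt0.
  - right => v; have := hk v; rewrite ropZ linearZl_LR/= pmulr_rle0//.
    by rewrite invr_gt0.
have [y [yc ys y1 yE]] := cabs central_closed central_subalgebra kc ks k1.
pose s := cone A - y; have sE : s ** s = k ** k by [].
have sc : central s.
  by move=> a v; rewrite !ropB !rop1 yc linearB.
have s0 v : 0 <= hdot H (p s v) v.
  rewrite ropB rop1 linearBl/= subr_ge0 hdot_norm.
  have yr : hdot H (p y v) v \is Num.real.
    by apply/CrealP; rewrite -hdotC hdot_starr ys.
  rewrite (le_trans (real_ler_norm yr))// (le_trans (hdot_CauchySchwarz _ _))//.
  rewrite expr2 ler_wpM2r// (le_trans (rop_contraction _ _ _))//.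
  by rewrite ler_piMl.
have [pk|/existsNP[v0 pv0]] := pselect (forall v, p (s + k) v = 0).
  right => v; have := s0 v; have /eqP := pk v.
  rewrite ropD addr_eq0 => /eqP ->; rewrite linearNl oppr_ge0//.
left => v; have : p (s - k) v = 0.
  apply: (@irreducible_central_ker (s - k) (p (s + k) v0)) => //; last first.
  have ss : p s (p s v0) = p k (p k v0) by rewrite -!ropM sE.
  by rewrite (ropB p s k) ropD (linearD (p s)) (linearD (p k)) sc ss [X in X - _]addrC subrr.

  by move=> a w; rewrite !(ropB p s k) sc kc linearB.
by rewrite ropB => /eqP; rewrite subr_eq0 => /eqP <-.
Qed.

(** Every shift [k - e] has a sign. At a unit vector [v0] this sign changes as
    [e] crosses [z = <k v0, v0>], hence [<k v, v> = z |v|^2] for all [v], and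
    polarization gives [k = z]. *)
Lemma central_selfadjoint_scalar k : cstar k = k -> central k ->
  exists z : R[i], forall v, p k v = z *: v.
Proof.
move=> ks kc; have [[v0 v00] _] := irr.
wlog n0 : v0 v00 / `|v0| = 1.
  move=> h; have nv : 0 < `|v0| by rewrite normr_gt0; exact/eqP.
  apply: (h (`|v0|^-1 *: v0)) => [/eqP|].
    by rewrite scaler_eq0 invr_eq0 gt_eqF//= => /eqP.
  by rewrite normrZ normfV normr_id mulVf// gt_eqF.
have kr v : hdot H (p k v) v \is Num.real.
  by apply/CrealP; rewrite -hdotC hdot_starr ks.
pose z := hdot H (p k v0) v0; have zr : z \is Num.real by exact: kr.
have dich (e : R[i]) : e \is Num.real ->
    (forall v, e * `|v| ^+ 2 <= hdot H (p k v) v) \/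
    (forall v, hdot H (p k v) v <= e * `|v| ^+ 2).
  move=> er; have [||h|h] := @central_sign (k - e *: cone A).
  - by rewrite cstarB cstarZ cstar1 ks (CrealP er).
  - by move=> a v; rewrite !ropB !ropZ !rop1 kc [RHS](linearB (p a)) [p a (e *: _)]linearZ.
  - left => v; have := h v.
    by rewrite ropB ropZ rop1 linearBl/= linearZl_LR/= hdot_norm subr_ge0.
  - right => v; have := h v.
    by rewrite ropB ropZ rop1 linearBl/= linearZl_LR/= hdot_norm subr_le0.
have zE v : hdot H (p k v) v = z * `|v| ^+ 2.
  have n2 : 0 <= `|v| ^+ 2 by rewrite exprn_ge0.
  have n1 : 0 < `|v| ^+ 2 + 1 by rewrite ltr_wpDl.
  have rr : z * `|v| ^+ 2 \is Num.real by rewrite realM// ger0_real.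
  apply/eqP; rewrite eq_le; apply/andP; split; apply/ler_addgt0Pr => e e0.
    have [|h|h] := dich (z + e / (`|v| ^+ 2 + 1)).
    - by rewrite realD// ger0_real// divr_ge0// ltW.
    - have := h v0; rewrite n0 expr1n mulr1.
      by rewrite -/z -[X in _ <= X -> _]addr0 lerD2l lt_geF// divr_gt0.
    - apply: le_trans (h v) _; rewrite mulrDl lerD2l -mulrA ler_piMr//; first exact: ltW.
      by rewrite ler_pdivrMl// mulr1 lerDl.
  have [|h|h] := dich (z - e / (`|v| ^+ 2 + 1)).
  - by rewrite realB// ger0_real// divr_ge0// ltW.
  - rewrite -lerBlDr; apply: le_trans (h v); rewrite mulrBl lerD2l lerN2.
    rewrite -mulrA ler_piMr//; first exact: ltW.
    by rewrite ler_pdivrMl// mulr1 lerDl.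
  - have := h v0; rewrite n0 expr1n mulr1.
    by rewrite -/z -[X in X <= _ -> _]addr0 lerD2l oppr_ge0 lt_geF// divr_gt0.
exists z => v; apply/eqP; rewrite -subr_eq0 -normr_eq0 -sqrf_eq0.
pose m := k - z *: cone A.
have mE u : p m u = p k u - z *: u by rewrite ropB ropZ rop1.
have ms u w : hdot H (p m u) w = hdot H u (p m w).
  by rewrite hdot_starr cstarB cstarZ cstar1 ks (CrealP zr).
have m0 u : hdot H (p m u) u = 0.
  by rewrite mE linearBl/= linearZl_LR/= zE hdot_norm subrr.
rewrite -mE -hdot_norm; have := m0 (v + p m v).
rewrite linearD/= linearDl !linearDr/= !m0 add0r addr0 [hdot H (p m (p m v)) v]ms -mulr2n => /eqP.
by rewrite mulrn_eq0.
Qed.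

Lemma central_scalar c : central c -> exists z : R[i], forall v, p c v = z *: v.
Proof.
move=> cc; have ccs := subalg_star central_subalgebra cc.
have [|a v|z1 h1] := @central_selfadjoint_scalar (c + cstar c).
- by rewrite cstarD cstarK addrC.
- by rewrite !ropD cc ccs [RHS]linearD.
have [|a v|z2 h2] := @central_selfadjoint_scalar ('i *: (c - cstar c)).
- by rewrite cstarZ cstarB cstarK conjCi scaleNr -scalerN opprB.
- by rewrite !ropZ !ropB cc ccs [p a (_ *: _)]linearZ/= [p a (_ - _)]linearB.
exists ((z1 - 'i * z2) / 2) => v.
have e1 : p c v + p (cstar c) v = z1 *: v by rewrite -ropD h1.
have e2 : p c v - p (cstar c) v = - 'i *: (z2 *: v).
  rewrite -h2 ropZ scalerA ropB mulNr -expr2 sqrCi opprK scale1r //.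
rewrite mulrC -scalerA scalerBl -[('i * z2) *: v]scalerA -scaleNr -e2 -e1.
rewrite addrACA subrr addr0 scalerDr -scalerDl.
by rewrite (_ : 2^-1 + 2^-1 = 1 :> R[i]) ?scale1r//; field.
Qed.

End SchurLemma.

(** * The C*-algebra of bounded operators *)

Section RealNorm.
Variables (R : realType) (V : normedModType R[i]).
Implicit Types u v : V.

Lemma rnormD u v : rnorm (u + v) <= rnorm u + rnorm v.
Proof. by rewrite -lecR rmorphD/= -!rnormE ler_normD. Qed.

Lemma rnormZ (c : R[i]) v : (rnorm (c *: v))%:C = `|c| * (rnorm v)%:C.
Proof. by rewrite -!rnormE normrZ. Qed.

Lemma rnorm0 : @rnorm R V 0 = 0.
Proof. by rewrite /rnorm normr0. Qed.

Lemma rnorm_eq0 v : rnorm v = 0 -> v = 0.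
Proof. by move=> v0; apply/eqP; rewrite -normr_eq0 rnormE v0. Qed.

End RealNorm.

Section BoundedOperators.
Variables (R : realType) (H : hilbert R).

(** Linearity is implied by the existence of an adjoint. *)
Definition adjointable (T : H -> H) :=
  exists T' : H -> H, exists2 M : R,
    (forall u v, hdot H (T u) v = hdot H u (T' v)) &
    (forall u, `|T u| <= M%:C * `|u|).

Lemma adjointable_comb (c : R[i]) S T : adjointable S -> adjointable T ->
  adjointable (fun v => c *: S v + T v).
Proof.
move=> [S' [M SS' SM]] [T' [N TT' TN]].
exists (fun v => c^*%R *: S' v + T' v); exists (rnorm (c : R[i]^o) * M + N) => [u v|u] /=.
  rewrite linearDl/= linearZl_LR/= SS' TT' linearDr/= linearZr_LR/=.
  by rewrite conjCK.
rewrite (le_trans (ler_normD _ _))// rmorphD mulrDl lerD// normrZ rmorphM/= -rnormE -mulrA.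
by rewrite ler_wpM2l.
Qed.

Lemma adjointable0 : adjointable (fun=> 0).
Proof.
exists (fun=> 0); exists 0 => [u v|u]; first by rewrite linear0l linear0r.
by rewrite normr0 mul0r.
Qed.

Record bop := Bop { bopval :> H -> H; _ : `[< adjointable bopval >] }.

HB.instance Definition _ := [isSub for bopval].
HB.instance Definition _ := gen_eqMixin bop.
HB.instance Definition _ := gen_choiceMixin bop.

Implicit Types S T : bop.

Lemma bopP T : adjointable T.
Proof. by case: T => T0 /= /asboolP. Qed.

Lemma bop_ext S T : (forall v, S v = T v) -> S = T.
Proof. by move=> ST; apply/val_inj/funext. Qed.

Definition bop_of (T : H -> H) (hT : adjointable T) : bop := Bop (introT (asboolP _) hT).

Definition bop_comb (c : R[i]) S T : bop := bop_of (adjointable_comb c (bopP S) (bopP T)).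

Let bop0 : bop := bop_of adjointable0.
Let bopadd S T := bop_comb 1 S T.
Let bopscale c T := bop_comb c T bop0.
Let bopopp T := bopscale (-1) T.

Let bopaddA : associative bopadd.
Proof. by move=> S T W; apply: bop_ext => v /=; rewrite !scale1r addrA. Qed.
Let bopaddC : commutative bopadd.
Proof. by move=> S T; apply: bop_ext => v /=; rewrite !scale1r addrC. Qed.
Let bopadd0 : left_id bop0 bopadd.
Proof. by move=> S; apply: bop_ext => v /=; rewrite scaler0 add0r. Qed.
Let bopaddN : left_inverse bop0 bopopp bopadd.
Proof. by move=> S; apply: bop_ext => v /=; rewrite scale1r scaleN1r addr0 addNr. Qed.

HB.instance Definition _ := GRing.isZmodule.Build bop bopaddA bopaddC bopadd0 bopaddN.

Let bopscaleA a b T : bopscale a (bopscale b T) = bopscale (a * b) T.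
Proof. by apply: bop_ext => v /=; rewrite !addr0 scalerA. Qed.
Let bopscale1 : left_id 1 bopscale.
Proof. by move=> T; apply: bop_ext => v /=; rewrite !addr0 scale1r. Qed.
Let bopscaleDr : right_distributive bopscale +%R.
Proof. by move=> a S T; apply: bop_ext => v /=; rewrite !addr0 !scale1r scalerDr. Qed.
Let bopscaleDl T : {morph bopscale^~ T : a b / a + b}.
Proof. by move=> a b; apply: bop_ext => v /=; rewrite !addr0 !scale1r scalerDl. Qed.

HB.instance Definition _ := GRing.Zmodule_isLmodule.Build R[i] bop
  bopscaleA bopscale1 bopscaleDr bopscaleDl.

Lemma bopDE S T v : (S + T) v = S v + T v.
Proof. by rewrite /= scale1r. Qed.
Lemma bopZE (c : R[i]) T v : (c *: T) v = c *: T v.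
Proof. by rewrite /= addr0. Qed.
Lemma bopNE T v : (- T) v = - T v.
Proof. by rewrite /= addr0 scaleN1r. Qed.
Lemma bopBE S T v : (S - T) v = S v - T v.
Proof. by rewrite bopDE bopNE. Qed.
Lemma bop0E v : (0 : bop) v = 0. Proof. by []. Qed.

Definition bop_adj_fun T : H -> H := projT1 (cid (bopP T)).

Lemma bop_adj_funP T u v : hdot H (T u) v = hdot H u (bop_adj_fun T v).
Proof. by rewrite /bop_adj_fun; case: cid => T' [M h _] /=; exact: h. Qed.

Lemma bop_linear T (c : R[i]) u v : T (c *: u + v) = c *: T u + T v.
Proof.
apply: hdot_eqP => w; rewrite hdotC bop_adj_funP -hdotC.
rewrite [RHS]hdotC !(linearDl, linearDr)/= !(linearZl_LR, linearZr_LR)/=.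
by rewrite rmorphD rmorphM/= !bop_adj_funP -!hdotC.
Qed.

Lemma bopZ T (c : R[i]) u : T (c *: u) = c *: T u.
Proof.
have T0 : T 0 = 0.
  by have := bop_linear T (-1) 0 0; rewrite scaler0 addr0 scaleN1r addNr.
by rewrite -[c *: u]addr0 bop_linear T0 addr0.
Qed.

Lemma bopD T u v : T (u + v) = T u + T v.
Proof. by rewrite -{1}[u]scale1r bop_linear scale1r. Qed.

Definition bop_unit_values T := [set rnorm (T u) | u in [set u | `|u| <= 1]].

Definition opnorm T : R := sup (bop_unit_values T).

Lemma bop_bounded T : exists2 M : R, 0 <= M & forall u, rnorm (T u) <= M * rnorm u.
Proof.
have [T' [M _ hM]] := bopP T; exists `|M| => [//|u].
rewrite (@le_trans _ _ (M * rnorm u))//; last by rewrite ler_wpM2r ?rnorm_ge0 ?ler_norm.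
by rewrite -lecR rmorphM/= -!rnormE.
Qed.

Lemma has_sup_opnorm T : has_sup (bop_unit_values T).
Proof.
split; first by exists (rnorm (T 0)); exists 0 => //=; rewrite normr0.
have [M M0 hM] := bop_bounded T.
exists M => _ [u /= + <-]; rewrite rnormE lecR => u1.
by rewrite (le_trans (hM u))// ler_piMr.
Qed.

Lemma opnorm_ge0 T : 0 <= opnorm T.
Proof.
apply: le_trans (rnorm_ge0 (T 0)) _; apply: sup_upper_bound.
  exact: has_sup_opnorm.
by exists 0 => //=; rewrite normr0.
Qed.

Lemma opnorm_ge T u : rnorm (T u) <= opnorm T * rnorm u.
Proof.
have [/rnorm_eq0 ->|u0] := eqVneq (rnorm u) 0.
  have [M M0 /(_ 0)] := bop_bounded T; rewrite rnorm0 mulr0 => h.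
  by rewrite mulr0.
have up : 0 < rnorm u by rewrite lt_def u0 rnorm_ge0.
have vc : (rnorm u)%:C^-1 * (rnorm u)%:C = 1 :> R[i].
  by rewrite mulVf// -rnormE normr_eq0; apply: contra_neq u0 => ->; rewrite rnorm0.
have n1 : `|(rnorm u)%:C^-1 *: u| = 1.
  by rewrite normrZ normfV [`|u|]rnormE ger0_norm ?lecR ?rnorm_ge0.
have : rnorm (T ((rnorm u)%:C^-1 *: u)) <= opnorm T.
  apply: sup_upper_bound; first exact: has_sup_opnorm.
  by exists ((rnorm u)%:C^-1 *: u) => //=; rewrite n1.
rewrite bopZ -lecR rnormZ normfV ger0_norm ?lecR ?rnorm_ge0// => h.
rewrite -lecR rmorphM/= -[leLHS]mul1r -vc mulrAC mulrC.
by rewrite mulrC ler_wpM2r// ?lecR ?rnorm_ge0.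
Qed.

Lemma opnorm_le T M : 0 <= M -> (forall u, rnorm (T u) <= M * rnorm u) -> opnorm T <= M.
Proof.
move=> M0 hM; apply: ge_sup; first by have [] := has_sup_opnorm T.
move=> _ [u /= + <-]; rewrite rnormE lecR => u1.
by rewrite (le_trans (hM u))// ler_piMr.
Qed.

Definition bop_norm T : R[i] := (opnorm T)%:C.

Let bop_normD S T : bop_norm (S + T) <= bop_norm S + bop_norm T.
Proof.
rewrite -rmorphD lecR; apply: opnorm_le => [|u]; first by rewrite addr_ge0 ?opnorm_ge0.
by rewrite bopDE (le_trans (rnormD _ _))// mulrDl lerD ?opnorm_ge.
Qed.

Let opnormZ_le (c : R[i]) T : bop_norm (c *: T) <= `|c| * bop_norm T.
Proof.
have -> : `|c| = (rnorm (c : R[i]^o))%:C by rewrite -rnormE.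
rewrite -rmorphM lecR; apply: opnorm_le => [|u].
  by rewrite mulr_ge0 ?opnorm_ge0 ?rnorm_ge0.
rewrite bopZE -lecR rnormZ !rmorphM/= -mulrA [`|c|]rnormE ler_wpM2l ?lecR ?rnorm_ge0//.
by rewrite -rmorphM lecR opnorm_ge.
Qed.

Let bop_normZ (c : R[i]) T : bop_norm (c *: T) = `|c| * bop_norm T.
Proof.
apply/eqP; rewrite eq_le opnormZ_le/=.
have [->|c0] := eqVneq c 0; first by rewrite normr0 mul0r /bop_norm lecR opnorm_ge0.
rewrite -ler_pdivlMl ?normr_gt0// -normfV.
by rewrite -{1}[T](scalerK c0) opnormZ_le.
Qed.

Let bop_norm_eq0 T : bop_norm T = 0 -> T = 0.
Proof.
move=> /(congr1 (@Re R)) /= T0; apply: bop_ext => v; rewrite bop0E.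
by apply: rnorm_eq0; apply/eqP; rewrite eq_le rnorm_ge0 andbT -(mul0r (rnorm v)) -T0 opnorm_ge.
Qed.

HB.instance Definition _ := @Lmodule_isNormed.Build R[i] bop bop_norm
  bop_normD bop_normZ bop_norm_eq0.

Lemma bop_normE T : `|T| = (opnorm T)%:C.
Proof. by []. Qed.

Lemma bop_norm_ge T u : `|T u| <= `|T| * `|u|.
Proof. by rewrite bop_normE !rnormE -rmorphM lecR opnorm_ge. Qed.

Lemma bop_norm_le T (M : R) : 0 <= M -> (forall u, `|T u| <= M%:C * `|u|) -> `|T| <= M%:C.
Proof.
move=> M0 h; rewrite bop_normE lecR; apply: opnorm_le => // u.
by rewrite -lecR rmorphM/= -!rnormE.
Qed.

Lemma bop_adj_fun_norm T u : `|bop_adj_fun T u| <= (opnorm T)%:C * `|u|.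
Proof.
have [->|u0] := eqVneq (bop_adj_fun T u) 0.
  by rewrite normr0 mulr_ge0 ?lecR ?opnorm_ge0.
rewrite -(@ler_pM2r _ `|bop_adj_fun T u|) ?normr_gt0// -expr2 -hdot_norm -bop_adj_funP.
have := hdot_CauchySchwarz (T (bop_adj_fun T u)) u.
rewrite bop_adj_funP hdot_norm normrX normr_id => h; rewrite (le_trans h)//.
by rewrite mulrAC ler_wpM2r//; exact: bop_norm_ge.
Qed.

Lemma bop_adj_subproof T : adjointable (bop_adj_fun T).
Proof.
exists T; exists (opnorm T) => [u v|u].
  by rewrite hdotC -bop_adj_funP -hdotC.
exact: bop_adj_fun_norm.
Qed.

Definition bop_adj T : bop := bop_of (bop_adj_subproof T).

Lemma bop_adjP T u v : hdot H (T u) v = hdot H u (bop_adj T v).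
Proof. exact: bop_adj_funP. Qed.

Lemma bop_adj_norm T u : `|bop_adj T u| <= (opnorm T)%:C * `|u|.
Proof.
exact: bop_adj_fun_norm.
Qed.

Lemma bop_adj_unique S T : (forall u v, hdot H (T u) v = hdot H u (S v)) -> bop_adj T = S.
Proof.
by move=> h; apply: bop_ext => v; apply: hdot_eqP => w; rewrite -bop_adjP h.
Qed.

Lemma bop_comp_subproof S T : adjointable (S \o T).
Proof.
exists (bop_adj T \o bop_adj S); exists (opnorm S * opnorm T) => [u v|u] /=.
  by rewrite !bop_adjP.
rewrite (le_trans (bop_norm_ge _ _))// rmorphM/= -mulrA -!bop_normE ler_wpM2l//.
exact: bop_norm_ge.
Qed.

Definition bop_comp S T : bop := bop_of (bop_comp_subproof S T).

Lemma bop_id_subproof : adjointable id.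
Proof. by exists id; exists 1 => // u; rewrite mul1r. Qed.

Definition bop_id : bop := bop_of bop_id_subproof.

Lemma bop_complete (F : set_system bop) : ProperFilter F -> cauchy F -> cvg F.
Proof.
move=> FF /cauchy_ballP Fc.
have ev (g : bop -> H -> H) : (forall S T u, `|g S u - g T u| <= `|S - T| * `|u|) ->
    forall u, cvg ((fun T : bop => g T u) @ F).
  move=> gl u; apply: cauchy_cvg; apply/cauchy_ballP => e e0.
  have p0 : 0 < `|u| + 1 by rewrite ltr_wpDl.
  have [/= [P Q] [FP FQ] PQ] := Fc _ (divr_gt0 e0 p0).
  exists ((fun T : bop => g T u) @` P, (fun T : bop => g T u) @` Q) => /=.
    split; [apply: filterS FP|apply: filterS FQ] => x ?; by exists x.
  move=> [_ _] /= [[S PS <-] [T QT <-]].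
  have := PQ (S, T) (conj PS QT); rewrite -!ball_normE /ball_/= => ST.
  apply: le_lt_trans (gl _ _ _) _.
  apply: (@le_lt_trans _ _ (`|S - T| * (`|u| + 1))); first by rewrite ler_wpM2l ?lerDl.
  by rewrite -ltr_pdivlMr.
have bop_adjB S T : bop_adj S - bop_adj T = bop_adj (S - T).
  apply/esym/bop_adj_unique => u v.
  by rewrite !bopBE linearBl linearBr/= !bop_adjP.
have cv : forall u, cvg ((fun T : bop => T u) @ F).
  by apply: ev => S T u; rewrite -bopBE; exact: bop_norm_ge.
have cv' : forall u, cvg ((fun T : bop => bop_adj T u) @ F).
  by apply: ev => S T u; rewrite -bopBE bop_adjB bop_normE; exact: bop_adj_norm.
pose h u := lim ((fun T : bop => T u) @ F).
pose h' u := lim ((fun T : bop => bop_adj T u) @ F).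
have key (e : R) : 0 < e -> \forall T \near F, forall u, `|(T : bop) u - h u| <= e%:C * `|u|.
  move=> e0; have e0' : 0 < e%:C by rewrite ltcR.
  have [/= [P Q] [FP FQ] PQ] := Fc _ e0'.
  apply: filterS FP => T PT u.
  have -> : e%:C * `|u| = (e * rnorm u)%:C by rewrite rmorphM/= -rnormE.
  have cvu : (fun S : bop => T u - S u) @ F --> T u - h u.
    by apply: cvgB; [exact: cvg_cst|exact: cv].
  have cl : closed [set w : H | `|w| <= (e * rnorm u)%:C].
    by apply: (@closed_norm_le R H H id) => w; exact: cvg_id.
  apply: (closed_cvg _ cl _ _ cvu).
  apply: filterS FQ => S QS /=; have := PQ (T, S) (conj PT QS).
  rewrite -ball_normE /ball_/= => TS; rewrite -bopBE (le_trans (bop_norm_ge _ _))//.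
  by rewrite rmorphM/= -rnormE ler_wpM2r// ltW.
have hP : adjointable h.
  have /filter_ex[T0 T0P] := key 1 ltr01.
  exists h'; exists (opnorm T0 + 1) => [u v|u].
    apply: (@cvg_unique _ (@norm_hausdorff _ R[i]) ((fun T : bop => hdot H (T u) v) @ F)).
      apply: (@cvg_comp _ _ _ (fun T : bop => T u) (fun w => hdot H w v) F (nbhs (h u))).
        exact: cv.
      exact: hdot_continuous_l.
    rewrite (_ : (fun T : bop => hdot H (T u) v) = (fun T : bop => hdot H u (bop_adj T v))); last first.
      by apply/funext => T; rewrite bop_adjP.
    apply: (@cvg_comp _ _ _ (fun T : bop => bop_adj T v) (fun w => hdot H u w) F (nbhs (h' v))).
      exact: cv'.
    exact: hdot_continuous_r.
  have -> : h u = T0 u - (T0 u - h u) by rewrite opprB addrC subrK.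
  rewrite (le_trans (ler_normB _ _))// rmorphD mulrDl.
  by apply: lerD; [exact: bop_norm_ge|exact: T0P].
apply/cvg_ex; exists (bop_of hP); apply/cvgrPdist_le => e /gt0_complex[e0 ->].
apply: filterS (key _ e0) => T TP; apply: bop_norm_le; first exact: ltW.
by move=> u; rewrite bopBE distrC TP.
Qed.

HB.instance Definition _ := Uniform_isComplete.Build bop bop_complete.

Lemma bop_cnormM S T : `|bop_comp S T| <= `|S| * `|T|.
Proof.
rewrite !bop_normE -rmorphM; apply: bop_norm_le => [|u]; first by rewrite mulr_ge0 ?opnorm_ge0.
apply: le_trans (bop_norm_ge S (T u)) _.
rewrite rmorphM/= -mulrA -!bop_normE; apply: ler_wpM2l => //.
exact: bop_norm_ge.
Qed.

Lemma bop_cnorm_star T : `|bop_comp (bop_adj T) T| = `|T| ^+ 2.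
Proof.
have adjle S : `|bop_adj S| <= `|S|.
  by rewrite [X in _ <= X]bop_normE; apply: (bop_norm_le (opnorm_ge0 _)) => u; exact: bop_adj_norm.
apply/eqP; rewrite eq_le (le_trans (bop_cnormM _ _))/=; last first.
  by rewrite expr2 ler_wpM2r.
set C := bop_comp _ _.
have h u : `|T u| ^+ 2 <= `|C| * `|u| ^+ 2.
  rewrite -hdot_norm bop_adjP hdotC -[leLHS]ger0_norm; last first.
    by rewrite -hdotC -bop_adjP hdot_norm exprn_ge0.
  rewrite norm_conjC (le_trans (hdot_CauchySchwarz _ _))// expr2 mulrA.
  by apply: ler_wpM2r => //; exact: (bop_norm_ge C u).
have : `|T| <= (Num.sqrt (opnorm C))%:C.
  apply: (bop_norm_le (sqrtr_ge0 _)) => u.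
  rewrite -(@ler_pXn2r _ 2) ?nnegrE ?mulr_ge0 ?lecR ?sqrtr_ge0// exprMn -rmorphXn/=.
  rewrite sqr_sqrtr ?opnorm_ge0//; exact: (h u).
move=> hT; apply: (@le_trans _ _ ((Num.sqrt (opnorm C))%:C ^+ 2)).
  by rewrite !expr2; apply: ler_pM.
by rewrite -rmorphXn/= sqr_sqrtr ?opnorm_ge0.
Qed.

Definition bounded_operators : cstarAlg R.
Proof.
refine (@CStarAlg R bop bop_comp bop_id bop_adj _ _ _ _ _ _ _ _ _ _ _ bop_cnormM bop_cnorm_star).
- by move=> S T W; apply: bop_ext.
- by move=> S; apply: bop_ext.
- by move=> S; apply: bop_ext.
- by move=> S T W; apply: bop_ext => v; rewrite [RHS]bopDE; exact: bopDE.
- by move=> S T W; apply: bop_ext => v; rewrite [RHS]bopDE; exact: etrans (congr1 S (bopDE T W v)) (bopD S (T v) (W v)).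
- by move=> c S T; apply: bop_ext => v; rewrite [RHS]bopZE; exact: bopZE.
- by move=> c S T; apply: bop_ext => v; rewrite [RHS]bopZE; exact: etrans (congr1 S (bopZE c T v)) (bopZ S c (T v)).
- by move=> S; apply: bop_adj_unique => u v; rewrite hdotC -bop_adjP -hdotC.
- by move=> S T; apply: bop_adj_unique => u v; rewrite !bopDE linearDl linearDr/= !bop_adjP.
- move=> c S; apply: bop_adj_unique => u v.
  by rewrite !bopZE linearZl_LR linearZr_LR/= bop_adjP conjCK.
- by move=> S T; apply: bop_adj_unique => u v /=; rewrite !bop_adjP.
Defined.

Lemma representation_of_hom (A : cstarAlg R) (h : A -> bounded_operators) :
  star_hom h -> exists p : representation A H, forall a v, p a v = (h a : bop) v.
Proof.
move=> hh.
have lin a : linear (fun v => (h a : bop) v).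
  by move=> c u v; rewrite bop_linear.
pose op a : {linear H -> H} := HB.pack (fun v => (h a : bop) v)
  (GRing.isLinear.Build _ _ _ _ _ (lin a)).
have opc a : continuous (op a).
  apply: (@dist_continuous _ _ _ _ `|(h a : bop)|) => u v.
  by rewrite -linearB; exact: bop_norm_ge.
unshelve eexists (@Representation R A H op opc _ _ _ _ _).
- by move=> a b v; rewrite /= (star_homD hh) bopDE.
- by move=> c a v; rewrite /= (star_homZ hh) bopZE.
- by move=> a b v; rewrite /= (star_homM hh).
- by move=> v; rewrite /= (star_hom1 hh).
- by move=> a u v; rewrite /= (star_hom_star hh) [LHS]hdotC -(bop_adjP (h a)) -hdotC.
by [].
Qed.

End BoundedOperators.

(** * Compactness of the disk and domination of functions *)

Section CompactDomination.
Variables (R : realType) (X : topologicalType).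
Local Notation CX := (continuousType X R[i]).
Hypothesis cX : compact [set: X].

(** If [P] failed on the whole space, the complements of the sets satisfying
    [P] would form a filter without cluster point. *)
Lemma compact_ind (P : set X -> Prop) : P set0 ->
  (forall A B, A `<=` B -> P B -> P A) ->
  (forall A B, P A -> P B -> P (A `|` B)) ->
  (forall x : X, exists2 B, nbhs x B & P B) -> P setT.
Proof.
move=> P0 Psub PU Ploc; apply: contrapT => PT.
pose F : set_system X := [set A | P (~` A)].
have FF : ProperFilter F.
  split; first by rewrite /F/= setC0.
  split; first by rewrite /F/= setCT.
    by move=> A B FA FB; rewrite /F/= setCI; exact: PU.
  by move=> A B AB; apply: Psub; exact: subsetC.
have [|x [_ xF]] := cX FF; first by rewrite /F/= setCT.
have [B xB PB] := Ploc x.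
have FB : F (~` B) by rewrite /F/= setCK.
by have [y []] := xF _ _ FB xB.
Qed.

(** Near a zero of [f] the constant [e] suffices, elsewhere a member of [G]
    does; compactness sums finitely many members. It serves twice: with
    multiples of [|z - x|^2] to control [f - f(x)], and with the nonnegative
    functions of an ideal to show that the ideal is determined by its zeros. *)
Lemma compact_domination (G : set CX) (f : CX) (e : R) :
  0 < e -> G (cst 0) -> (forall g h, G g -> G h -> G (ctsD g h)) ->
  (forall g, G g -> forall x, 0 <= g x) ->
  (forall x, f x = 0 \/ exists2 g, G g & `|f x| ^+ 2 < g x) ->
  exists2 g, G g & forall x, `|f x| ^+ 2 <= e%:C + g x.
Proof.
move=> e0 G0 GD Gge0 fG.
have e0' : 0 <= e%:C by rewrite lecR ltW.
pose P (B : set X) := exists2 g, G g & forall x, B x -> `|f x| ^+ 2 <= e%:C + g x.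
suff [g Gg gP] : P setT by exists g => // x; exact: gP.
apply: compact_ind.
- by exists (cst 0).
- by move=> A B AB [g Gg gP]; exists g => // x /AB; exact: gP.
- move=> A B [g Gg gP] [h Gh hP]; exists (ctsD g h); first exact: GD.
  by move=> x [/gP|/hP] /le_trans; apply; rewrite ctsDE lerD2l ?lerDl ?lerDr Gge0.
move=> x; have FF := nbhs_filter x.
have cf2 : (fun y => rnorm (f y : R[i]^o) ^+ 2) @ x --> rnorm (f x : R[i]^o) ^+ 2.
  rewrite expr2; under eq_fun do rewrite expr2.
  have cf : (fun y => rnorm (f y : R[i]^o)) @ x --> rnorm (f x : R[i]^o).
    apply: (@continuous_comp _ _ _ f (@rnorm R R[i]^o)); first exact: cts_fun.
    exact: rnorm_continuous.
  by apply: cvgM.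
have fE y : `|f y| ^+ 2 = (rnorm (f y : R[i]^o) ^+ 2)%:C.
  by rewrite rmorphXn/= -rnormE.
have [fx0|[g Gg fg]] := fG x.
  exists [set y | rnorm (f y : R[i]^o) ^+ 2 < e].
    by apply: (cvgr_lt _ cf2); rewrite fx0 rnorm0 expr0n.
  exists (cst 0) => // y /= ye; rewrite /cst/= addr0 fE lecR; exact: ltW.
have gE y : g y = (Re (g y))%:C by apply: ge0_complex; exact: Gge0.
have cg : (fun y => Re (g y) - rnorm (f y : R[i]^o) ^+ 2) @ x -->
    Re (g x) - rnorm (f x : R[i]^o) ^+ 2.
  apply: cvgB => //.
  by apply: (@continuous_comp _ _ _ g (@Re R)); [exact: cts_fun|exact: continuous_Re].
exists [set y | 0 < Re (g y) - rnorm (f y : R[i]^o) ^+ 2].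
  by apply: (cvgr_gt _ cg); rewrite subr_gt0 -ltcR -fE -gE.
exists g => // y /=; rewrite subr_gt0 -ltcR -fE -gE => /ltW /le_trans; apply.
by rewrite lerDr.
Qed.

End CompactDomination.

Section DiskTopology.
Variable R : realType.

Lemma disk_norm_le1 (z : disk R) : `|set_val z| <= 1.
Proof. by have := valP z; rewrite inE. Qed.

Lemma nbhs_subsetP (D : set R[i]) (z : D) (P : set D) : nbhs z P ->
  exists2 d : R, 0 < d & forall w : D, `|set_val w - set_val z| < d%:C -> P w.
Proof.
rewrite nbhsE => -[B [oB Bz] BP].
have [W oW WB] : exists2 W : set R[i], open W & set_val @^-1` W = B by [].
have Wz : W (set_val z) by move: Bz; rewrite -WB.
have : nbhs (set_val z) W by exact: open_nbhs_nbhs.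
move=> /nbhs_normP[d /= /gt0_complex[d0 dE] dW]; exists (Re d) => // w wz.
by apply: BP; rewrite -WB /=; apply: dW; rewrite /= distrC dE.
Qed.

Lemma disk_compact : compact [set: disk R].
Proof.
move=> F FF _.
pose Q : set (R * R)%type := [set p | p.1 ^+ 2 + p.2 ^+ 2 <= 1].
have cS : compact (`[-1, 1]%classic `*` `[-1, 1]%classic : set (R * R)%type).
  by apply: compact_setX; exact: segment_compact.
have cQ : compact Q.
  apply: subclosed_compact cS _.
    have /continuous_closedP : continuous (fun p : R * R => p.1 ^+ 2 + p.2 ^+ 2).
      move=> p; rewrite /continuous_at !expr2.
      under eq_fun do rewrite !expr2.
      by apply: cvgD; apply: cvgM; (exact: cvg_fst || exact: cvg_snd).
    by move=> /(_ _ (@closed_le _ 1)).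
  move=> [a b]; rewrite /Q/= !in_itv/= => ab.
  by split; apply/andP; split; nra.
pose c (z : disk R) : R * R := (Re (set_val z), Im (set_val z)).
have sqn1 (z : R[i]) : (`|z| <= 1) = (Re z ^+ 2 + Im z ^+ 2 <= 1).
  rewrite -(@ler_pXn2r _ 2) ?nnegrE// expr1n -add_Re2_Im2.
  by rewrite lecR.
have cQF : (c @ F) Q.
  suff : F [set z | Q (c z)] by [].
  apply: (@filterS _ F _ setT) => [z _|]; last exact: filterT.
  by have := disk_norm_le1 z; rewrite sqn1.
have [p [Qp pF]] := cQ _ _ cQF.
have zP : p.1 +i* p.2 \in disk R.
  by rewrite inE /disk/= sqn1.
exists (SigSub zP); split => // A B FA /nbhs_subsetP[d d0 dB].
have d2 : 0 < d / 2 by rewrite divr_gt0.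
have cA : (c @ F) (c @` A).
  by apply: (@filterS _ F _ A) => // z Az; exists z.
have pB : nbhs p (ball p.1 (d / 2) `*` ball p.2 (d / 2)).
  by exists (ball p.1 (d / 2), ball p.2 (d / 2)) => //; split; exact: nbhsx_ballx.
have [_ [[z Az <-] [/= b1 b2]]] := pF _ _ cA pB.
exists z; split => //; apply: dB; rewrite /= distrC.
apply: le_lt_trans (le_normc_ReIm _) _; rewrite ltcR [d]splitr.
by move: (set_val z) b1 b2 => [x y] /=; rewrite /ball/=; exact: ltrD.
Qed.

End DiskTopology.

(** * Normal form of the automorphism *)

Section Moebius.
Variable R : realType.
Implicit Types (z w : disk R) (r : R).

Lemma moebius_den r z : -1 < r < 1 -> 1 + r%:C * set_val z != 0.
Proof.
move=> /andP[r1 r2]; have := disk_norm_le1 z; case: (set_val z) => a b.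
rewrite -(@ler_pXn2r _ 2) ?nnegrE// expr1n -add_Re2_Im2 lecR/= => h.
apply/eqP => e.
have e1 : 1 + r * a = 0 by have := congr1 (@Re R) e; rewrite /= mul0r subr0.
have e2 : r * b = 0 by have := congr1 (@Im R) e; rewrite /= mul0r addr0 add0r.
by nra.
Qed.

Lemma moebius_subproof r z : -1 < r < 1 ->
  `|(set_val z + r%:C) / (1 + r%:C * set_val z)| <= 1.
Proof.
move=> rr; have := moebius_den z rr; case/andP: rr => [r1 r2].
have := disk_norm_le1 z; case: (set_val z) => a b h d0.
rewrite normrM normfV ler_pdivrMr ?normr_gt0// mul1r.
rewrite -(@ler_pXn2r _ 2) ?nnegrE// -!add_Re2_Im2 lecR/=.
move: h; rewrite -(@ler_pXn2r _ 2) ?nnegrE// expr1n -add_Re2_Im2 lecR/= => h.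
have r0 : 0 <= 1 - r ^+ 2 by nra.
have ab0 : 0 <= 1 - (a ^+ 2 + b ^+ 2) by lra.
by have := mulr_ge0 r0 ab0; lra.
Qed.

Definition moebius_fun r (rr : -1 < r < 1) z : disk R :=
  SigSub (mem_set (moebius_subproof z rr : disk R _)).

Lemma moebius_continuous r (rr : -1 < r < 1) : continuous (moebius_fun rr).
Proof.
apply: (@continuous_comp_initial (disk R) _ R[i] (@set_val _ (disk R))) => z.
have FF := nbhs_filter (z : disk R); apply: (@cvgM R[i] _ _ _ (fun w : disk R => set_val w + r%:C)
  (fun w : disk R => (1 + r%:C * set_val w)^-1)
  (set_val z + r%:C) (1 + r%:C * set_val z)^-1).
  by apply: (@cvgD R[i] R[i]); [exact: disk_coord_subproof|exact: cvg_cst].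
apply: (@cvgV R[i]); first exact: moebius_den.
apply: (@cvgD R[i] R[i]); first exact: cvg_cst.
by apply: (@cvgM R[i]); [exact: cvg_cst|exact: disk_coord_subproof].
Qed.

Definition moebius r (rr : -1 < r < 1) : continuousType (disk R) (disk R) :=
  mkcts (@moebius_continuous r rr).

Lemma disk_ext z w : set_val z = set_val w -> z = w.
Proof. exact: val_inj. Qed.

Lemma moebius_val r (rr : -1 < r < 1) z :
  set_val (moebius rr z) = (set_val z + r%:C) / (1 + r%:C * set_val z).
Proof. by []. Qed.

Lemma moebius_opp r : -1 < r < 1 -> -1 < - r < 1.
Proof. by move=> /andP[? ?]; apply/andP; split; lra. Qed.

Lemma moebiusK r (rr : -1 < r < 1) (rr' : -1 < - r < 1) : cancel (moebius rr) (moebius rr').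
Proof.
move=> z; apply: disk_ext; rewrite !moebius_val.
have := moebius_den (moebius rr z) rr'; rewrite moebius_val.
have := moebius_den z rr; set x := set_val z; rewrite !rmorphN => d1 d2.
have r2 : 1 - r%:C ^+ 2 != 0.
  case/andP: rr => ? ?; rewrite -rmorphXn -(rmorph1 (@real_complex R)) -rmorphB.
  by rewrite fmorph_eq0; apply: lt0r_neq0; nra.
have e1 : (x + r%:C) / (1 + r%:C * x) - r%:C = x * (1 - r%:C ^+ 2) / (1 + r%:C * x).
  by field.
have e2 : 1 - r%:C * ((x + r%:C) / (1 + r%:C * x)) = (1 - r%:C ^+ 2) / (1 + r%:C * x).
  by field.
by rewrite mulNr e1 e2; field; rewrite d1 r2.
Qed.

End Moebius.

Section DiskPoints.
Variable R : realType.
Implicit Types z w : disk R.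

Lemma disk_sign_val b : set_val (disk_sign R b) = (-1) ^+ b.
Proof. by []. Qed.

Lemma puncturedP z : z \in punctured_disk R <-> set_val z != 1 /\ set_val z != -1.
Proof.
rewrite inE; split=> [h|[h1 h2] b zb].
  by split; apply/eqP => e; [apply: (h false)|apply: (h true)]; apply: disk_ext;
    rewrite e disk_sign_val ?expr0 ?expr1.
by case: b zb h1 h2 => -> ; rewrite disk_sign_val ?expr0 ?expr1 eqxx.
Qed.

Lemma punctured_cases z : z \in punctured_disk R \/ exists b, z = disk_sign R b.
Proof.
have [?|h] := boolP (z \in punctured_disk R); first by left.
right; move: h; rewrite notin_setE => /existsNP[b /contrapT zb]; by exists b.
Qed.

End DiskPoints.

Section HyperbolicNormalForm.
Variables (R : realType) (phi : continuousType (disk R) (disk R)).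
Hypothesis hyp : hyperbolic_automorphism phi.
Hypothesis fix1 : forall b : bool, phi (disk_sign R b) = disk_sign R b.

(** Evaluating at the two fixed points forces the rotation to be trivial and
    the centre to be real. *)
Lemma hyperbolic_normal_form : exists r, exists rr : -1 < r < 1, r != 0 /\ phi = moebius rr.
Proof.
have [[theta [z0 [z01 hphi]]] [a [b [ab fixP]]]] := hyp.
set c := cis _ in hphi.
have d0 (s : R[i]) : `|s| = 1 -> 1 - z0^*%R * s != 0.
  move=> s1; apply/eqP => /subr0_eq e.
  have : `|z0^*%R * s| = 1 by rewrite -e normr1.
  by rewrite normrM s1 mulr1 norm_conjC => e'; rewrite e' ltxx in z01.
have e1 : 1 - z0^*%R = c * (1 - z0).
  have := hphi (disk_sign R false); rewrite fix1 disk_sign_val expr0 mulr1 => e.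
  have n0 := d0 1 (normr1 _); rewrite mulr1 in n0.
  by have := congr1 (fun x => x * (1 - z0^*%R)) e; rewrite mul1r -mulrA divfK.
have e2 : 1 + z0^*%R = c * (1 + z0).
  have := hphi (disk_sign R true); rewrite fix1 disk_sign_val expr1 => e.
  have n0 := d0 (-1) (normrN1 _); rewrite mulrN1 opprK in n0 e.
  have : - (1 + z0^*%R) = c * (-1 - z0) by have := congr1 (fun x => x * (1 + z0^*%R)) e; rewrite mulN1r -mulrA divfK.
  by rewrite -[-1 - z0]opprD mulrN => /oppr_inj.
have c1 : c = 1.
  have : 2 = c * 2 by rewrite [LHS](_ : _ = (1 - z0^*%R) + (1 + z0^*%R)); [rewrite e1 e2; ring|ring].
  by move=> /(congr1 (fun x => x / 2)); rewrite -mulrA divff ?mulr1// pnatr_eq0.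
have zr : z0^*%R = z0 by move: e2; rewrite c1 mul1r => /addrI.
have zE : z0 = (Re z0)%:C by case: (z0) zr => x y [] e; rewrite -(_ : 0 = y)//; lra.
pose r := - Re z0.
have rr : -1 < r < 1.
  move: z01; rewrite zE normc_def/= expr0n addr0 sqrtr_sqr ltcR ltr_norml /r.
  by case/andP => ? ?; apply/andP; split; lra.
exists r, rr; split.
  apply/eqP => r0.
  have allfix z : phi z = z.
    apply: disk_ext; rewrite hphi c1 mul1r zr zE -[Re z0]opprK -/r r0 oppr0.
    by rewrite subr0 mul0r subr0 divr1.
  have z0P : (0 : R[i]) \in disk R by rewrite inE /disk/= normr0 ler01.
  pose o : disk R := SigSub z0P.
  have /fixP h1 := allfix (disk_sign R false).
  have /fixP h2 := allfix (disk_sign R true).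
  have /fixP h3 := allfix o.
  have s0 : set_val o = 0 by [].
  have ob d : o <> disk_sign R d.
    by move=> /(congr1 (@set_val _ _)) /esym/eqP; rewrite disk_sign_val s0 signr_eq0.
  have n1 : disk_sign R false <> disk_sign R true.
    move=> /(congr1 (@set_val _ _)) /eqP; rewrite !disk_sign_val expr0 expr1.
    by rewrite eq_sym -addr_eq0 addrC || rewrite -subr_eq0 opprK -mulr2n pnatr_eq0.
  case: h1 => h1; case: h2 => h2; try by apply: n1; rewrite h1 h2.
    by case: h3 => h3; [apply: (ob false); rewrite h3 h1|apply: (ob true); rewrite h3 h2].
  by case: h3 => h3; [apply: (ob true); rewrite h3 h2|apply: (ob false); rewrite h3 h1].
apply/continuousEP => z; apply: disk_ext; rewrite moebius_val hphi c1 mul1r zr.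
by rewrite {1 2}zE /r rmorphN mulNr.
Qed.

End HyperbolicNormalForm.

(** * Linearizing coordinates on the punctured disk *)

Section CayleyCoordinate.
Variable R : realType.
Implicit Types (z w : disk R) (r : R).

Lemma rnormM (x y : R[i]) : rnorm (x * y) = rnorm x * rnorm y.
Proof.
apply: (@complexI R); rewrite rmorphM/= -!rnormE.
exact: normrM.
Qed.

Lemma rnormr (x : R) : rnorm (x%:C : R[i]) = `|x|.
Proof. by rewrite /rnorm normc_def/= expr0n/= addr0 sqrtr_sqr. Qed.

Lemma rnormV (x : R[i]) : rnorm x^-1 = (rnorm x)^-1.
Proof.
apply: (@complexI R); rewrite fmorphV/= -!rnormE.
exact: normfV.
Qed.

Lemma rnorm_gt0 (x : R[i]) : x != 0 -> 0 < rnorm x.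
Proof. by move=> x0; rewrite -ltcR -rnormE normr_gt0. Qed.

(** The half-plane coordinate, sending -1 to 0 and 1 to infinity, in which the
    automorphism is multiplication by a positive number. *)
Definition cayley z : R[i] := (1 + set_val z) / (1 - set_val z).

Lemma cayley_inj z w : set_val z != 1 -> set_val w != 1 -> cayley z = cayley w -> z = w.
Proof.
move=> z1 w1 /eqP; rewrite eqr_div ?subr_eq0 1?eq_sym// => /eqP e.
apply: disk_ext; have : 2 * set_val z = 2 * set_val w.
  have -> : 2 * set_val z = (1 + set_val z) * (1 - set_val w) - (1 + set_val w) * (1 - set_val z) + 2 * set_val w.
    by ring.
  by rewrite e subrr add0r.
by have n2 : 2 != 0 :> R[i]; [rewrite pnatr_eq0|exact: (mulfI n2)].
Qed.

Lemma cayley_neq0 z : z \in punctured_disk R -> cayley z != 0.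
Proof.
move=> /puncturedP[z1 z2]; apply: mulf_neq0; first by rewrite addrC addr_eq0.
by rewrite invr_eq0 subr_eq0 eq_sym.
Qed.

Definition multiplier r : R := (1 + r) / (1 - r).

Lemma multiplier_gt0 r : -1 < r < 1 -> 0 < multiplier r.
Proof. by move=> /andP[? ?]; rewrite divr_gt0//; lra. Qed.

Lemma moebius_eq1 r (rr : -1 < r < 1) z : (set_val (moebius rr z) == 1) = (set_val z == 1).
Proof.
have d0 := moebius_den z rr; have r1 : 1 - r%:C != 0 :> R[i].
  case/andP: rr => ? ?; rewrite -(rmorph1 (@real_complex R)) -rmorphB fmorph_eq0.
  by apply: lt0r_neq0; lra.
rewrite moebius_val -subr_eq0 -[in RHS]subr_eq0.
have -> : (set_val z + r%:C) / (1 + r%:C * set_val z) - 1 =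
    (1 - r%:C) * (set_val z - 1) / (1 + r%:C * set_val z) by field.
by rewrite !mulf_eq0 invr_eq0 (negPf r1) (negPf d0) orbF.
Qed.

Lemma cayley_moebius r (rr : -1 < r < 1) z : set_val z != 1 ->
  cayley (moebius rr z) = (multiplier r)%:C * cayley z.
Proof.
move=> z1; have d0 := moebius_den z rr.
have r1 : 1 - r%:C != 0 :> R[i].
  case/andP: rr => ? ?; rewrite -(rmorph1 (@real_complex R)) -rmorphB fmorph_eq0.
  by apply: lt0r_neq0; lra.
rewrite /cayley moebius_val /multiplier fmorph_div rmorphD rmorphB rmorph1/=.
have z1' : 1 - set_val z != 0 by rewrite subr_eq0 eq_sym.
move: d0 z1' r1; set x := set_val z; set c := r%:C => d0 z1' r1.
have -> : 1 + (x + c) / (1 + c * x) = (1 + c) * (1 + x) / (1 + c * x) by field.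
have e2 : 1 - (x + c) / (1 + c * x) = (1 - c) * (1 - x) / (1 + c * x) by field.
by rewrite e2; field; rewrite d0 r1 z1'.
Qed.

(** In the polar form of [cayley] the automorphism translates the logarithm of
    the modulus and fixes the argument: orbits are arithmetic progressions. *)
Definition height z : R := ln (rnorm (cayley z)).

Definition direction z : R[i] := cayley z / (rnorm (cayley z))%:C.

Lemma expR_height z : z \in punctured_disk R -> expR (height z) = rnorm (cayley z).
Proof. by move=> zP; rewrite lnK// posrE rnorm_gt0// cayley_neq0. Qed.

Lemma height_direction z : z \in punctured_disk R ->
  cayley z = (expR (height z))%:C * direction z.
Proof.
move=> zP; rewrite expR_height// /direction mulrC divfK//.
by rewrite -rnormE normr_eq0 cayley_neq0.
Qed.

Lemma height_direction_inj z w : z \in punctured_disk R -> w \in punctured_disk R ->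
  height z = height w -> direction z = direction w -> z = w.
Proof.
move=> zP wP eh ed; move: (zP) (wP) => /puncturedP[z1 _] /puncturedP[w1 _].
by apply: cayley_inj => //; rewrite !height_direction// eh ed.
Qed.

Lemma moebius_punctured r (rr : -1 < r < 1) z : z \in punctured_disk R ->
  moebius rr z \in punctured_disk R.
Proof.
move=> zP; have := cayley_neq0 zP; move/puncturedP : zP => [z1 _] c0.
apply/puncturedP; rewrite moebius_eq1 z1; split => //; apply: contra_neq c0 => e.
have := cayley_moebius rr z1; rewrite /cayley e subrr mul0r => /esym/eqP.
rewrite mulf_eq0 => /orP[|/eqP//]; rewrite fmorph_eq0 => /eqP e0.
by have := multiplier_gt0 rr; rewrite e0 ltxx.
Qed.

Lemma height_moebius r (rr : -1 < r < 1) z : z \in punctured_disk R ->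
  height (moebius rr z) = height z + ln (multiplier r).
Proof.
move=> zP; have c0 := rnorm_gt0 (cayley_neq0 zP); have m0 := multiplier_gt0 rr.
move/puncturedP : zP => [z1 _].
by rewrite /height cayley_moebius// rnormM rnormr gtr0_norm// lnM ?posrE// addrC.
Qed.

Lemma direction_moebius r (rr : -1 < r < 1) z : z \in punctured_disk R ->
  direction (moebius rr z) = direction z.
Proof.
move=> zP; have c0 := rnorm_gt0 (cayley_neq0 zP); have m0 := multiplier_gt0 rr.
move/puncturedP : zP => [z1 _].
rewrite /direction cayley_moebius// rnormM rnormr gtr0_norm//.
have -> : (multiplier r * rnorm (cayley z))%:C =
    (multiplier r)%:C * (rnorm (cayley z))%:C :> R[i] by exact: rmorphM.
rewrite invfM mulrACA divff ?mul1r// fmorph_eq0; exact: lt0r_neq0.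
Qed.

Lemma ln_multiplier_neq0 r : -1 < r < 1 -> r != 0 -> ln (multiplier r) != 0.
Proof.
move=> rr r0; rewrite ln_eq0 ?multiplier_gt0//.
case/andP: rr => ? ?; apply: contra_neq r0 => e.
have n0 : 1 - r != 0 by apply: lt0r_neq0; lra.
have := congr1 (fun x => x * (1 - r)) e; rewrite /multiplier divfK// mul1r.
by lra.
Qed.

(** [|1 - z| |cayley z| = |1 + z| <= 2]; large heights are close to 1 and,
    by the next lemma, very negative ones are close to -1. *)
Lemma sub1_le_height z : z \in punctured_disk R ->
  rnorm (1 - set_val z) <= 2 * expR (- height z).
Proof.
move=> zP; rewrite expRN expR_height// rnormM rnormV invf_div.
move/puncturedP : zP => [z1 z2].
have p1 : 0 < rnorm (1 + set_val z).
  by apply: rnorm_gt0; rewrite addrC addr_eq0.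
rewrite mulrA ler_pdivlMr// mulrC ler_wpM2r ?rnorm_ge0//.
rewrite -lecR -rnormE (le_trans (ler_normD _ _))// normr1.
by rewrite rmorph_nat -[2]/(1 + 1) lerD2l disk_norm_le1.
Qed.

Lemma add1_le_height z : z \in punctured_disk R ->
  rnorm (1 + set_val z) <= 2 * expR (height z).
Proof.
move=> zP; rewrite expR_height// rnormM rnormV.
move/puncturedP : zP => [z1 z2].
have p1 : 0 < rnorm (1 - set_val z).
  by apply: rnorm_gt0; rewrite subr_eq0 eq_sym.
rewrite mulrA ler_pdivlMr// mulrC ler_wpM2r ?rnorm_ge0//.
rewrite -lecR -rnormE (le_trans (ler_normB _ _))// normr1.
by rewrite rmorph_nat -[2]/(1 + 1) lerD2l disk_norm_le1.
Qed.

Lemma cayley_continuous z : set_val z != 1 -> {for z, continuous cayley}.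
Proof.
move=> z1; have FF := nbhs_filter (z : disk R).
have dc := @disk_coord_subproof R z.
apply: (@cvgM R[i] _ _ _ (fun w : disk R => 1 + set_val w)
  (fun w : disk R => (1 - set_val w)^-1) (1 + set_val z) (1 - set_val z)^-1).
  by apply: (@cvgD R[i] R[i]); [exact: cvg_cst|exact: dc].
apply: (@cvgV R[i]); first by rewrite subr_eq0 eq_sym.
by apply: (@cvgB R[i] R[i]); [exact: cvg_cst|exact: dc].
Qed.

Lemma norm_cayley_continuous z : set_val z != 1 ->
  {for z, continuous (fun w => rnorm (cayley w))}.
Proof.
move=> z1; apply: (@continuous_comp _ _ _ cayley (@rnorm R R[i])).
  exact: cayley_continuous.
exact: rnorm_continuous.
Qed.

Lemma height_continuous z : z \in punctured_disk R -> {for z, continuous height}.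
Proof.
move=> zP; have c0 := rnorm_gt0 (cayley_neq0 zP); move/puncturedP : zP => [z1 _].
apply: (@continuous_comp _ _ _ (fun w => rnorm (cayley w)) (@ln R)).
  exact: norm_cayley_continuous.
exact: continuous_ln.
Qed.

Lemma real_complex_continuous : continuous (fun x : R => x%:C).
Proof.
move=> x; have FF := nbhs_filter x; apply: cvg_complex; last exact: cvg_cst.
exact: cvg_id.
Qed.

Lemma direction_continuous z : z \in punctured_disk R -> {for z, continuous direction}.
Proof.
move=> zP; have c0 := cayley_neq0 zP; move/puncturedP : zP => [z1 _].
have FF := nbhs_filter (z : disk R).
apply: (@cvgM R[i] _ _ _ cayley (fun w : disk R => (rnorm (cayley w))%:C^-1)
  (cayley z) (rnorm (cayley z))%:C^-1); first exact: cayley_continuous.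
apply: (@cvgV R[i]); first by rewrite -rnormE normr_eq0.
apply: (@continuous_comp _ _ _ (fun w => rnorm (cayley w)) (fun x : R => x%:C)).
  exact: norm_cayley_continuous.
exact: real_complex_continuous.
Qed.

End CayleyCoordinate.

(** * Iterates and orbits *)

Lemma int_updown_ind (P : int -> Prop) : P 0 ->
  (forall n, P n -> P (n + 1)) -> (forall n, P n -> P (n - 1)) -> forall n, P n.
Proof.
move=> P0 Pu Pd; elim/int_rect => // n Pn.
  by rewrite -addn1 PoszD; exact: Pu.
by rewrite -addn1 PoszD opprD; exact: Pd.
Qed.

Section HyperbolicDynamics.
Variables (R : realType) (r : R).
Hypotheses (rr : -1 < r < 1) (r0 : r != 0).
Implicit Types (x y z w : disk R) (n m : int).

Local Notation phi := (moebius rr).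
Local Notation phiV := (moebius (moebius_opp rr)).
Local Notation phiz := (iterz phi).
Let kappa := ln (multiplier r).

Let phiK : cancel phi phiV.
Proof. exact: moebiusK. Qed.

Let phiVK : cancel phiV phi.
Proof.
move=> z; have h := @moebiusK R (- r) (moebius_opp rr).
have rr' : -1 < - - r < 1 by rewrite opprK.
rewrite -[RHS](h rr' z); apply: disk_ext; rewrite !moebius_val.
by rewrite opprK.
Qed.

Lemma moebius_sign b : phi (disk_sign R b) = disk_sign R b.
Proof.
apply: disk_ext; rewrite moebius_val disk_sign_val.
have := moebius_den (disk_sign R b) rr; rewrite disk_sign_val.
by move=> d0; apply: (canLR (mulfK d0)); case: b {d0}; rewrite ?expr0 ?expr1; ring.
Qed.

Lemma moebius_xget y : xget y [set z | phi z = y] = phiV y.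
Proof.
case: xgetP => [z _ <-|/(_ (phiV y))]; first by rewrite phiK.
by rewrite /= phiVK.
Qed.

Lemma iterz_moebius_neg k x : phiz (Negz k) x = iter k.+1 phiV x.
Proof.
rewrite /iterz; apply: eq_iter => y; exact: moebius_xget.
Qed.

Lemma iterz_moebiusS n x : phiz (n + 1) x = phi (phiz n x).
Proof.
case: n => [k|[|k]].
- by rewrite -PoszD addn1.
- by rewrite iterz_moebius_neg /= phiVK.
- have -> : Negz k.+1 + 1 = Negz k by rewrite !NegzE -[k.+2]addn1 PoszD opprD addrNK.
  by rewrite !iterz_moebius_neg [in RHS]iterS phiVK.
Qed.

Lemma iterz_moebiusB n x : phiz (n - 1) x = phiV (phiz n x).
Proof. by rewrite -{2}[n](subrK 1) iterz_moebiusS phiK. Qed.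

Lemma iterz_moebiusD n m x : phiz (n + m) x = phiz n (phiz m x).
Proof.
elim/int_updown_ind: n => [|n IH|n IH]; first by rewrite add0r.
  by rewrite addrAC !iterz_moebiusS IH.
by rewrite addrAC !iterz_moebiusB IH.
Qed.

Lemma iterz_moebiusSr n x : phiz n (phi x) = phi (phiz n x).
Proof. by rewrite -[phi x]/(phiz 1 x) -iterz_moebiusD -iterz_moebiusS addrC. Qed.

Lemma iterz_punctured n x : x \in punctured_disk R -> phiz n x \in punctured_disk R.
Proof.
move=> xP; elim/int_updown_ind: n => // n IH.
  by rewrite iterz_moebiusS moebius_punctured.
by rewrite iterz_moebiusB moebius_punctured.
Qed.

Lemma height_iterz n x : x \in punctured_disk R -> height (phiz n x) = height x + n%:~R * kappa.
Proof.
move=> xP; elim/int_updown_ind: n => [|n IH|n IH]; first by rewrite mul0r addr0.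
  by rewrite iterz_moebiusS height_moebius ?iterz_punctured// IH rmorphD/= mulrDl mul1r addrA.
apply: (addIr kappa); rewrite -height_moebius ?iterz_punctured//.
by rewrite -iterz_moebiusS subrK IH rmorphB/= mulrBl mul1r addrA subrK.
Qed.

Lemma direction_iterz n x : x \in punctured_disk R -> direction (phiz n x) = direction x.
Proof.
move=> xP; elim/int_updown_ind: n => // n IH.
  by rewrite iterz_moebiusS direction_moebius ?iterz_punctured// IH.
by rewrite -IH -[in RHS](subrK 1 n) iterz_moebiusS direction_moebius ?iterz_punctured.
Qed.

Lemma kappa_neq0 : kappa != 0. Proof. exact: ln_multiplier_neq0. Qed.

Lemma orbitP x y : (Defs.orbit phi x = Defs.orbit phi y) <-> exists n, y = phiz n x.
Proof.
split=> [e|[n ->]].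
  have : Defs.orbit phi y y by exists 0.
  by rewrite -e.
apply/seteqP; split => z [m ->]; last by exists (m + n); rewrite iterz_moebiusD.
by exists (m - n); rewrite -iterz_moebiusD subrK.
Qed.

(** If the directions agree, the difference of the heights divided by [kappa]
    is not an integer, and its distance to the integers is positive. *)
Lemma orbit_separation x y : x \in punctured_disk R -> y \in punctured_disk R ->
  (forall n, y <> phiz n x) ->
  exists2 d : R, 0 < d &
    forall n, d <= `|height x - height y + n%:~R * kappa| + rnorm (direction x - direction y).
Proof.
move=> xP yP nxy; have k0 := kappa_neq0.
have [exy|dxy] := eqVneq (direction x) (direction y); last first.
  exists (rnorm (direction x - direction y)); first by rewrite rnorm_gt0// subr_eq0.
  by move=> n; rewrite lerDr.
pose t := (height x - height y) / kappa.
have tE : height x - height y = t * kappa by rewrite divfK.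
have tn n : t + n%:~R != 0.
  apply/eqP => tn; apply: (nxy n); apply: height_direction_inj => //.
  - exact: iterz_punctured.
  - rewrite height_iterz//; apply/eqP; rewrite eq_sym -subr_eq0 addrAC tE -mulrDl tn.
    by rewrite mul0r.
  - by rewrite direction_iterz.
pose s := t - (Num.floor t)%:~R.
have s0 : 0 < s.
  rewrite lt_def subr_ge0 floor_le_tmp ?andbT//.
  by have := tn (- Num.floor t); rewrite rmorphN.
have s1 : s < 1 by rewrite ltrBlDl -[1]/(1%:~R) -rmorphD/= floorD1_gt.
pose d := Num.min s (1 - s).
have d0 : 0 < d by rewrite lt_min s0 subr_gt0.
exists (d * `|kappa|); first by rewrite mulr_gt0// normr_gt0.
move=> n; rewrite exy subrr rnorm0 addr0 tE -mulrDl normrM ler_wpM2r//.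
have -> : t + n%:~R = s + (Num.floor t + n)%:~R by rewrite rmorphD/= addrA subrK.
have [m0|m0] := leP 0 (Num.floor t + n).
  have m0' : 0 <= (Num.floor t + n)%:~R :> R by rewrite ler0z.
  by rewrite ger0_norm ?ge_min ?lerDl ?m0'// addr_ge0// ltW.
have m1 : (Num.floor t + n)%:~R <= -1 :> R.
  by rewrite -[-1]/((-1)%:~R) ler_int -ltzD1 addNr.
by rewrite ler0_norm ?ge_min; [apply/orP; right; lra|lra].
Qed.

End HyperbolicDynamics.

(** * Bump functions and far iterates *)

Section BumpFunctions.
Variable R : realType.
Implicit Types (x y z w : disk R).

Lemma max0_continuous : continuous (fun y : R => Num.max 0 y).
Proof.
move=> y; apply: (@continuous_max R R (fun=> 0) id y); first exact: cvg_cst.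
exact: cvg_id.
Qed.

(** Vanishes exactly at the two fixed points. *)
Definition pinch w : R := rnorm (1 - set_val w) * rnorm (1 + set_val w).

Lemma pinch_continuous : continuous pinch.
Proof.
move=> z; have FF := nbhs_filter (z : disk R).
have dc := @disk_coord_subproof R z.
apply: (@cvgM R _ _ _ (fun w : disk R => rnorm (1 - set_val w))
  (fun w : disk R => rnorm (1 + set_val w))).
  apply: (@continuous_comp _ _ _ (fun w : disk R => 1 - set_val w) (@rnorm R R[i])).
    by apply: (@cvgB R[i] R[i]); [exact: cvg_cst|exact: dc].
  exact: rnorm_continuous.
apply: (@continuous_comp _ _ _ (fun w : disk R => 1 + set_val w) (@rnorm R R[i])).
  by apply: (@cvgD R[i] R[i]); [exact: cvg_cst|exact: dc].
exact: rnorm_continuous.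
Qed.

Lemma pinch_ge0 w : 0 <= pinch w.
Proof. by rewrite mulr_ge0 ?rnorm_ge0. Qed.

Lemma pinch_sign b : pinch (disk_sign R b) = 0.
Proof.
rewrite /pinch disk_sign_val; case: b; first by rewrite expr1 subrr rnorm0 mulr0.
by rewrite expr0 subrr rnorm0 mul0r.
Qed.

Lemma pinch_gt0 w : w \in punctured_disk R -> 0 < pinch w.
Proof.
move=> /puncturedP[w1 w2]; rewrite mulr_gt0 ?rnorm_gt0//.
  by rewrite subr_eq0 eq_sym.
by rewrite addrC addr_eq0.
Qed.

Definition orbit_dist x w : R := `|height w - height x| + rnorm (direction w - direction x).

Definition bump_fun x (d : R) w : R := pinch w * Num.max 0 (d - orbit_dist x w).

(** Height and direction are discontinuous at the fixed points, where the
    vanishing of [pinch] restores the continuity of the product. *)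
Lemma bump_continuous x d : 0 <= d -> continuous (fun w => (bump_fun x d w)%:C).
Proof.
move=> d0 z; suff h : {for z, continuous (bump_fun x d)}.
  by apply: (@continuous_comp _ _ _ (bump_fun x d) (fun y : R => y%:C));
    [exact: h|exact: real_complex_continuous].
have FF := nbhs_filter (z : disk R).
have [zP|[b zb]] := punctured_cases z.
  apply: (@cvgM R _ _ _ pinch (fun w => Num.max 0 (d - orbit_dist x w))).
    exact: pinch_continuous.
  apply: (@continuous_comp _ _ _ (fun w => d - orbit_dist x w) (fun y : R => Num.max 0 y)); last first.
    exact: max0_continuous.
  apply: (@cvgB R R); first exact: cvg_cst.
  apply: (@cvgD R R).
    apply: (@cvg_norm R R); apply: (@cvgB R R); last exact: cvg_cst.
    exact: height_continuous.
  apply: (@continuous_comp _ _ _ (fun w => direction w - direction x) (@rnorm R R[i])).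
    apply: (@cvgB R[i] R[i]); last exact: cvg_cst.
    exact: direction_continuous.
  exact: rnorm_continuous.
have z0 : bump_fun x d z = 0 by rewrite /bump_fun zb pinch_sign mul0r.
suff : bump_fun x d @ z --> (0 : R) by rewrite -[X in _ --> X -> _]z0.
apply: (@squeeze_cvgr _ _ _ _ (fun=> 0) (fun w => pinch w * d)).
- apply: nearW => w; rewrite /bump_fun mulr_ge0 ?pinch_ge0 ?le_max ?lexx//=.
  rewrite ler_wpM2l ?pinch_ge0// ge_max d0 lerBlDr lerDl.
  by rewrite addr_ge0 ?rnorm_ge0.
- exact: cvg_cst.
- rewrite -[X in _ --> X](mul0r d) -[X in X * d](pinch_sign b) -zb.
  by apply: (@cvgM R); [exact: pinch_continuous|exact: cvg_cst].
Qed.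

Definition orbit_bump x (d : R) : continuousType (disk R) R[i] :=
  mkcts (@bump_continuous x `|d| (normr_ge0 d)).

Lemma bump_sign x d b : orbit_bump x d (disk_sign R b) = 0.
Proof. by rewrite mkctsE /bump_fun pinch_sign mul0r. Qed.

Lemma bump_eq0 x d w : 0 < d -> d <= orbit_dist x w -> orbit_bump x d w = 0.
Proof.
move=> d0 h; rewrite mkctsE /bump_fun gtr0_norm//.
by rewrite max_l ?mulr0// subr_le0.
Qed.

Lemma bump_neq0 x d w : 0 < d -> orbit_bump x d w <> 0 -> orbit_dist x w < d.
Proof. by move=> d0 h; rewrite ltNge; apply/negP => /(bump_eq0 d0). Qed.

Lemma bump_self x d : 0 < d -> x \in punctured_disk R -> orbit_bump x d x <> 0.
Proof.
move=> d0 xP; rewrite mkctsE /bump_fun /orbit_dist !subrr normr0 rnorm0 addr0 subr0.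
rewrite gtr0_norm// max_r ?ltW// => /(congr1 (@Re R))/= /eqP.
by rewrite mulf_eq0 !gt_eqF// pinch_gt0.
Qed.

(** A tent around [z], multiplied by [pinch] to vanish at the fixed points. *)
Lemma nbhs_bump z (P : set (disk R)) : z \in punctured_disk R -> nbhs z P ->
  exists f : continuousType (disk R) R[i],
    [/\ f z <> 0, forall b, f (disk_sign R b) = 0 & forall w, f w <> 0 -> P w].
Proof.
move=> zP /nbhs_subsetP[d d0 dP].
pose h w := pinch w * Num.max 0 (d - rnorm (set_val w - set_val z)).
have ch : continuous (fun w => (h w)%:C).
  move=> w; apply: (@continuous_comp _ _ _ h (fun y : R => y%:C)); last first.
    exact: real_complex_continuous.
  have FF := nbhs_filter (w : disk R).
  apply: (@cvgM R _ _ _ pinch (fun w => Num.max 0 (d - rnorm (set_val w - set_val z)))).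
    exact: pinch_continuous.
  apply: (@continuous_comp _ _ _ (fun w => d - rnorm (set_val w - set_val z)) (fun y : R => Num.max 0 y)); last first.
    exact: max0_continuous.
  apply: (@cvgB R R); first exact: cvg_cst.
  apply: (@continuous_comp _ _ _ (fun w : disk R => set_val w - set_val z) (@rnorm R R[i])).
    by apply: (@cvgB R[i] R[i]); [exact: (@disk_coord_subproof R w)|exact: cvg_cst].
  exact: rnorm_continuous.
exists (mkcts ch); split.
- rewrite mkctsE /h subrr rnorm0 subr0 max_r ?ltW// => /(congr1 (@Re R))/= /eqP.
  by rewrite mulf_eq0 !gt_eqF// pinch_gt0.
- by move=> b; rewrite mkctsE /h pinch_sign mul0r.
- move=> w; rewrite mkctsE /h => hw; apply: dP; rewrite rnormE ltcR ltNge.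
  apply/negP => dw; apply: hw; rewrite max_l ?mulr0//; lra.
Qed.

End BumpFunctions.

Section FarIterates.
Variables (R : realType) (r : R).
Hypotheses (rr : -1 < r < 1) (r0 : r != 0).

(** The starting point depends on the sign of [c]: to the right of a large [M]
    if the progression increases, to the left of [- M - N] if it decreases. *)
Lemma arithmetic_progression_ge (a c B : R) (N : nat) : c != 0 ->
  exists lo : int, forall i, (i < N)%N -> B <= a + (lo + i%:Z)%:~R * c.
Proof.
move=> c0; pose M := Num.Def.archi_bound (`|B - a| / `|c|).
have nc : 0 < `|c| by rewrite normr_gt0.
have hM : B - a <= M%:R * `|c|.
  apply: le_trans (ler_norm _) _; rewrite -ler_pdivrMr//.
  by apply/ltW/archi_boundP; rewrite divr_ge0.
have [cp|cn] := ltP 0 c.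
  exists M => i _; rewrite rmorphD/= mulrDl.
  have : 0 <= i%:R * c by rewrite mulr_ge0// ltW.
  by rewrite gtr0_norm// in hM; rewrite -!pmulrn; lra.
exists (- M%:Z - N%:Z) => i iN.
have cn' : c < 0 by rewrite lt_neqAle c0.
rewrite ltr0_norm// in hM.
have : 0 <= (N - i)%:R * - c by rewrite mulr_ge0// oppr_ge0.
rewrite natrB ?(ltnW iN)// !rmorphD !rmorphN/= -!pmulrn; lra.
Qed.

Lemma far_iterates (x : disk R) (b : bool) (e : R) (N : nat) : x \in punctured_disk R -> 0 < e ->
  exists lo : int, forall i, (i < N)%N ->
    rnorm (set_val (iterz (moebius rr) (lo + i%:Z) x) - (-1) ^+ b) <= e.
Proof.
move=> xP e0; have k0 := ln_multiplier_neq0 rr r0.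
pose s : R := (-1) ^+ b; have s0 : s != 0 by rewrite signr_eq0.
have e2 : 0 < e / 2 by rewrite divr_gt0.
have [lo hlo] := @arithmetic_progression_ge (s * height x) (s * ln (multiplier r))
   (- ln (e / 2)) N (mulf_neq0 s0 k0).
exists lo => i iN; have zP := iterz_punctured rr (lo + i%:Z) xP.
have hs : expR (- (s * height (iterz (moebius rr) (lo + i%:Z) x))) <= e / 2.
  rewrite -[leRHS]lnK ?posrE// ler_expR height_iterz//.
  by have := hlo i iN; rewrite mulrDr !(mulrCA _ s); lra.
have [bt|/negbTE bf] := boolP b.
  have s1 : s = -1 by rewrite /s bt expr1.
  rewrite s1 mulN1r opprK in hs; rewrite expr1 opprK [X in rnorm X]addrC.
  by apply: le_trans (add1_le_height zP) _; lra.
have s1 : s = 1 by rewrite /s bf expr0.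
rewrite s1 mul1r in hs; rewrite expr0 /rnorm distrC -/(rnorm _).
by apply: le_trans (sub1_le_height zP) _; lra.
Qed.

End FarIterates.

(** * Bessel's identity and the space of square-summable sequences *)

Section SeriesOverIntegers.

(** [zseries] adds the indices of rank [n] at step [n]. *)
Definition intrank (k : int) : nat := match k with Posz i => i | Negz i => i end.

Lemma zseriesS (V : zmodType) (g : int -> V) n :
  zseries g n.+1 = zseries g n + (g (Posz n) + g (Negz n)).
Proof. by rewrite /zseries /series/= big_nat_recr. Qed.

Lemma zseries0 (V : zmodType) (g : int -> V) : zseries g 0 = 0.
Proof. by rewrite /zseries /series/= big_geq. Qed.

Lemma zseries_single (V : zmodType) (g : int -> V) m n : (intrank m < n)%N ->
  (forall k, k != m -> g k = 0) -> zseries g n = g m.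
Proof.
elim: n => // n IH; rewrite ltnS leq_eqVlt => /orP[/eqP mn|mn] g0; rewrite zseriesS.
  have z0 : zseries g n = 0.
    rewrite /zseries /series/= big_nat_cond big1// => i /andP[/andP[_ iN] _].
    have ni k : intrank k = i -> g k = 0.
      by move=> ki; apply: g0; apply: contraTneq iN => km; rewrite -ki km mn ltnn.
    by rewrite !ni// addr0.
  clear IH; case: m mn g0 => i /= mn g0; rewrite z0 add0r -mn.
    by rewrite (g0 (Negz i)) ?addr0.
  by rewrite (g0 (Posz i)) ?add0r.
rewrite IH// (g0 (Posz n)) ?(g0 (Negz n)) ?addr0//.
  by apply: contraTneq mn => <-; rewrite /= ltnn.
by apply: contraTneq mn => <-; rewrite /= ltnn.
Qed.

(** Shifting the index moves one term at each end of the symmetric sum. *)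
Lemma zseries_shift (V : zmodType) (g : int -> V) n :
  zseries (fun k => g (k + 1)) n + g (- n%:Z) = zseries g n + g n%:Z.
Proof.
elim: n => [|n IH]; first by rewrite !zseries0 oppr0.
rewrite !zseriesS.
have e1 : Negz n + 1 = - n%:Z by rewrite NegzE -addn1 PoszD opprD addrNK.
have e2 : - n.+1%:Z = Negz n by rewrite NegzE.
have e3 : Posz n + 1 = n.+1%:Z by rewrite -PoszD addn1.
rewrite e1 e2 e3 [X in _ + X + _]addrC !addrA IH.
by rewrite -!addrA; congr (_ + (_ + _)); rewrite addrC.
Qed.

Lemma zseries_shift_le (R : realType) (g : int -> R) n : (forall k, 0 <= g k) ->
  zseries (fun k => g (k + 1)) n <= zseries g n.+1.
Proof.
move=> g0; have := zseries_shift g n; rewrite zseriesS.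
by have := g0 (- n%:Z); have := g0 (Negz n); lra.
Qed.

Lemma zseries_shiftV_le (R : realType) (g : int -> R) n : (forall k, 0 <= g k) ->
  zseries (fun k => g (k - 1)) n <= zseries g n.+1.
Proof.
move=> g0; have := zseries_shift (fun k => g (k - 1)) n; rewrite zseriesS.
have -> : (fun k => g (k + 1 - 1)) = g by apply/funext => k; rewrite addrK.
have -> : - n%:Z - 1 = Negz n by rewrite NegzE -addn1 PoszD opprD.
by have := g0 n; have := g0 (n%:Z - 1); lra.
Qed.

End SeriesOverIntegers.

Section Bessel.
Variables (R : realType) (H : hilbert R) (w : int -> H).
Hypothesis wo : forall m n, hdot H (w m) (w n) = (m == n)%:R.

Let s v n := zseries (fun k => hdot H v (w k) *: w k) n.

Lemma bessel_orthogonal v n m : (n <= intrank m)%N -> hdot H (s v n) (w m) = 0.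
Proof.
elim: n => [|n IH] nm; first by rewrite /s zseries0 linear0l.
rewrite /s zseriesS !linearDl/= IH ?(ltnW nm)// add0r !linearZl_LR/= !wo.
have /negbTE -> : Posz n != m by apply: contraTneq nm => <-; rewrite ltnn.
have /negbTE -> : Negz n != m by apply: contraTneq nm => <-; rewrite ltnn.
by rewrite !mulr0 addr0.
Qed.

(** The equality is needed besides the inequality: on the basis of [l^2(Z)] the
    right-hand side tends to 0, which proves the basis total. *)
Lemma bessel v n : hdot H (v - s v n) (v - s v n) =
  hdot H v v - (zseries (fun k => sqnorm (hdot H v (w k))) n)%:C.
Proof.
elim: n => [|n IH]; first by rewrite /s !zseries0 !subr0.
rewrite /s !zseriesS -/(s v n); set a := hdot H v (w n); set b := hdot H v (w (Negz n)).
rewrite rmorphD rmorphD/= !sqnormE !opprD !addrA -IH.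
set d := v - s v n.
have da : hdot H d (w n) = a by rewrite linearBl/= bessel_orthogonal ?subr0.
have db : hdot H d (w (Negz n)) = b by rewrite linearBl/= bessel_orthogonal ?subr0.
have da' : hdot H (w n) d = a^*%R by rewrite hdotC da.
have db' : hdot H (w (Negz n)) d = b^*%R by rewrite hdotC db.
clearbody d.
rewrite !(linearDl, linearNl)/= !(linearDr, linearNr)/=.
rewrite !(linearZl_LR, linearZr_LR)/= da db da' db' !wo.
rewrite !eqxx/= !mulr0 !mulr1.
rewrite !scaler0 -[a^*%R *: a]/(a^*%R * a) -[b^*%R *: b]/(b^*%R * b).
by ring.
Qed.

Lemma bessel_le v n : zseries (fun k => sqnorm (hdot H v (w k))) n <= rnorm v ^+ 2.
Proof.
rewrite -lecR -subr_ge0 rmorphXn/= -rnormE -hdot_norm -bessel hdot_norm.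
by rewrite exprn_ge0.
Qed.

End Bessel.

Section SquareSummable.
Variable R : realType.
Local Notation l2 := (l2Z R).
Local Notation H := (hilbert_l2Z R).
Implicit Types (u v : l2) (n m k : int).

Definition l2of (f : int -> R[i]) (hf : sqsummable f) : l2 := L2Z (introT (asboolP _) hf).

Lemma l2_ext u v : (forall n, u n = v n) -> u = v.
Proof. by move=> uv; apply/val_inj/funext. Qed.

Lemma l2DE u v n : (u + v) n = u n + v n. Proof. by []. Qed.
Lemma l2BE u v n : (u - v) n = u n - v n. Proof. by []. Qed.
Lemma l2ZE (c : R[i]) u n : (c *: u) n = c * u n. Proof. by []. Qed.
Lemma l2basisE n k : l2basis R n k = (k == n)%:R. Proof. by []. Qed.

Lemma l2dot_basis u n : hdot H u (l2basis R n) = u n.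
Proof.
rewrite -[LHS]/(l2dot u (l2basis R n)); apply: cvg_lim => //.
apply: (@cvg_near_cst _ _ _ _ \oo); exists (intrank n).+1 => // N /= nN.
rewrite (@zseries_single _ _ n)//; first by rewrite /= eqxx conjC1 mulr1.
by move=> k /negbTE kn; rewrite /= kn conjC0 mulr0.
Qed.

Lemma l2basis_dot u n : hdot H (l2basis R n) u = (u n)^*%R.
Proof. by rewrite hdotC l2dot_basis. Qed.

Lemma l2basis_orthonormal m n : hdot H (l2basis R m) (l2basis R n) = (m == n)%:R.
Proof. by rewrite l2dot_basis l2basisE eq_sym. Qed.

Lemma l2basis_norm n : `|l2basis R n| = 1.
Proof.
apply/eqP; rewrite -(@eqrXn2 _ 2)// expr1n.
by rewrite -[X in X == _](hdot_norm (h := H)) l2basis_orthonormal eqxx.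
Qed.

Lemma l2basis_neq0 n : l2basis R n <> 0.
Proof. by move=> e; have := l2basis_norm n; rewrite e normr0 => /eqP; rewrite eq_sym oner_eq0. Qed.

(** By [bessel], the partial sums of the coordinate expansion converge. *)
Lemma l2basis_total (W : set H) : closed_subspace W ->
  (forall n, W (l2basis R n)) -> W = setT.
Proof.
move=> Wsub We; apply/seteqP; split => // u _.
pose s (n : nat) := zseries (fun k => hdot H u (l2basis R k) *: (l2basis R k : H)) n.
have Ws (n : nat) : W (s n).
  elim: n => [|n IH]; first by rewrite /s zseries0; exact: csub0.
  rewrite /s zseriesS addrC -addrA; apply: (csub_lin Wsub) => //.
  by apply: (csub_lin Wsub).
apply: (closed_cvg W (csub_closed Wsub) (u_ := s) (F := \oo)).
  by apply: nearW.
pose g k := sqnorm (u k).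
have gc : zseries g @ \oo --> l2sq u by exact: (cvg_zseries_sqnorm (l2P u)).
apply/cvgrPdist_lt => e /gt0_complex[e0 ee].
have e2 : 0 < Re e ^+ 2 by rewrite exprn_gt0.
move/cvgrPdist_lt : gc => /(_ _ e2); apply: filterS => n.
rewrite ger0_norm ?subr_ge0 ?l2sq_ge// => h.
rewrite -(@ltr_pXn2r _ 2) ?nnegrE//; last by rewrite ee lecR ltW.
rewrite -[X in X < _](hdot_norm (h := H)) (bessel l2basis_orthonormal).
rewrite -[hdot H u u]/(l2dot u u) l2dotE -rmorphB ee -rmorphXn ltcR.
apply: le_lt_trans h; rewrite lerD2l lerN2 le_eqVlt; apply/orP; left; apply/eqP.
by congr (zseries _ n); apply/funext => k; rewrite /g l2dot_basis.
Qed.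

Lemma l2_linear_ext (G : hilbert R) (S T : H -> G) :
  continuous S -> continuous T -> linear S -> linear T ->
  (forall n, S (l2basis R n) = T (l2basis R n)) -> forall u, S u = T u.
Proof.
move=> cS cT lS lT e u.
have S0 : S 0 = 0 by have := lS (-1) 0 0; rewrite scaler0 addr0 scaleN1r addNr.
have T0 : T 0 = 0 by have := lT (-1) 0 0; rewrite scaler0 addr0 scaleN1r addNr.
have : [set u | S u = T u] u; last by [].
rewrite (@l2basis_total [set u | S u = T u])//; split => /=.
- exact: closed_eq_continuous.
- by rewrite S0 T0.
- by move=> c a b ea eb; rewrite lS lT ea eb.
Qed.

Definition bounded_seq (a : int -> R[i]) := exists M : R, forall n, `|a n| <= M%:C.

Lemma sqnorm_rnorm (z : R[i]) : sqnorm z = rnorm z ^+ 2.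
Proof. by apply: (@complexI R); rewrite sqnormE -normCK rnormE rmorphXn. Qed.

Lemma diag_subproof (a : int -> R[i]) (M : R) u : (forall n, `|a n| <= M%:C) ->
  forall n : nat, zseries (fun k => sqnorm (a k * u k)) n <= M ^+ 2 * l2sq u.
Proof.
move=> aM n; apply: (@le_trans _ _ (M ^+ 2 * zseries (fun k => sqnorm (u k)) n)).
  rewrite -[leRHS]/((M ^+ 2) *: (zseries (fun k => sqnorm (u k)) n : R^o)) -zseriesZ.
  apply: le_zseries => k; rewrite sqnormM ler_wpM2r ?sqnorm_ge0// sqnorm_rnorm.
  have := aM k; rewrite rnormE lecR => h.
  by rewrite ler_pXn2r ?nnegrE ?rnorm_ge0// (le_trans (rnorm_ge0 _) h).
by rewrite ler_wpM2l ?sqr_ge0 ?l2sq_ge.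
Qed.

Lemma l2_norm_le u (M : R) : 0 <= M ->
  (forall n : nat, zseries (fun k => sqnorm (u k)) n <= M ^+ 2) -> `|u| <= M%:C.
Proof.
move=> M0 h; rewrite -(@ler_pXn2r _ 2) ?nnegrE ?lecR//.
rewrite -l2dot_norm l2dotE -rmorphXn lecR; apply: limr_le.
  exact: cvg_zseries_sqnorm (l2P u).
by apply: nearW.
Qed.

Lemma l2sq_norm u : (l2sq u)%:C = `|u| ^+ 2.
Proof. by rewrite -l2dot_norm l2dotE. Qed.

Definition diag_fun (a : int -> R[i]) (ha : bounded_seq a) u : l2 :=
  l2of (ex_intro _ _ (diag_subproof u (projT2 (cid ha)))).

Lemma diag_funE a (ha : bounded_seq a) u n : diag_fun ha u n = a n * u n.
Proof. by []. Qed.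

Lemma diag_bound a (ha : bounded_seq a) : exists M : R, forall u, `|diag_fun ha u| <= M%:C * `|u|.
Proof.
have [M aM] := ha; have M0 : 0 <= M.
  by have := aM 0; rewrite rnormE lecR; exact: le_trans (rnorm_ge0 _).
exists M => u; rewrite rnormE -[`|u|]/(`|u : hilbert_l2Z R|) rnormE -rmorphM -rnormE.
apply: l2_norm_le => [|n]; first by rewrite mulr_ge0 ?rnorm_ge0.
apply: le_trans (diag_subproof u aM n) _; rewrite exprMn le_eqVlt; apply/orP; left.
apply/eqP; congr (_ * _); apply: (@complexI R).
by rewrite l2sq_norm rmorphXn/= -rnormE.
Qed.

End SquareSummable.

(** * The representations attached to orbits and to characters *)

Section ShiftOperator.
Variable R : realType.
Local Notation l2 := (l2Z R).
Local Notation H := (hilbert_l2Z R).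
Implicit Types (u v : l2).

Lemma shift_subproof u (N : nat) : zseries (fun k => sqnorm (u (k - 1))) N <= l2sq u.
Proof.
apply: le_trans (zseries_shiftV_le (g := fun k => sqnorm (u k)) _ _) _.
  by move=> k; exact: sqnorm_ge0.
exact: l2sq_ge.
Qed.

Lemma shiftV_subproof u (N : nat) : zseries (fun k => sqnorm (u (k + 1))) N <= l2sq u.
Proof.
apply: le_trans (zseries_shift_le (g := fun k => sqnorm (u k)) _ _) _.
  by move=> k; exact: sqnorm_ge0.
exact: l2sq_ge.
Qed.

Definition l2shift u : l2 := l2of (ex_intro _ _ (shift_subproof u)).
Definition l2shiftV u : l2 := l2of (ex_intro _ _ (shiftV_subproof u)).

Lemma shiftE u n : l2shift u n = u (n - 1). Proof. by []. Qed.
Lemma shiftVE u n : l2shiftV u n = u (n + 1). Proof. by []. Qed.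

Lemma shift_basis n : l2shift (l2basis R n) = l2basis R (n + 1).
Proof. by apply: l2_ext => k; rewrite shiftE !l2basisE subr_eq. Qed.

Lemma l2sq_rnorm u : l2sq u = rnorm (u : H) ^+ 2.
Proof. by apply: (@complexI R); rewrite l2sq_norm rmorphXn/= -rnormE. Qed.

Lemma shift_norm u : `|l2shift u| <= `|u|.
Proof.
rewrite [X in _ <= X](_ : _ = (rnorm (u : H))%:C) ; last by rewrite -rnormE.
apply: l2_norm_le => [|n]; first exact: rnorm_ge0.
by rewrite -l2sq_rnorm; exact: shift_subproof.
Qed.

Lemma shift_linear : linear (l2shift : H -> H).
Proof. by move=> c a b; apply: l2_ext. Qed.

(** Both sides are continuous in [u], so the basis vectors suffice; this avoids
    shifting the summation index in a limit. *)
Lemma shift_adjoint u v : hdot H (l2shift u) v = hdot H u (l2shiftV v).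
Proof.
have cS : continuous (l2shift : H -> H).
  apply: (@dist_continuous _ _ _ _ 1) => a b; rewrite mul1r.
  have -> : (l2shift a : H) - l2shift b = l2shift (a - b) by apply: l2_ext.
  exact: shift_norm.
apply: (@l2_linear_ext R (hilbert_C R) (fun u => hdot H (l2shift u) v)
    (fun u => hdot H u (l2shiftV v))).
- move=> w; apply: (@continuous_comp _ _ _ (l2shift : H -> H) (fun z : H => hdot H z v)).
    exact: cS.
  exact: hdot_continuous_l.
- exact: hdot_continuous_l.
- by move=> c a b; rewrite shift_linear linearDl/= linearZl_LR.
- by move=> c a b; rewrite linearDl/= linearZl_LR.
- by move=> n; rewrite shift_basis !l2basis_dot shiftVE.
Qed.

Lemma shift_adjointable : adjointable (l2shift : H -> H).
Proof.
exists l2shiftV; exists 1 => [u v|u]; first exact: shift_adjoint.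
by rewrite mul1r; exact: shift_norm.
Qed.

Definition shift_bop : bounded_operators H := bop_of shift_adjointable.

Lemma shift_bopE u : (shift_bop : bop H) u = l2shift u. Proof. by []. Qed.

Lemma shift_bop_star u : (cstar shift_bop : bop H) u = l2shiftV u.
Proof.
apply: (@hdot_eqP _ H) => w.
by rewrite -[LHS](bop_adjP (shift_bop : bop H)) shift_bopE shift_adjoint.
Qed.

Lemma diag_dot (a : int -> R[i]) (ha : bounded_seq a) (hb : bounded_seq (fun n => (a n)^*%R)) u v :
  hdot H (diag_fun ha u) v = hdot H u (diag_fun hb v).
Proof.
rewrite -[LHS]/(l2dot _ _) -[RHS]/(l2dot _ _) /l2dot.
congr (limn (zseries _)); apply/funext => k; rewrite !diag_funE rmorphM/= conjCK.
by ring.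
Qed.

Lemma bounded_seq_conj (a : int -> R[i]) : bounded_seq a -> bounded_seq (fun n => (a n)^*%R).
Proof. by move=> [M aM]; exists M => n; rewrite norm_conjC. Qed.

Lemma diag_adjointable (a : int -> R[i]) (ha : bounded_seq a) :
  adjointable (diag_fun ha : H -> H).
Proof.
have [M aM] := diag_bound ha.
by exists (diag_fun (bounded_seq_conj ha)); exists M => // u v; exact: diag_dot.
Qed.

Definition diag_bop (a : int -> R[i]) (ha : bounded_seq a) : bounded_operators H :=
  bop_of (diag_adjointable ha).

Lemma diag_bop_star (a : int -> R[i]) (ha : bounded_seq a) (hb : bounded_seq (fun n => (a n)^*%R)) :
  cstar (diag_bop ha) = diag_bop hb.
Proof. by apply: bop_adj_unique => u v; exact: diag_dot. Qed.

End ShiftOperator.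

Section ScalarOperators.
Variable R : realType.
Local Notation H := (hilbert_C R).

Lemma scalar_dot (c u v : R[i]) : hdot H (c * u) v = hdot H u (c^*%R * v).
Proof. by rewrite -[LHS]/(c * u * v^*%R) -[RHS]/(u * (c^*%R * v)^*%R) rmorphM/= conjCK mulrA (mulrC c). Qed.

Lemma scalar_adjointable (c : R[i]) : adjointable (fun v : H => c * v : H).
Proof.
exists (fun v : H => c^*%R * v); exists (rnorm c) => [u v|u]; first exact: scalar_dot.
by rewrite -rnormE -normrM.
Qed.

Definition scalar_bop (c : R[i]) : bounded_operators H := bop_of (scalar_adjointable c).

Lemma scalar_bop_star c : cstar (scalar_bop c) = scalar_bop c^*%R.
Proof. by apply: bop_adj_unique => u v; exact: scalar_dot. Qed.

End ScalarOperators.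

Section Models.
Variables (R : realType) (r : R) (rr : -1 < r < 1).
Local Notation phi := (moebius rr).
Local Notation phiz := (iterz phi).
Local Notation CX := (continuousType (disk R) R[i]).
Variables (A : cstarAlg R) (iota : CX -> A) (U : A).
Hypothesis cp : is_crossed_product phi iota U.

Lemma cts_bounded (f : CX) : exists M : R, forall x, `|f x| <= M%:C.
Proof.
pose P (B : set (disk R)) := exists M : R, forall x, B x -> `|f x| <= M%:C.
suff [M fM] : P setT by exists M => x; exact: fM.
apply: (compact_ind (@disk_compact R)).
- by exists 0.
- by move=> B C BC [M fM]; exists M => x /BC; exact: fM.
- move=> B C [M fM] [N fN]; exists (Num.max M N) => x [/fM|/fN] /le_trans; apply;
    by rewrite lecR le_max lexx ?orbT.
move=> x; have FF := nbhs_filter (x : disk R).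
have cf : (fun y => rnorm (f y)) @ x --> rnorm (f x).
  apply: (@continuous_comp _ _ _ f (@rnorm R R[i])); first exact: cts_fun.
  exact: rnorm_continuous.
exists [set y | rnorm (f y) < rnorm (f x) + 1].
  by apply: (cvgr_lt _ cf); rewrite ltrDl.
by exists (rnorm (f x) + 1) => y /= /ltW; rewrite rnormE lecR.
Qed.

Lemma orbit_values_bounded (f : CX) x : bounded_seq (fun n => f (phiz n x)).
Proof. by have [M fM] := cts_bounded f; exists M => n; exact: fM. Qed.

Lemma orbit_covariant x :
  covariant_pair phi (fun f => diag_bop (orbit_values_bounded f x)) (shift_bop R).
Proof.
split.
- by move=> f g; apply: bop_ext => v; rewrite bopDE; apply: l2_ext => n;
    exact: mulrDl.
- by move=> c f; apply: bop_ext => v; rewrite bopZE; apply: l2_ext => n;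
    exact: (esym (mulrA _ _ _)).
- by move=> f g; apply: bop_ext => v; apply: l2_ext => n; exact: (esym (mulrA _ _ _)).
- by apply: bop_ext => v; apply: l2_ext => n; exact: mul1r.
- by move=> f; rewrite (diag_bop_star _ (orbit_values_bounded (cts_conj f) x)).
- by apply: bop_ext => v; rewrite /= -[bop_adj_fun _ _]/((cstar (shift_bop R) : bop _) _) shift_bop_star;
    apply: l2_ext => n; rewrite shiftVE shiftE addrK.
- by apply: bop_ext => v; rewrite /= -[bop_adj_fun _ _]/((cstar (shift_bop R) : bop _) _) shift_bop_star;
    apply: l2_ext => n; rewrite shiftE shiftVE subrK.
- move=> f; apply: bop_ext => v; rewrite /= -[bop_adj_fun _ _]/((cstar (shift_bop R) : bop _) _) shift_bop_star.
  apply: l2_ext => n; rewrite shiftVE !diag_funE shiftE addrK.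
  by rewrite (iterz_moebiusS rr).
Qed.

Lemma orbit_model x : exists p : representation A (hilbert_l2Z R),
  (forall f v n, p (iota f) v n = f (phiz n x) * v n) /\ (forall v, p U v = l2shift v).
Proof.
have [h hh [hf hU]] := cp_universal cp (orbit_covariant x).
have [p pE] := representation_of_hom hh.
by exists p; split=> [f v n|v]; rewrite pE ?hf ?hU.
Qed.

Lemma character_covariant (t : R[i]) b : `|t| = 1 ->
  covariant_pair phi (fun f : CX => scalar_bop (f (disk_sign R b))) (scalar_bop t).
Proof.
move=> t1; have tt : t^*%R * t = 1 by rewrite mulrC -normCK t1 expr1n.
split.
- by move=> f g; apply: bop_ext => v; rewrite bopDE; exact: mulrDl.
- by move=> c f; apply: bop_ext => v; rewrite bopZE; exact: (esym (mulrA _ _ _)).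
- by move=> f g; apply: bop_ext => v; exact: (esym (mulrA _ _ _)).
- by apply: bop_ext => v; exact: mul1r.
- by move=> f; rewrite scalar_bop_star.
- by rewrite scalar_bop_star; apply: bop_ext => v; rewrite /= mulrA tt mul1r.
- by rewrite scalar_bop_star; apply: bop_ext => v; rewrite /= mulrA [t * _]mulrC tt mul1r.
- move=> f; rewrite scalar_bop_star; apply: bop_ext => v.
  by rewrite /= mulrCA [_ * (t * v)]mulrA tt mul1r -{1}(moebius_sign rr).
Qed.

Lemma character_model (t : R[i]) b : `|t| = 1 -> exists p : representation A (hilbert_C R),
  (forall f v, p (iota f) v = f (disk_sign R b) * v) /\ (forall v, p U v = t * v).
Proof.
move=> t1; have [h hh [hf hU]] := cp_universal cp (character_covariant b t1).
have [p pE] := representation_of_hom hh.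
by exists p; split=> [f v|v]; rewrite pE ?hf ?hU.
Qed.

Lemma character_irreducible (p : representation A (hilbert_C R)) : irreducible p.
Proof.
split; first by exists (1 : R[i]) => /eqP; rewrite oner_eq0.
move=> W Wsub _; have [W0|/existsNP[v /not_implyP[Wv v0]]] :=
  pselect (forall v : hilbert_C R, W v -> v = 0).
  by left; apply/seteqP; split => [v /W0//|_ ->]; exact: csub0.
right; apply/seteqP; split => // u _; have /eqP v0' := v0.
have -> : u = (u / v : R[i]) *: v + 0 by rewrite addr0 -[RHS]/(u / v * v) divfK.
by apply: (csub_lin Wsub) => //; exact: csub0.
Qed.

Hypothesis r0 : r != 0.

Lemma orbit_dist_iterz x m n : x \in punctured_disk R ->
  orbit_dist (phiz n x) (phiz m x) = `|m - n|%:~R * `|ln (multiplier r)|.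
Proof.
move=> xP; rewrite /orbit_dist !(direction_iterz rr)// subrr rnorm0 addr0.
by rewrite !(height_iterz rr)// opprD addrACA subrr add0r -mulrBl -rmorphB normrM -intr_norm.
Qed.

Lemma bump_iterz x m n : x \in punctured_disk R -> m != n ->
  orbit_bump (phiz n x) `|ln (multiplier r)| (phiz m x) = 0.
Proof.
move=> xP mn; have k0 := ln_multiplier_neq0 rr r0.
apply: bump_eq0; first by rewrite normr_gt0.
rewrite orbit_dist_iterz// ler_peMl// -[1]/(1%:~R) ler_int.
by rewrite -gtz0_ge1 normr_gt0 subr_eq0.
Qed.

(** A bump function isolating one point of the orbit acts as a multiple of a
    coordinate projection. A nonzero invariant subspace therefore contains a
    basis vector, and by translation all of them. *)
Lemma orbit_irreducible x (p : representation A (hilbert_l2Z R)) : x \in punctured_disk R ->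
  (forall f v n, p (iota f) v n = f (phiz n x) * v n) -> (forall v, p U v = l2shift v) ->
  irreducible p.
Proof.
move=> xP pf pU; have k0 := ln_multiplier_neq0 rr r0.
split; first by exists (l2basis R 0); exact: l2basis_neq0.
move=> W Wsub Wp; have [W0|/existsNP[v /not_implyP[Wv v0]]] :=
  pselect (forall v : hilbert_l2Z R, W v -> v = 0).
  by left; apply/seteqP; split => [v /W0//|_ ->]; exact: csub0.
right.
have [n vn] : exists n, v n <> 0.
  by apply: contra_notP v0 => /forallNP h; apply: l2_ext => n; exact: contrapT (h n).
pose g := orbit_bump (phiz n x) `|ln (multiplier r)|.
have gn : g (phiz n x) <> 0.
  by apply: bump_self; rewrite ?normr_gt0// (iterz_punctured rr).
pose c := g (phiz n x) * v n.
have c0 : c != 0 by rewrite mulf_neq0//; exact/eqP.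
have pv : p (iota g) v = c *: l2basis R n.
  apply: l2_ext => m; rewrite pf l2ZE l2basisE.
  have [->|mn] := eqVneq m n; first by rewrite mulr1.
  by rewrite mulr0 bump_iterz// mul0r.
have WZ (z : R[i]) u : W u -> W (z *: u).
  by move=> Wu; rewrite -[z *: u]addr0; apply: (csub_lin Wsub) => //; exact: csub0.
have Wn : W (l2basis R n).
  by rewrite -(scalerK c0 (l2basis R n)); apply: WZ; rewrite -pv; exact: Wp.
have Wnm m : W (l2basis R (n + m)).
  elim/int_updown_ind: m => [|m IH|m IH]; first by rewrite addr0.
    by rewrite addrA -shift_basis -pU; exact: Wp.
  have -> : l2basis R (n + (m - 1)) = p (cstar U) (l2basis R (n + m)).
    apply: (ropU_inj (cp_covariant cp) (p := p)).
    rewrite -ropM (cov_unitaryr (cp_covariant cp)) rop1 pU.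
    by rewrite shift_basis addrA subrK.
  exact: Wp.
apply: l2basis_total => // m.
by rewrite -(subrK n m) addrC.
Qed.

End Models.

(** * Eigenvectors and intertwiners *)

Lemma small_eq0 (R : realType) (H : hilbert R) (u v : H) : (forall e : R, 0 < e -> `|u| ^+ 2 <= e%:C * `|v| ^+ 2) -> u = 0.
Proof.
move=> h; apply/eqP; rewrite -normr_eq0 -sqrf_eq0 rnormE -rmorphXn.
set t := rnorm u; suff : t ^+ 2 <= 0.
  by move=> t0; rewrite (_ : t ^+ 2 = 0)//; apply/eqP; rewrite eq_le t0 sqr_ge0.
apply/ler_addgt0Pr => e e0; rewrite add0r.
have n1 : 0 < rnorm v ^+ 2 + 1 by rewrite ltr_wpDl ?sqr_ge0.
have := h _ (divr_gt0 e0 n1); rewrite !rnormE -!rmorphXn -rmorphM lecR.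
move=> /le_trans; apply; rewrite -mulrA ler_piMr ?(ltW e0)//.
by rewrite mulrC ler_pdivrMr// mul1r lerDl.
Qed.


Section EigenvalueEstimate.
Variables (R : realType) (phi : continuousType (disk R) (disk R)).
Local Notation CX := (continuousType (disk R) R[i]).
Variables (A : cstarAlg R) (iota : CX -> A) (U : A).
Hypothesis cov : covariant_pair phi iota U.
Variables (H : hilbert R) (p : representation A H).

Lemma iota_cst (c : R[i]) v : p (iota (ctsZ c (cts1 R _))) v = c *: v.
Proof. by rewrite (covZ cov) (cov1 cov) ropZ rop1. Qed.

Lemma iota_shift (f : CX) (c : R[i]) v :
  p (iota (ctsD f (ctsZ (-1) (ctsZ c (cts1 R _))))) v = p (iota f) v - c *: v.
Proof. by rewrite (covB cov) ropB iota_cst. Qed.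

(** Continuity at [x] bounds [|f - f(x)|^2] by [e + C |z - x|^2], and
    positivity turns this into an operator estimate. *)
Lemma eigen_estimate (f : CX) (x : disk R) (e : R) : 0 < e ->
  exists2 C : R, 0 <= C & forall v,
    `|p (iota f) v - f x *: v| ^+ 2 <=
    e%:C * `|v| ^+ 2 + C%:C * `|p (iota (disk_coord R)) v - set_val x *: v| ^+ 2.
Proof.
move=> e0; pose sub (g : CX) (c : R[i]) : CX := ctsD g (ctsZ (-1) (ctsZ c (cts1 R _))).
have subE g c y : sub g c y = g y - c.
  by rewrite ctsDE !ctsZE cts1E mulr1 mulN1r.
pose f' := sub f (f x); pose z' := sub (disk_coord R) (set_val x).
pose G : set CX := [set g | exists2 C : R, 0 <= C & g = ctsZ C%:C (ctsM (cts_conj z') z')].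
have zz y : ctsM (cts_conj z') z' y = `|set_val y - set_val x| ^+ 2.
  by rewrite ctsME cts_conjE mulrC -normCK subE.
have GE g : G g -> exists2 C : R, 0 <= C & forall y, g y = C%:C * `|set_val y - set_val x| ^+ 2.
  by move=> [C C0 ->]; exists C => // y; rewrite ctsZE zz.
have [|||y|_ [C C0 ->] gP] := @compact_domination R _ (@disk_compact R) G f' e e0.
- by exists 0 => //; apply: cts_ext => y; rewrite ctsZE mul0r.
- move=> g h [C C0 ->] [D D0 ->]; exists (C + D); first exact: addr_ge0.
  by apply: cts_ext => y; rewrite ctsDE !ctsZE rmorphD mulrDl.
- by move=> g /GE[C C0 gE] y; rewrite gE mulr_ge0 ?lecR ?exprn_ge0.
- have [->|yx] := eqVneq y x; first by left; rewrite subE subrr.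
  right; have d0 : 0 < rnorm (set_val y - set_val x).
    by apply: rnorm_gt0; rewrite subr_eq0; apply: contra_neq yx; exact: disk_ext.
  pose C := (rnorm (f' y) ^+ 2 + 1) / rnorm (set_val y - set_val x) ^+ 2.
  have C0 : 0 <= C by rewrite divr_ge0 ?addr_ge0 ?sqr_ge0.
  exists (ctsZ C%:C (ctsM (cts_conj z') z')); first by exists C.
  rewrite ctsZE zz !rnormE -!rmorphXn -rmorphM ltcR /C divfK ?ltrDl//.
  by rewrite expf_neq0// gt_eqF.
exists C => // v.
rewrite -(iota_shift f (f x)) -(iota_shift (disk_coord R) (set_val x)).
rewrite -(iota_sqr cov) -(iota_sqr cov).
pose h := ctsD (ctsZ e%:C (cts1 R (disk R))) (ctsZ C%:C (ctsM (cts_conj z') z')).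
have hE y : h y = e%:C + ctsZ C%:C (ctsM (cts_conj z') z') y.
  by rewrite /h ctsDE [X in X + _]ctsZE cts1E mulr1.
apply: le_trans (iota_mono cov (g := h) p v _) _.
  move=> y; rewrite ctsME cts_conjE mulrC -normCK hE; exact: gP.
by rewrite /h (covD cov) !(covZ cov) (cov1 cov) ropD !ropZ rop1 linearDl/= !linearZl_LR/= hdot_norm.
Qed.

Lemma iota_eigen (x : disk R) v : p (iota (disk_coord R)) v = set_val x *: v ->
  forall f, p (iota f) v = f x *: v.
Proof.
move=> pv f; apply/eqP; rewrite -subr_eq0; apply/eqP.
apply: (@small_eq0 _ _ _ v) => e e0.
have [C C0 hC] := eigen_estimate f x e0.
by have := hC v; rewrite pv subrr normr0 expr0n/= mulr0 addr0.
Qed.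

End EigenvalueEstimate.

Section Intertwiners.
Variables (R : realType) (A : cstarAlg R).

Lemma unitary_equiv_refl (p : irrep A) : unitary_equiv p p.
Proof.
pose T : {linear irr_space p -> irr_space p} := idfun.
by exists T; split=> //; exists id.
Qed.

Lemma unitary_equiv_sym (p q : irrep A) : unitary_equiv p q -> unitary_equiv q p.
Proof.
move=> [T [bT Td Tp]]; have [S TK SK] := bT.
have lS : linear S.
  move=> c u v; apply: (bij_inj bT); rewrite linearD linearZ/= !SK//.
pose S' : {linear irr_space q -> irr_space p} := HB.pack S (GRing.isLinear.Build _ _ _ _ _ lS).
exists S'; split => [|u v|a v].
- by exists T.
- by rewrite /= -Td !SK.
- by rewrite /=; apply: (bij_inj bT); rewrite Tp !SK.
Qed.

Lemma unitary_equiv_trans (p q s : irrep A) :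
  unitary_equiv p q -> unitary_equiv q s -> unitary_equiv p s.
Proof.
move=> [T [bT Td Tp]] [S [bS Sd Sp]].
pose TS : {linear irr_space p -> irr_space s} := S \o T.
exists TS; split => [|u v|a v].
- exact: bij_comp.
- by rewrite /= Sd Td.
- by rewrite /= Tp Sp.
Qed.

(** The vectors on which [T] preserves inner products form a closed invariant
    subspace, and so does the range of the resulting isometry. *)
Lemma intertwiner_unitary (p q : irrep A) (T : {linear irr_space p -> irr_space q}) :
  (forall v, `|T v| <= `|v|) ->
  (forall a v, T (p a v) = q a (T v)) ->
  (exists2 w, w <> 0 & forall v, hdot _ (T w) (T v) = hdot _ w v) ->
  unitary_equiv p q.
Proof.
move=> Tn Tp [w w0 wT].
have [_ irrp] := irr_irreducible p; have [_ irrq] := irr_irreducible q.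
have cT : continuous T.
  by apply: (@dist_continuous _ _ _ _ 1) => a b; rewrite mul1r -linearB.
pose E := [set u : irr_space p | forall v, hdot _ (T u) (T v) = hdot _ u v].
have ET : E = setT.
  have [||E0|//] := irrp E.
  - split.
    + rewrite (_ : E = \bigcap_(v in setT) [set u | hdot _ (T u) (T v) = hdot _ u v]); last first.
        by apply/seteqP; split => [u Eu v _|u Eu v]; exact: Eu.
      apply: closed_bigI => v _.
      apply: (@closed_eq_continuous R _ R[i] (fun u => hdot _ (T u) (T v)) (fun u => hdot _ u v)).
        move=> u; apply: (@continuous_comp _ _ _ T (fun z => hdot _ z (T v))).
          exact: cT.
        exact: hdot_continuous_l.
      exact: hdot_continuous_l.
    + by move=> v; rewrite linear0 !linear0l.
    + move=> c u v Eu Ev z.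
      by rewrite linearD linearZ/= !linearDl/= !linearZl_LR/= Eu Ev.
  - by move=> a u Eu v; rewrite Tp !hdot_starr -Tp Eu.
  - by have : E w by []; rewrite E0 => /w0.
have Td u v : hdot _ (T u) (T v) = hdot _ u v.
  by have : E u by rewrite ET.
have Tnorm u : `|T u| = `|u|.
  by apply/eqP; rewrite -(@eqrXn2 _ 2)// -!hdot_norm Td.
have Tinj : injective T.
  move=> u v e; apply/eqP; rewrite -subr_eq0 -normr_eq0 -Tnorm linearB e subrr.
  by rewrite normr0.
have crange : closed (range T).
  move=> y yr.
  pose F : set_system (irr_space p) := [set B | exists2 V, nbhs y V & T @^-1` V `<=` B].
  have FF : ProperFilter F.
    split.
      move=> [V yV V0]; have [_ [[u _ <-] Vu]] := yr _ yV; exact: (V0 u).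
    split; first by exists setT => //; exact: filterT.
      move=> B C [V yV VB] [V' yV' VC]; exists (V `&` V'); first exact: filterI.
      by move=> u [/VB ? /VC].
    by move=> B C BC [V yV VB]; exists V => // u /VB /BC.
  have Fc : cauchy F.
    apply/cauchy_ballP => e e0.
    have e2 : 0 < e / 2 by rewrite divr_gt0.
    have FB : F (T @^-1` (ball y (e / 2))).
      by exists (ball y (e / 2)) => //; exact: nbhsx_ballx.
    exists (T @^-1` (ball y (e / 2)), T @^-1` (ball y (e / 2))) => //= -[u v] /= [hu hv].
    rewrite -ball_normE /ball_/= -Tnorm linearB.
    have := ball_splitr hu hv; by rewrite -ball_normE.
  have /cauchy_cvg Fu := Fc; pose u := lim F.
  exists u => //.
  have Tu : T @ F --> T u by apply: cvg_comp Fu _; exact: cT.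
  have Ty : T @ F --> y by move=> V yV; exists V.
  exact: (cvg_unique (@norm_hausdorff _ _) Tu Ty).
exists T; split => //.
have [||R0|RT] := irrq (range T).
- split => //; first by exists 0 => //; rewrite linear0.
  by move=> c _ _ [u _ <-] [v _ <-]; exists (c *: u + v) => //; rewrite linearD linearZ.
- by move=> a _ [u _ <-]; exists (p a u).
- have : range T (T w) by exists w.
  by rewrite R0 => /= e; case: w0; apply: Tinj; rewrite e linear0.
have surj y : exists u, T u = y.
  have : [set: irr_space q] y by [].
  by rewrite -RT => -[u _ uy]; exists u.
pose S y := projT1 (cid (surj y)).
have SK y : T (S y) = y by exact: (projT2 (cid (surj y))).
by exists S => // u; apply: Tinj; rewrite SK.
Qed.

End Intertwiners.

(** * Eigenvectors determine the representation *)

Section Eigenvectors.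
Variables (R : realType) (r : R) (rr : -1 < r < 1) (r0 : r != 0).
Local Notation phi := (moebius rr).
Local Notation phiV := (moebius (moebius_opp rr)).
Local Notation phiz := (iterz phi).
Local Notation CX := (continuousType (disk R) R[i]).
Variables (A : cstarAlg R) (iota : CX -> A) (U : A).
Hypothesis cp : is_crossed_product phi iota U.
Let cov := cp_covariant cp.

Lemma intertwine_crossed_product (H K : hilbert R) (p : representation A H)
  (q : representation A K) (T : {linear H -> K}) : continuous T ->
  (forall f v, T (p (iota f) v) = q (iota f) (T v)) ->
  (forall v, T (p U v) = q U (T v)) ->
  forall a v, T (p a v) = q a (T v).
Proof.
move=> cT Tf TU a v.
apply: (crossed_product_ind cp (S := [set a | T (p a v) = q a (T v)])) => /=.
- apply: closed_eq_continuous; last exact: rop_continuous_alg.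
  by move=> b; apply: (continuous_comp (@rop_continuous_alg _ _ _ p v b)); exact: cT.
- by move=> c b1 b2 e1 e2; rewrite !ropD !ropZ linearD linearZ/= e1 e2.
- by rewrite !rop1.
- by move=> f b e; rewrite !ropM Tf e.
- by move=> b e; rewrite !ropM TU e.
- move=> b e; rewrite !ropM -e; apply: (ropU_inj cov (p := q)).
  by rewrite -TU -!ropM (cov_unitaryr cov) cmul1l rop1.
Qed.

Section OrbitEigenvector.
Variables (H : hilbert R) (p : representation A H) (x : disk R) (w : H).
Hypotheses (xP : x \in punctured_disk R) (w1 : `|w| = 1).
Hypothesis wx : p (iota (disk_coord R)) w = set_val x *: w.

(** The translates of an eigenvector at [x] by the unitary are eigenvectors at
    the points of the orbit of [x]. *)
Definition eigen_orbit (n : int) : H :=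
  match n with
  | Posz k => iter k (p U) w
  | Negz k => iter k.+1 (p (cstar U)) w
  end.

Lemma eigen_orbitS n : eigen_orbit (n + 1) = p U (eigen_orbit n).
Proof.
case: n => [k|[|k]].
- by rewrite -PoszD addn1.
- by rewrite /= -ropM (cov_unitaryr cov) rop1.
- have -> : Negz k.+1 + 1 = Negz k by rewrite !NegzE -[k.+2]addn1 PoszD opprD addrNK.
  by rewrite /= -[in RHS]ropM (cov_unitaryr cov) rop1.
Qed.

Lemma eigen_orbitB n : eigen_orbit (n - 1) = p (cstar U) (eigen_orbit n).
Proof.
by rewrite -[in RHS](subrK 1 n) eigen_orbitS -ropM (cov_unitaryl cov) rop1.
Qed.

Lemma eigen_orbit_iota f n : p (iota f) (eigen_orbit n) = f (phiz n x) *: eigen_orbit n.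
Proof.
elim/int_updown_ind: n f => [|n IH|n IH] f; first exact: (iota_eigen cov wx).
  rewrite eigen_orbitS (iterz_moebiusS rr) -ropM (cov_U cov) ropM IH linearZ.
  by [].
have fE : f = ((f \o phiV : CX) \o phi : CX).
  by apply: cts_ext => y /=; rewrite (moebiusK rr).
rewrite eigen_orbitB (iterz_moebiusB rr) {1}fE -ropM (cov_Ustar cov) ropM IH linearZ.
by [].
Qed.

Lemma eigen_orbit_norm n : `|eigen_orbit n| = 1.
Proof.
elim/int_updown_ind: n => // n IH; first by rewrite eigen_orbitS (ropU_norm cov).
by rewrite eigen_orbitB (ropUstar_norm cov).
Qed.

Lemma iterz_inj : injective (fun n => phiz n x).
Proof.
move=> m n /(congr1 (@height R)); rewrite !(height_iterz rr)// => /addrI.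
by move=> /(mulIf (ln_multiplier_neq0 rr r0)) /eqP; rewrite eqr_int => /eqP.
Qed.

Lemma eigen_orbit_orthonormal m n : hdot H (eigen_orbit m) (eigen_orbit n) = (m == n)%:R.
Proof.
have [->|mn] := eqVneq m n; first by rewrite hdot_norm eigen_orbit_norm expr1n.
have : set_val (phiz m x) * hdot H (eigen_orbit m) (eigen_orbit n) =
       set_val (phiz n x) * hdot H (eigen_orbit m) (eigen_orbit n).
  have := hdot_iota cov p (disk_coord R) (eigen_orbit m) (eigen_orbit n).
  by rewrite !eigen_orbit_iota linearZl_LR linearZr_LR/= conjCK.
move=> /eqP; rewrite -subr_eq0 -mulrBl mulf_eq0 subr_eq0 => /orP[/eqP e|/eqP//].
by move/eqP : mn; case; apply: iterz_inj; exact: disk_ext.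
Qed.

Lemma eigen_coord_subproof v (N : nat) :
  zseries (fun k => sqnorm (hdot H v (eigen_orbit k))) N <= rnorm v ^+ 2.
Proof. exact: (bessel_le eigen_orbit_orthonormal). Qed.

Definition eigen_coord v : hilbert_l2Z R := l2of (ex_intro _ _ (eigen_coord_subproof v)).

Lemma eigen_coordE v n : (eigen_coord v : l2Z R) n = hdot H v (eigen_orbit n).
Proof. by []. Qed.

Lemma eigen_coord_linear : linear eigen_coord.
Proof.
move=> c u v; apply: l2_ext => n.
by rewrite l2DE l2ZE !eigen_coordE linearDl/= linearZl_LR.
Qed.

Lemma eigen_coord_norm v : `|eigen_coord v| <= `|v|.
Proof.
rewrite [X in _ <= X]rnormE; apply: l2_norm_le => [|n]; first exact: rnorm_ge0.
exact: eigen_coord_subproof.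
Qed.

End OrbitEigenvector.

Lemma normalize_eigenvector (H : hilbert R) (w : H) : w <> 0 ->
  exists2 w', `|w'| = 1 & exists c : R[i], w' = c *: w.
Proof.
move=> /eqP w0; exists (`|w|^-1 *: w); last by exists `|w|^-1.
by rewrite normrZ normfV normr_id mulVf// normr_eq0.
Qed.

Definition orbit_formulas (x : disk R) (q : representation A (hilbert_l2Z R)) :=
  (forall f v n, q (iota f) v n = f (phiz n x) * v n) /\ (forall v, q U v = l2shift v).

Definition character_formulas (t : R[i]) b (q : representation A (hilbert_C R)) :=
  (forall f v, q (iota f) v = f (disk_sign R b) * v) /\ (forall v, q U v = t * v).

(** The coordinates along the orthonormal family [eigen_orbit] define the
    intertwiner; going from the abstract space to [l^2(Z)], rather than back,
    spares the summation of a series of vectors. *)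
Lemma eigenvector_orbit_equiv (p : irrep A) (x : disk R) (w : irr_space p)
  (q : representation A (hilbert_l2Z R)) (irrq : irreducible q) :
  x \in punctured_disk R -> w <> 0 -> p (iota (disk_coord R)) w = set_val x *: w ->
  orbit_formulas x q -> unitary_equiv p (Irrep irrq).
Proof.
move=> xP /normalize_eigenvector[w' w'1 [c w'E]] wx [qf qU].
have w'x : p (iota (disk_coord R)) w' = set_val x *: w'.
  by rewrite w'E linearZ/= wx !scalerA mulrC.
pose T : {linear irr_space p -> hilbert_l2Z R} := HB.pack (eigen_coord xP w'1 w'x)
  (GRing.isLinear.Build _ _ _ _ _ (eigen_coord_linear xP w'1 w'x)).
have Tn v : `|T v| <= `|v| by exact: eigen_coord_norm.
have TE v n : (T v : l2Z R) n = hdot _ v (eigen_orbit p w' n) by [].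
have cT : continuous T.
  by apply: (@dist_continuous _ _ _ _ 1) => a b; rewrite mul1r -linearB.
apply: (@intertwiner_unitary _ _ p (Irrep irrq) T Tn).
  apply: intertwine_crossed_product => //.
    move=> f v; apply: l2_ext => n; rewrite qf !TE.
    by rewrite (hdot_iota cov) (eigen_orbit_iota w'x) linearZr_LR/= conjCK.
  move=> v; rewrite qU; apply: l2_ext => n; rewrite shiftE !TE.
  by rewrite hdot_starr eigen_orbitB.
exists w'; first by move=> w0; have := w'1; rewrite w0 normr0 => /eqP; rewrite eq_sym oner_eq0.
move=> v; have -> : T w' = l2basis R 0.
  apply: l2_ext => n; rewrite TE l2basisE eq_sym.
  exact: (eigen_orbit_orthonormal xP w'1 w'x 0 n).
by rewrite l2basis_dot TE [RHS]hdotC.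
Qed.

(** The coordinate along the unit eigenvector is the intertwiner. *)
Lemma eigenvector_character_equiv (p : irrep A) (t : R[i]) (b : bool) (w : irr_space p)
  (q : representation A (hilbert_C R)) (irrq : irreducible q) :
  w <> 0 -> p (iota (disk_coord R)) w = (-1) ^+ b *: w -> `|t| = 1 -> p U w = t *: w ->
  character_formulas t b q -> unitary_equiv p (Irrep irrq).
Proof.
move=> /normalize_eigenvector[w' w'1 [c w'E]] wx t1 wU [qf qU].
have w'x : p (iota (disk_coord R)) w' = set_val (disk_sign R b) *: w'.
  by rewrite w'E linearZ/= wx !scalerA mulrC.
have tt : t^*%R * t = 1 by rewrite mulrC -normCK t1 expr1n.
have w'U : p U w' = t *: w' by rewrite w'E linearZ/= wU !scalerA mulrC.
have w'Us : p (cstar U) w' = t^*%R *: w'.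
  apply: (ropU_inj cov (p := p)); rewrite -ropM (cov_unitaryr cov) rop1 linearZ/= w'U.
  by rewrite scalerA tt scale1r.
have Tl : linear (fun v => hdot _ v w' : hilbert_C R).
  by move=> z u v; rewrite linearDl/= linearZl_LR.
pose T : {linear irr_space p -> hilbert_C R} := HB.pack (fun v => hdot _ v w' : hilbert_C R)
  (GRing.isLinear.Build _ _ _ _ _ Tl).
have TE v : T v = hdot _ v w' by [].
have Tn v : `|T v| <= `|v|.
  by rewrite TE (le_trans (hdot_CauchySchwarz _ _))// w'1 mulr1.
have cT : continuous T.
  by apply: (@dist_continuous _ _ _ _ 1) => a a'; rewrite mul1r -linearB.
apply: (@intertwiner_unitary _ _ p (Irrep irrq) T Tn).
  apply: intertwine_crossed_product => //.
    move=> f v; rewrite qf !TE (hdot_iota cov) (iota_eigen cov w'x) linearZr_LR/= conjCK.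
    by [].
  by move=> v; rewrite qU !TE hdot_starr w'Us linearZr_LR/= conjCK.
exists w'; first by move=> w0; have := w'1; rewrite w0 normr0 => /eqP; rewrite eq_sym oner_eq0.
move=> v; rewrite !TE -[LHS]/(hdot _ w' w' * (hdot _ v w')^*%R) hdot_norm w'1 expr1n mul1r.
by rewrite -hdotC.
Qed.

End Eigenvectors.

(** * Existence of eigenvectors *)

Section Classification.
Variables (R : realType) (r : R) (rr : -1 < r < 1) (r0 : r != 0).
Local Notation phi := (moebius rr).
Local Notation phiV := (moebius (moebius_opp rr)).
Local Notation phiz := (iterz phi).
Local Notation CX := (continuousType (disk R) R[i]).
Variables (A : cstarAlg R) (iota : CX -> A) (U : A).
Hypothesis cp : is_crossed_product phi iota U.
Let cov := cp_covariant cp.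
Variables (H : hilbert R) (p : representation A H).

Definition iota_ker : set CX := [set f | forall v, p (iota f) v = 0].

Definition iota_support : set (disk R) := [set x | forall f, iota_ker f -> f x = 0].

(** By compactness finitely many elements of the kernel give a nonnegative [g]
    in the kernel with [|f|^2 <= e + g], whence [|p f v|^2 <= e |v|^2]. *)
Lemma iota_ker_support (f : CX) : (forall x, iota_support x -> f x = 0) -> iota_ker f.
Proof.
move=> fK v; apply: (@small_eq0 _ _ _ v) => e e0.
pose G : set CX := [set g : CX | (forall x, 0 <= g x) /\ iota_ker g].
have [||||g [g0 gk] gP] := @compact_domination R _ (@disk_compact R) G f e e0.
- split=> [x //|u]; have -> : (cst 0 : CX) = ctsZ 0 (cts1 R _).
    by apply: cts_ext => x; rewrite ctsZE mul0r.
  by rewrite (covZ cov) scale0r rop0.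
- move=> g h [g0 gk] [h0 hk]; split=> [x|u]; first by rewrite ctsDE addr_ge0.
  by rewrite (covD cov) ropD gk hk addr0.
- by move=> g [].
- move=> x; have [/fK|] := pselect (iota_support x); first by left.
  move=> /existsNP[h /not_implyP[hk /eqP hx]]; right.
  have hx0 : 0 < rnorm (h x) ^+ 2 by rewrite exprn_gt0// rnorm_gt0.
  pose C := (rnorm (f x) ^+ 2 + 1) / rnorm (h x) ^+ 2.
  have C0 : 0 <= C by rewrite divr_ge0 ?addr_ge0 ?sqr_ge0.
  have hh y : ctsM (cts_conj h) h y = `|h y| ^+ 2.
    by rewrite ctsME cts_conjE mulrC -normCK.
  exists (ctsZ C%:C (ctsM (cts_conj h) h)).
    split=> [y|u]; first by rewrite ctsZE hh mulr_ge0 ?lecR ?exprn_ge0.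
    by rewrite (covZ cov) (covM cov) ropZ ropM hk linear0 scaler0.
  by rewrite ctsZE hh !rnormE -!rmorphXn -rmorphM ltcR /C divfK ?ltrDl// gt_eqF.
rewrite -(iota_sqr cov).
pose k := ctsD (ctsZ e%:C (cts1 R (disk R))) g.
have kE y : k y = e%:C + g y by rewrite /k ctsDE [X in X + _]ctsZE cts1E mulr1.
apply: le_trans (iota_mono cov (g := k) p v _) _.
  by move=> y; rewrite ctsME cts_conjE mulrC -normCK kE; exact: gP.
by rewrite /k (covD cov) (covZ cov) (cov1 cov) ropD ropZ rop1 gk addr0 linearZl_LR/= hdot_norm.
Qed.

Lemma support_nonzero (x : disk R) (f : CX) : iota_support x -> f x <> 0 ->
  exists v, p (iota f) v <> 0.
Proof. by move=> Kx fx; apply/existsNP => fk; apply: fx; exact: Kx. Qed.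

Hypothesis irr : irreducible p.

(** Functions supported near two different orbits have disjoint invariant
    supports, so that one of them acts as zero. *)
Lemma support_one_orbit (x y : disk R) : iota_support x -> iota_support y ->
  x \in punctured_disk R -> y \in punctured_disk R -> exists n, y = phiz n x.
Proof.
move=> Kx Ky xP yP; apply: contrapT => /forallNP nxy.
have [d d0 dsep] := orbit_separation r0 xP yP nxy.
have d2 : 0 < d / 2 by rewrite divr_gt0.
pose f1 := orbit_bump x (d / 2); pose f2 := orbit_bump y (d / 2).
pose I : set CX := [set f | forall z, (forall n, f1 (phiz n z) = 0) -> f z = 0].
pose N : set H := [set v | forall f, I f -> p (iota f) v = 0].
have Nsub : closed_subspace N.
  split.
  - rewrite (_ : N = \bigcap_(f in I) [set v | p (iota f) v = 0]); last first.
      by apply/seteqP; split => v h f If; exact: h.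
    apply: closed_bigI => f _.
    by apply: closed_eq_continuous; [exact: rop_continuous|exact: cst_continuous].
  - by move=> f _; rewrite linear0.
  - by move=> c u v Nu Nv f If; rewrite linearD linearZ/= Nu// Nv// scaler0 addr0.
have NI : forall a v, N v -> N (p a v).
  apply: (invariant_crossed_product cp) => //.
  - move=> g v Nv f If; rewrite -ropM -(covM cov); apply: Nv => z fz.
    by rewrite ctsME If// mul0r.
  - move=> v Nv f If; rewrite -ropM (cov_U cov) ropM Nv ?linear0// => z fz.
    by rewrite /=; apply: If => n; rewrite (iterz_moebiusSr rr) -(iterz_moebiusS rr).
  - move=> v Nv f If.
    have fE : f = ((f \o phiV : CX) \o phi : CX).
      by apply: cts_ext => z /=; rewrite (moebiusK rr).
    rewrite fE -ropM (cov_Ustar cov) ropM Nv ?linear0// => z fz.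
    rewrite /=; apply: If => n; have -> : phiV z = phiz (-1) z.
      by rewrite -[-1]add0r (iterz_moebiusB rr).
    by rewrite -(iterz_moebiusD rr).
have f2N v : N (p (iota f2) v).
  move=> f If; rewrite -ropM -(covM cov).
  have -> : ctsM f f2 = ctsZ 0 (cts1 R _).
    apply: cts_ext => z; rewrite ctsME ctsZE mul0r.
    have [->|f2z] := pselect (f2 z = 0); first by rewrite mulr0.
    have [zP|[b zb]] := punctured_cases z; last by case: f2z; rewrite zb bump_sign.
    rewrite If ?mul0r// => n; apply: contrapT => f1z.
    have := bump_neq0 d2 f1z; have := bump_neq0 d2 f2z; rewrite /orbit_dist.
    rewrite (direction_iterz rr)// (height_iterz rr)// => h1 h2.
    have := dsep (- n); rewrite leNgt => /negP; apply.
    have n1 : `|height x - height y + (- n)%:~R * ln (multiplier r)| <=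
        `|height z - height y| + `|height z + n%:~R * ln (multiplier r) - height x|.
      rewrite rmorphN mulNr.
      have -> : height x - height y - n%:~R * ln (multiplier r) =
        (height z - height y) - (height z + n%:~R * ln (multiplier r) - height x) by lra.
      exact: ler_normB.
    have n2 : rnorm (direction x - direction y) <=
        rnorm (direction z - direction y) + rnorm (direction z - direction x).
      rewrite -lecR rmorphD/= -!rnormE.
      have -> : direction x - direction y =
        (direction z - direction y) - (direction z - direction x) by ring.
      exact: ler_normB.
    lra.
  by rewrite (covZ cov) scale0r rop0.
have [_ irrp] := irr.
have f2y : f2 y <> 0 by exact: bump_self.
have [v2 v20] := support_nonzero Ky f2y.
have [//|//|N0|NT] := irrp N.
  by apply: v20; have := f2N v2; rewrite N0.
have f1x : f1 x <> 0 by exact: bump_self.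
have [v1 v10] := support_nonzero Kx f1x; apply: v10.
have : N v1 by rewrite NT.
by apply => z /(_ 0).
Qed.

Definition has_orbit_eigenvector := exists2 x, x \in punctured_disk R &
  exists2 w, w <> 0 & p (iota (disk_coord R)) w = set_val x *: w.

Definition has_character_eigenvector := exists t : R[i], exists b : bool, `|t| = 1 /\
  exists2 w, w <> 0 & p (iota (disk_coord R)) w = (-1) ^+ b *: w /\ p U w = t *: w.

(** Multiplied by a function [g] isolating [x] in its orbit, [z - x] vanishes
    on the whole support: the range of [g] consists of eigenvectors. *)
Lemma orbit_support_eigenvector x : iota_support x -> x \in punctured_disk R ->
  has_orbit_eigenvector.
Proof.
move=> Kx xP; have k0 := ln_multiplier_neq0 rr r0.
pose g := orbit_bump x `|ln (multiplier r)|.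
have gx : g x <> 0 by apply: bump_self; rewrite ?normr_gt0.
have [v v0] := support_nonzero Kx gx; exists x => //; exists (p (iota g) v) => //.
apply/eqP; rewrite -subr_eq0 -(iota_shift cov) -ropM -(covM cov); apply/eqP.
apply: iota_ker_support => y Ky.
rewrite ctsME ctsDE !ctsZE cts1E mulr1 mulN1r.
have [yP|[b yb]] := punctured_cases y; last by rewrite yb bump_sign mulr0.
have [n yn] := support_one_orbit Kx Ky xP yP.
have [n0|n0] := eqVneq n 0; first by rewrite yn n0 /= subrr mul0r.
by rewrite yn (bump_iterz rr r0 (n := 0)) ?mulr0.
Qed.

(** Functions act through their values at the two fixed points, so they commute
    with the unitary; Schur's lemma applies first to the coordinate function
    and then to the unitary. *)
Lemma fixed_support_eigenvector : (forall x, iota_support x -> x \notin punctured_disk R) ->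
  has_character_eigenvector.
Proof.
move=> Kfix; have [[v0 v00] _] := irr.
have kerI (f : CX) : (forall b, f (disk_sign R b) = 0) -> iota_ker f.
  move=> fb; apply: iota_ker_support => x /Kfix.
  by have [->//|[b ->]] := punctured_cases x; rewrite fb.
have kereq (f g : CX) : (forall b, f (disk_sign R b) = g (disk_sign R b)) ->
    forall v, p (iota f) v = p (iota g) v.
  move=> fg v; apply/eqP; rewrite -subr_eq0 -ropB -(covB cov); apply/eqP.
  by apply: kerI => b; rewrite ctsDE ctsZE fg mulN1r subrr.
(* on the support, [f \o phi] and [f] agree *)
have zc : central p (iota (disk_coord R)).
  apply: (commute_crossed_product cp) => [f v|v].
    rewrite -!ropM -!(covM cov); congr (p (iota _) v).
    by apply: cts_ext => x; rewrite !ctsME mulrC.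
  rewrite -ropM (cov_U cov) ropM; congr (p U _); apply: kereq => b.
  by rewrite /= (moebius_sign rr).
have [z zE] := central_scalar irr zc.
have zz : (z - 1) * (z + 1) = 0.
  have h : p (iota (ctsM (disk_coord R) (disk_coord R))) v0 = v0.
    rewrite -[RHS](rop1 p) -(cov1 cov); apply: kereq => b.
    by rewrite ctsME cts1E -expr2; exact: sqrr_sign.
  move: h; rewrite (covM cov) ropM !zE scalerA => /eqP.
  rewrite -subr_eq0 -[X in _ - X]scale1r -scalerBl scaler_eq0 => /orP[/eqP e|/eqP//].
  by rewrite -e; ring.
have [b zb] : exists b : bool, z = (-1) ^+ b.
  move/eqP : zz; rewrite mulf_eq0 subr_eq0 addr_eq0 => /orP[/eqP ->|/eqP ->].
    by exists false; rewrite expr0.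
  by exists true; rewrite expr1.
have pf f v : p (iota f) v = f (disk_sign R b) *: v.
  by apply: (iota_eigen cov); rewrite zE zb.
have Uc : central p U.
  apply: (commute_crossed_product cp) => // f v.
  by rewrite !pf linearZ.
have [t tE] := central_scalar irr Uc.
exists t, b; split; last by exists v0 => //; split => //; rewrite zE zb.
have := ropU_norm cov p v0; rewrite tE normrZ => e.
by apply: (@mulIf _ `|v0|); rewrite ?mul1r// normr_eq0; exact/eqP.
Qed.

Lemma classification : has_orbit_eigenvector \/ has_character_eigenvector.
Proof.
have [[x [Kx xP]]|no] := pselect (exists x, iota_support x /\ x \in punctured_disk R).
  by left; exact: orbit_support_eigenvector Kx xP.
right; apply: fixed_support_eigenvector => x Kx; apply/negP => xP.
by apply: no; exists x.
Qed.

End Classification.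

(** * The parametrization of the spectrum *)

Section SpectrumParametrization.
Variables (R : realType) (r : R) (rr : -1 < r < 1) (r0 : r != 0).
Local Notation phi := (moebius rr).
Local Notation phiz := (iterz phi).
Local Notation CX := (continuousType (disk R) R[i]).
Variables (A : cstarAlg R) (iota : CX -> A) (U : A).
Hypothesis cp : is_crossed_product phi iota U.
Let cov := cp_covariant cp.
Implicit Types (x y : punctured_disk R) (p : irrep A) (m : spectrum_model phi).

Definition pi_rep (x : disk R) : representation A (hilbert_l2Z R) :=
  projT1 (cid (orbit_model cp x)).

Lemma pi_repP (x : disk R) : orbit_formulas rr iota U x (pi_rep x).
Proof. exact: (projT2 (cid (orbit_model cp x))). Qed.

Lemma punctured_mem x : set_val x \in punctured_disk R.
Proof. exact: valP. Qed.

Lemma pi_rep_irreducible x : irreducible (pi_rep (set_val x)).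
Proof.
have [pf pU] := pi_repP (set_val x).
exact: (orbit_irreducible cp r0 (punctured_mem x) pf pU).
Qed.

Definition pi_irrep x : irrep A := Irrep (@pi_rep_irreducible x).

Lemma circle_norm (t : circle R) : `|set_val t| = 1.
Proof. by have := valP t; rewrite inE. Qed.

Definition chi_rep (t : circle R) (b : bool) : representation A (hilbert_C R) :=
  projT1 (cid (character_model cp b (circle_norm t))).

Lemma chi_repP (t : circle R) b : character_formulas iota U (set_val t) b (chi_rep t b).
Proof. exact: (projT2 (cid (character_model cp b (circle_norm t)))). Qed.

Definition chi_irrep (t : circle R) (b : bool) : irrep A :=
  Irrep (character_irreducible (chi_rep t b)).

Definition model_irrep m : irrep A :=
  match m with
  | inl c => pi_irrep (repr c)
  | inr tb => chi_irrep tb.1 tb.2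
  end.

(** A point of the model determines a representation through the eigenvectors
    of the coordinate function (and of the unitary, over the fixed points). *)
Definition joint_eigen p m : Prop :=
  match m with
  | inl c => exists2 x, orbit_class phi x = c &
      exists2 w, w <> 0 & p (iota (disk_coord R)) w = set_val (set_val x) *: w
  | inr tb => exists2 w, w <> 0 &
      p (iota (disk_coord R)) w = (-1) ^+ tb.2 *: w /\ p U w = set_val tb.1 *: w
  end.

Lemma orbit_classP x y :
  orbit_class phi x = orbit_class phi y <-> exists n, set_val y = phiz n (set_val x).
Proof.
rewrite -(orbitP rr); split => [/eqquotP/asboolP//|e].
by apply/eqquotP/asboolP.
Qed.

Lemma joint_eigen_equiv p q m : unitary_equiv p q -> joint_eigen p m -> joint_eigen q m.
Proof.
move=> [T [bT _ Tp]].
have T0 w : w <> 0 -> T w <> 0.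
  by move=> w0 Tw; apply: w0; apply: (bij_inj bT); rewrite Tw linear0.
case: m => [c|tb] /=.
  move=> [x xc [w w0 wx]]; exists x => //; exists (T w); first exact: T0.
  by rewrite -Tp wx linearZ.
move=> [w w0 [wx wU]]; exists (T w); first exact: T0.
by rewrite -!Tp wx wU !linearZ.
Qed.

Lemma pi_irrep_eigen x n (q : representation A (hilbert_l2Z R)) :
  orbit_formulas rr iota U (set_val x) q ->
  q (iota (disk_coord R)) (l2basis R n) = set_val (phiz n (set_val x)) *: l2basis R n.
Proof.
move=> [qf _]; apply: l2_ext => k; rewrite qf l2ZE l2basisE.
by have [->//|kn] := eqVneq k n; rewrite !mulr0.
Qed.

Lemma model_joint_eigen m : joint_eigen (model_irrep m) m.
Proof.
case: m => [c|[t b]] /=.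
  exists (repr c); first exact: reprK.
  exists (l2basis R 0); first exact: l2basis_neq0.
  exact: (pi_irrep_eigen 0 (pi_repP _)).
have [cf cU] := chi_repP t b.
by exists (1 : R[i]); [move=> /eqP; rewrite oner_eq0|rewrite cf cU].
Qed.

Lemma joint_eigen_model p m : joint_eigen p m -> unitary_equiv p (model_irrep m).
Proof.
case: m => [c|[t b]] /=; last first.
  move=> [w w0 [wx wU]].
  exact: (eigenvector_character_equiv cp _ w0 wx (circle_norm t) wU (chi_repP t b)).
move=> [x xc [w w0 wx]].
apply: (@unitary_equiv_trans _ _ _ (pi_irrep x)).
  exact: (eigenvector_orbit_equiv r0 cp _ (punctured_mem x) w0 wx (pi_repP _)).
have [n xn] : exists n, set_val (repr c) = phiz n (set_val x).
  by apply/orbit_classP; rewrite xc; apply/esym; exact: reprK.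
apply: (eigenvector_orbit_equiv r0 cp (w := (l2basis R n : irr_space (pi_irrep x))) _ (punctured_mem (repr c)) _ _ (pi_repP _)).
  exact: l2basis_neq0.
by rewrite xn; exact: (pi_irrep_eigen n (pi_repP _)).
Qed.

Lemma joint_eigen_exists p : exists m, joint_eigen p m.
Proof.
have [[x xP [w w0 wx]]|[t [b [t1 [w w0 wx]]]]] := classification r0 cp (irr_irreducible p).
  by exists (inl (orbit_class phi (SigSub xP))); exists (SigSub xP) => //; exists w.
have tP : t \in circle R by rewrite inE.
by exists (inr (SigSub tP, b)); exists w.
Qed.

Lemma sign_not_punctured x (b : bool) : set_val (set_val x) <> (-1) ^+ b.
Proof.
move=> e; have /puncturedP[h1 h2] := punctured_mem x.
case: b e => e; first by rewrite e expr1 eqxx in h2.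
by rewrite e expr0 eqxx in h1.
Qed.

Lemma joint_eigen_unique p m m' : joint_eigen p m -> joint_eigen p m' -> m = m'.
Proof.
move=> /joint_eigen_model pm /(joint_eigen_equiv pm) {p pm}.
case: m => [c|[t b]] /=.
  have [pf pU] := pi_repP (set_val (repr c)).
  have coord (w : l2Z R) (z : R[i]) : w <> 0 ->
      pi_rep (set_val (repr c)) (iota (disk_coord R)) w = z *: w ->
      exists n, z = set_val (phiz n (set_val (repr c))).
    move=> w0 wz; have [n wn] : exists n, w n <> 0.
      by apply: contra_notP w0 => /forallNP h; apply: l2_ext => n; exact: contrapT (h n).
    exists n; have := congr1 (fun u : l2Z R => u n) wz; rewrite pf l2ZE => e.
    by apply: (@mulIf _ (w n)); [exact/eqP|exact: esym e].
  case: m' => [c'|[t' b']] /=.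
    move=> [y <- [w w0 /(coord _ _ w0)[n yn]]]; congr inl.
    rewrite -[LHS](reprK c); apply/orbit_classP; exists n; exact: disk_ext.
  move=> [w w0 [/(coord _ _ w0)[n yn] _]].
  have xP := iterz_punctured rr n (punctured_mem (repr c)).
  by have := @sign_not_punctured (SigSub xP) b'; rewrite -yn.
have [cf cU] := chi_repP t b.
case: m' => [c'|[t' b']] /=.
  move=> [y _ [w /eqP w0]]; rewrite cf => /(mulIf w0) e.
  by have := @sign_not_punctured y b; rewrite -e.
move=> [w /eqP w0 []]; rewrite cf cU => /(mulIf w0) eb /(mulIf w0) et.
congr (inr (_, _)); first exact: val_inj.
have {}eb : (-1) ^+ b = (-1) ^+ b' :> R[i] by exact: eb.
move: eb; case: (b); case: (b') => //; rewrite expr0 expr1 => /eqP.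
  by rewrite eq_sym -subr_eq0 opprK -mulr2n pnatr_eq0.
by rewrite -subr_eq0 opprK -mulr2n pnatr_eq0.
Qed.

Lemma spec_classP p p' : spec_class p = spec_class p' <-> unitary_equiv p p'.
Proof.
split=> [/(congr1 (@sval _ _)) /= ->|e]; first exact: unitary_equiv_refl.
apply: eq_exist => /=; apply/funext => s; apply/propext; split.
  by apply: unitary_equiv_trans; exact: unitary_equiv_sym.
exact: unitary_equiv_trans.
Qed.

Lemma spec_class_surj (c : spectrum A) : exists p, c = spec_class p.
Proof. by case: c => c [p cp']; exists p; apply: eq_exist. Qed.

Lemma spectrum_point (c : spectrum A) : exists m, c = spec_class (model_irrep m).
Proof.
have [p ->] := spec_class_surj c; have [m pm] := joint_eigen_exists p.
by exists m; apply/spec_classP; exact: joint_eigen_model.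
Qed.

Definition spec_param (c : spectrum A) : spectrum_model phi := projT1 (cid (spectrum_point c)).

Lemma spec_paramK : cancel spec_param (fun m => spec_class (model_irrep m)).
Proof. by move=> c; rewrite /spec_param; case: cid. Qed.

Lemma joint_eigen_spec_param p m : joint_eigen p m -> spec_param (spec_class p) = m.
Proof.
move=> pm; have := spec_paramK (spec_class p); set m' := spec_param _ => /spec_classP e.
by apply: (@joint_eigen_unique p) => //; apply: joint_eigen_equiv e _; exact: model_joint_eigen.
Qed.

Lemma spec_param_model m : spec_param (spec_class (model_irrep m)) = m.
Proof. by apply: joint_eigen_spec_param; exact: model_joint_eigen. Qed.

Lemma spec_param_bij : bijective spec_param.
Proof.
exists (fun m => spec_class (model_irrep m)); first exact: spec_paramK.
exact: spec_param_model.
Qed.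

Lemma spec_param_is_q : is_q iota U spec_param.
Proof.
split=> [x p irr px|theta b p irr th pt]; apply: joint_eigen_spec_param => /=.
  exists x => //; exists (l2basis R 0); first exact: l2basis_neq0.
  by have [-> _] := px 0.
exists (1 : R[i]); first by move=> /eqP; rewrite oner_eq0.
by have [-> ->] := pt 1.
Qed.

Lemma ReIm_eta (z : R[i]) : Re z +i* Im z = z. Proof. by case: z. Qed.

Lemma circle_pt_surj (t : circle R) : exists2 theta : R, 0 <= theta < 1 & circle_pt theta = t.
Proof.
have t1 := circle_norm t.
have ab : Re (set_val t) ^+ 2 + Im (set_val t) ^+ 2 = 1.
  have := add_Re2_Im2 (set_val t); rewrite t1 expr1n => e.
  by apply: (@complexI R); rewrite e.
have pi0 : 0 < pi :> R := pi_gt0 R.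
suff [al al0 [ca sa]] : exists2 al : R, 0 <= al < 2 * pi & cos al = Re (set_val t) /\ sin al = Im (set_val t).
  exists (al / (2 * pi)).
    by case/andP: al0 => ? ?; rewrite divr_ge0 ?mulr_ge0 ?(ltW pi0)//= ltr_pdivrMr ?mulr_gt0// mul1r.
  apply: val_inj => /=; rewrite /cis mulrC divfK ?mulf_neq0 ?gt_eqF//.
  by rewrite ca sa; exact: ReIm_eta.
move: ab; set a := Re _; set b := Im _ => ab.
have a1 : -1 <= a <= 1 by apply/andP; split; nra.
have sE : sin (acos a) = `|b|.
  by rewrite sin_acos// -ab addrC addKr sqrtr_sqr.
have [b0|b0] := leP 0 b.
  exists (acos a); last by rewrite acosK ?in_itv//= sE ger0_norm.
  by rewrite acos_ge0//=; apply: le_lt_trans (acos_lepi a1) _; lra.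
have a1' : -1 <= a < 1 by apply/andP; split; nra.
exists (2 * pi - acos a).
  have := acos_gt0 a1'; have := acos_lepi a1 => h1 h2.
  by apply/andP; split; lra.
have -> : 2 * pi - acos a = - acos a + pi *+ 2 by rewrite mulr_natl addrC.
rewrite cosD2pi sinD2pi cosN sinN acosK ?in_itv//= sE.
by rewrite ltr0_norm// opprK.
Qed.

Lemma is_q_unique (q : spectrum A -> spectrum_model phi) : is_q iota U q -> q = spec_param.
Proof.
move=> [q1 q2]; apply/funext => c; rewrite -(spec_paramK c) spec_param_model.
case: (spec_param c) => [d|[t b]] /=.
  rewrite (q1 (repr d)); first by congr inl; exact: reprK.
  move=> n; split; first exact: (pi_irrep_eigen n (pi_repP _)).
  by have [_ ->] := pi_repP (set_val (repr d)); rewrite shift_basis.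
have [theta th tE] := circle_pt_surj t; have [cf cU] := chi_repP t b.
rewrite (q2 theta b) ?tE// => v; rewrite cf cU -tE.
by split.
Qed.

End SpectrumParametrization.

(** * Kernels and matrix coefficients *)

Section ComplexContinuity.
Variables (R : realType) (X : topologicalType).
Implicit Types f g : X -> R[i].

Lemma continuous_addC f g : continuous f -> continuous g -> continuous (fun x => f x + g x).
Proof.
move=> cf cg x; have FF := nbhs_filter x.
exact: (@cvgD R[i] R[i] _ _ _ f g (f x) (g x) (cf x) (cg x)).
Qed.

Lemma continuous_mulC f g : continuous f -> continuous g -> continuous (fun x => f x * g x).
Proof.
move=> cf cg x; have FF := nbhs_filter x.
exact: (@cvgM R[i] _ _ _ f g (f x) (g x) (cf x) (cg x)).
Qed.

End ComplexContinuity.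

Section JacobsonTopology.
Variables (R : realType) (r : R) (rr : -1 < r < 1) (r0 : r != 0).
Local Notation phi := (moebius rr).
Local Notation phiz := (iterz phi).
Local Notation CX := (continuousType (disk R) R[i]).
Variables (A : cstarAlg R) (iota : CX -> A) (U : A).
Hypothesis cp : is_crossed_product phi iota U.
Let cov := cp_covariant cp.
Implicit Types (m : spectrum_model phi).

Local Notation pi_rep := (pi_rep cp).
Local Notation chi_rep := (chi_rep cp).
Local Notation model_irrep := (model_irrep r0 cp).
Local Notation spec_param := (spec_param r0 cp).

Definition model_ker m : set A := [set a | forall v, model_irrep m a v = 0].

Lemma unitary_equiv_ker (p q : irrep A) a : unitary_equiv p q ->
  (forall v, p a v = 0) -> forall v, q a v = 0.
Proof.
move=> [T [[S TK SK] _ Tp]] pa v.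
by rewrite -(SK v) -Tp pa linear0.
Qed.

Lemma spec_ker_model m a : spec_ker (spec_class (model_irrep m)) a <-> model_ker m a.
Proof.
split=> [h|h p /= mp]; first by apply: h; exact: unitary_equiv_refl.
exact: unitary_equiv_ker mp h.
Qed.

Lemma jacobson_closed_model (F : set (spectrum_model phi)) :
  jacobson_closed (fun c => F (spec_param c)) <->
  forall m, (forall a, (forall m', F m' -> model_ker m' a) -> model_ker m a) -> F m.
Proof.
split=> [h m hm|h c hc].
  have := h (spec_class (model_irrep m)); rewrite spec_param_model; apply => a ha.
  apply/spec_ker_model; apply: hm => m' Fm'; apply/spec_ker_model.
  by apply: ha; rewrite spec_param_model.
rewrite -(spec_paramK r0 cp c) spec_param_model; apply: h => a ha.
apply/spec_ker_model; rewrite spec_paramK; apply: hc => c'.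
by rewrite -(spec_paramK r0 cp c') spec_param_model => Fc'; apply/spec_ker_model/ha.
Qed.

Lemma model_ker_orbit (x : punctured_disk R) a : model_ker (inl (orbit_class phi x)) a <-> forall v, pi_rep (set_val x) a v = 0.
Proof.
have e : unitary_equiv (pi_irrep r0 cp x) (model_irrep (inl (orbit_class phi x))).
  apply: joint_eigen_model; exists x => //; exists (l2basis R 0); first exact: l2basis_neq0.
  exact: (pi_irrep_eigen 0 (pi_repP cp _)).
split=> h; first exact: (unitary_equiv_ker (unitary_equiv_sym e) h).
exact: (unitary_equiv_ker e h).
Qed.

(** A limit of continuous functions for the uniform distance; this makes
    continuity in the parameter a closed condition on the algebra element. *)
Lemma closed_continuous_family (X : topologicalType) (g : A -> X -> R[i]) :
  (forall a b x, `|g a x - g b x| <= `|a - b|) -> closed [set a | continuous (g a)].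
Proof.
move=> gl a acl x; have FF := nbhs_filter x.
apply/cvgrPdist_lt => e e0; have e4 : 0 < e / 4 by rewrite divr_gt0.
have [b [/= cb ab]] := acl _ (nbhsx_ballx a _ e4).
move: ab; rewrite -ball_normE /ball_/= => ab.
have e2 : 0 < e / 2 by rewrite divr_gt0.
have /cvgrPdist_lt/(_ _ e2) := cb x; apply: filterS => y gy.
have -> : g a x - g a y = (g a x - g b x) + (g b x - g b y) + (g b y - g a y) by ring.
have -> : e = e / 4 + e / 2 + e / 4 by field.
rewrite (le_lt_trans (ler_normD _ _))// ltrD//; last by rewrite distrC (le_lt_trans (gl _ _ _)).
rewrite (le_lt_trans (ler_normD _ _))// ltrD//.
by rewrite (le_lt_trans (gl _ _ _)).
Qed.

Section MatrixCoefficients.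

Definition coef (n k : int) (a : A) (x : disk R) : R[i] := (pi_rep x a (l2basis R n) : l2Z R) k.

Lemma coef_lipschitz n k a b x : `|coef n k a x - coef n k b x| <= `|a - b|.
Proof.
have -> : coef n k a x - coef n k b x = (pi_rep x (a - b) (l2basis R n) : l2Z R) k.
  by rewrite ropB.
rewrite (le_trans (l2norm_coord _ _))//.
apply: le_trans (rop_contraction (pi_rep x) (a - b) (l2basis R n)) _.
by have -> : `|l2basis R n : hilbert_l2Z R| = 1; [exact: l2basis_norm|rewrite mulr1].
Qed.

Lemma iterz_continuous k : continuous (fun x : disk R => phiz k x).
Proof.
elim/int_updown_ind: k => [|k IH|k IH] x; first exact: cvg_id.
  rewrite (funext (iterz_moebiusS rr k)).
  apply: (@continuous_comp _ _ _ (fun x => phiz k x) phi); first exact: IH.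
  exact: cts_fun.
rewrite (funext (iterz_moebiusB rr k)).
apply: (@continuous_comp _ _ _ (fun x => phiz k x) (moebius (moebius_opp rr))); first exact: IH.
exact: cts_fun.
Qed.

Lemma coef_continuous n a k : continuous (coef n k a).
Proof.
move: k; apply: (crossed_product_ind cp (S := [set a | forall k, continuous (coef n k a)])).
- rewrite (_ : [set a | _] = \bigcap_(k in setT) [set a | continuous (coef n k a)]); last first.
    by apply/seteqP; split => b h k; [move=> _; exact: h|exact: h].
  apply: closed_bigI => k _; apply: closed_continuous_family => b c x.
  exact: coef_lipschitz.
- move=> c a1 a2 h1 h2 k; rewrite (_ : coef n k _ = fun x => c * coef n k a1 x + coef n k a2 x).
    apply: continuous_addC; last exact: h2.
    by apply: continuous_mulC; [exact: cst_continuous|exact: h1].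
  by apply/funext => y; rewrite /coef ropD ropZ.
- move=> k; rewrite (_ : coef n k _ = fun=> l2basis R n k); first exact: cst_continuous.
  by apply/funext => y; rewrite /coef rop1.
- move=> f b h k; rewrite (_ : coef n k _ = fun x => f (phiz k x) * coef n k b x).
    apply: continuous_mulC; last exact: h.
    move=> x; apply: (@continuous_comp _ _ _ (fun x => phiz k x) f); last exact: cts_fun.
    exact: iterz_continuous.
  by apply/funext => y; rewrite /coef ropM; have [-> _] := pi_repP cp y.
- move=> b h k x; rewrite (_ : coef n k _ = coef n (k - 1) b); first exact: h.
  by apply/funext => y; rewrite /coef ropM; have [_ ->] := pi_repP cp y.
- move=> b h k x; rewrite (_ : coef n k _ = coef n (k + 1) b); first exact: h.
  apply/funext => y; have [_ yU] := pi_repP cp y.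
  have -> : coef n k (cstar U ** b) y = coef n (k + 1) (U ** (cstar U ** b)) y.
    by rewrite /coef [in RHS]ropM yU shiftE addrK.
  by rewrite cmulA (cov_unitaryr cov) cmul1l.
Qed.

Lemma pi_rep_eq0 (x : punctured_disk R) a : (forall n k, coef n k a (set_val x) = 0) -> forall v, pi_rep (set_val x) a v = 0.
Proof.
move=> h; apply: (@l2_linear_ext R (hilbert_l2Z R) (pi_rep (set_val x) a) (fun=> 0)).
- exact: rop_continuous.
- exact: cst_continuous.
- by move=> c u v; rewrite linearD linearZ.
- by move=> c u v; rewrite scaler0 addr0.
- by move=> n; apply: l2_ext => k; exact: h.
Qed.

End MatrixCoefficients.

Section Characters.

Definition chi (a : A) (tb : (circle R * bool)%type) : R[i] := chi_rep tb.1 tb.2 a (1 : R[i]).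

Lemma chi_repE t b a v : chi_rep t b a v = chi a (t, b) * v.
Proof.
rewrite /chi/= -[LHS]/(chi_rep t b a v) -{1}[v]mulr1 -[v * 1]/(v *: (1 : R[i]^o)) .
rewrite -[LHS]/(chi_rep t b a (v *: (1 : hilbert_C R))) linearZ/=.
by rewrite mulrC.
Qed.

Lemma model_ker_chi t b a : model_ker (inr (t, b)) a <-> chi a (t, b) = 0.
Proof.
split=> [h|h v]; first exact: h.
by rewrite /= chi_repE h mul0r.
Qed.

Lemma chiM a b tb : chi (a ** b) tb = chi a tb * chi b tb.
Proof. by case: tb => t e; rewrite /chi ropM chi_repE. Qed.

Lemma chiD a b tb : chi (a + b) tb = chi a tb + chi b tb.
Proof. by rewrite /chi ropD. Qed.

Lemma chiZ (c : R[i]) a tb : chi (c *: a) tb = c * chi a tb.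
Proof. by rewrite /chi ropZ. Qed.

Lemma chiB a b tb : chi (a - b) tb = chi a tb - chi b tb.
Proof. by rewrite /chi ropB. Qed.

Lemma chi1 tb : chi (cone A) tb = 1.
Proof. by rewrite /chi rop1. Qed.

Lemma chi_star a tb : chi (cstar a) tb = (chi a tb)^*%R.
Proof.
have := rop_star (chi_rep tb.1 tb.2) a (1 : R[i]) (1 : R[i]).
rewrite -[hdot _ _ _]/(chi (cstar a) tb * 1^*%R) -[X in _ = X]/(1 * (chi a tb)^*%R).
by rewrite conjC1 mulr1 mul1r.
Qed.

Lemma chi_le a tb : `|chi a tb| <= `|a|.
Proof.
have := rop_contraction (chi_rep tb.1 tb.2) a (1 : R[i]).
by rewrite -[X in _ <= _ * X]/(`|1 : R[i]|) normr1 mulr1.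
Qed.

Lemma chi_iota f t b : chi (iota f) (t, b) = f (disk_sign R b).
Proof. by rewrite /chi; have [-> _] := chi_repP cp t b; rewrite mulr1. Qed.

Lemma chi_U t b : chi U (t, b) = set_val t.
Proof. by rewrite /chi; have [_ ->] := chi_repP cp t b; rewrite mulr1. Qed.

Lemma chi_continuous a : continuous (chi a).
Proof.
have ct : continuous (fun tb : (circle R * bool)%type => set_val tb.1 : R[i]).
  move=> tb; apply: (@continuous_comp _ _ _ fst (@set_val _ (circle R))); first exact: cvg_fst.
  exact: initial_continuous.
apply: (crossed_product_ind cp (S := [set a | continuous (chi a)])).
- apply: closed_continuous_family => b c x; rewrite -chiB; exact: chi_le.
- move=> c a1 a2 h1 h2; rewrite /= (_ : chi _ = fun x => c * chi a1 x + chi a2 x).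
    apply: continuous_addC; last exact: h2.
    by apply: continuous_mulC; [exact: cst_continuous|exact: h1].
  by apply/funext => y; rewrite chiD chiZ.
- rewrite /= (_ : chi _ = fun=> 1); first exact: cst_continuous.
  by apply/funext => y; rewrite chi1.
- move=> f b h; rewrite /= (_ : chi _ = fun x => f (disk_sign R x.2) * chi b x).
    apply: continuous_mulC; last exact: h.
    move=> x; apply: (@continuous_comp _ _ _ snd (fun b : bool => f (disk_sign R b))); first exact: cvg_snd.
    move=> V fV; have FF := nbhs_filter (x.2 : bool).
    apply: (@filterS _ _ FF [set x.2]); last exact: discrete_set1.
    by move=> _ ->; exact: (nbhs_singleton fV).
  by apply/funext => -[t e]; rewrite chiM chi_iota.
- move=> b h; rewrite /= (_ : chi _ = fun x => set_val x.1 * chi b x).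
    by apply: continuous_mulC; [exact: ct|exact: h].
  by apply/funext => -[t e]; rewrite chiM chi_U.
- move=> b h; rewrite /= (_ : chi _ = fun x => (set_val x.1)^*%R * chi b x).
    apply: continuous_mulC; last exact: h.
    move=> x; apply: (@continuous_comp _ _ _ (fun tb : (circle R * bool)%type => set_val tb.1 : R[i]) (fun z : R[i] => z^*%R)).
      exact: ct.
    exact: continuous_conj.
  by apply/funext => -[t e]; rewrite chiM chi_star chi_U.
Qed.

End Characters.

End JacobsonTopology.

(** * Approximate eigenvectors *)

Section RealNormComplements.
Variables (R : realType) (V : normedModType R[i]).
Implicit Types u v : V.

Lemma rnormZr (c : R[i]) v : rnorm (c *: v) = rnorm c * rnorm v.
Proof. by apply: (@complexI R); rewrite rnormZ rmorphM/= -[in RHS]rnormE. Qed.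

Lemma rnormN v : rnorm (- v) = rnorm v.
Proof. by rewrite /rnorm normrN. Qed.

Lemma rnormB u v : rnorm (u - v) <= rnorm u + rnorm v.
Proof. by rewrite (le_trans (rnormD _ _))// rnormN. Qed.

Lemma rnorm_gt0V v : v <> 0 -> 0 < rnorm v.
Proof. by move=> /eqP v0; rewrite -ltcR -rnormE normr_gt0. Qed.

Lemma rnorm_conj (c : R[i]) : rnorm (c^*%R) = rnorm c.
Proof. by rewrite /rnorm norm_conjC. Qed.

End RealNormComplements.

Section ApproximateEigenvectors.
Variables (R : realType) (r : R) (rr : -1 < r < 1) (r0 : r != 0).
Local Notation phi := (moebius rr).
Local Notation phiz := (iterz phi).
Local Notation CX := (continuousType (disk R) R[i]).
Variables (A : cstarAlg R) (iota : CX -> A) (U : A).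
Hypothesis cp : is_crossed_product phi iota U.
Let cov := cp_covariant cp.
Local Notation pi_rep := (pi_rep cp).
Local Notation chi := (chi cp).
Variables (t : circle R) (b : bool).

Section OneRepresentation.
Variables (H : hilbert R) (p : representation A H).

Lemma rop_rnorm a v : rnorm (p a v) <= rnorm a * rnorm v.
Proof. by rewrite -lecR rmorphM/= -!rnormE rop_contraction. Qed.

(** [v] is an eigenvector of [a] for the value of the character at [a],
    asymptotically along joint approximate eigenvectors of the generators. *)
Definition approx_eigen (a : A) := forall e : R, 0 < e ->
  exists2 d : R, 0 < d & forall v : H,
    rnorm (p (iota (disk_coord R)) v - (-1) ^+ b *: v) <= d * rnorm v ->
    rnorm (p U v - set_val t *: v) <= d * rnorm v ->
    rnorm (p a v - chi a (t, b) *: v) <= e * rnorm v.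

Lemma approx_eigen_comb (c : R[i]) a1 a2 :
  approx_eigen a1 -> approx_eigen a2 -> approx_eigen (c *: a1 + a2).
Proof.
move=> h1 h2 e e0; have c0 : 0 < 2 * (rnorm c + 1) by have := rnorm_ge0 c; lra.
have [d1 d10 hd1] := h1 _ (divr_gt0 e0 c0).
have e2 : 0 < e / 2 by rewrite divr_gt0.
have [d2 d20 hd2] := h2 _ e2.
exists (Num.min d1 d2) => [|v vz vU]; first by rewrite lt_min d10.
have v0 := rnorm_ge0 v.
have m1 : Num.min d1 d2 * rnorm v <= d1 * rnorm v by rewrite ler_wpM2r// ge_min lexx.
have m2 : Num.min d1 d2 * rnorm v <= d2 * rnorm v by rewrite ler_wpM2r// ge_min lexx orbT.
have := hd1 v (le_trans vz m1) (le_trans vU m1).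
have := hd2 v (le_trans vz m2) (le_trans vU m2).
rewrite chiD chiZ ropD ropZ.
have -> : c *: p a1 v + p a2 v - (c * chi a1 (t, b) + chi a2 (t, b)) *: v =
    c *: (p a1 v - chi a1 (t, b) *: v) + (p a2 v - chi a2 (t, b) *: v).
  by rewrite scalerDl opprD addrACA scalerBr scalerA.
move=> g2 g1; apply: le_trans (rnormD _ _) _; rewrite rnormZr.
have : rnorm c * rnorm (p a1 v - chi a1 (t, b) *: v) <= e / 2 * rnorm v; last by lra.
apply: le_trans (ler_wpM2l (rnorm_ge0 c) g1) _; rewrite mulrA ler_wpM2r//.
rewrite mulrC -mulrA ler_wpM2l ?(ltW e0)// invfM -mulrA ler_piMr ?invr_ge0//.
by rewrite ler_pdivrMl ?mulr1 ?lerDl//; have := rnorm_ge0 c; lra.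
Qed.

Lemma approx_eigenM a1 a2 : approx_eigen a1 -> approx_eigen a2 -> approx_eigen (a1 ** a2).
Proof.
move=> h1 h2 e e0.
have n1 := rnorm_ge0 a1; have n2 := rnorm_ge0 a2.
have c1 : 0 < 2 * (rnorm a2 + 1) by lra.
have c2 : 0 < 2 * (rnorm a1 + 1) by lra.
have [d1 d10 hd1] := h1 _ (divr_gt0 e0 c1).
have [d2 d20 hd2] := h2 _ (divr_gt0 e0 c2).
exists (Num.min d1 d2) => [|v vz vU]; first by rewrite lt_min d10.
have v0 := rnorm_ge0 v.
have m1 : Num.min d1 d2 * rnorm v <= d1 * rnorm v by rewrite ler_wpM2r// ge_min lexx.
have m2 : Num.min d1 d2 * rnorm v <= d2 * rnorm v by rewrite ler_wpM2r// ge_min lexx orbT.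
have := hd1 v (le_trans vz m1) (le_trans vU m1).
have := hd2 v (le_trans vz m2) (le_trans vU m2).
rewrite chiM ropM.
have -> : p a1 (p a2 v) - (chi a1 (t, b) * chi a2 (t, b)) *: v =
    p a1 (p a2 v - chi a2 (t, b) *: v) + chi a2 (t, b) *: (p a1 v - chi a1 (t, b) *: v).
  by rewrite [p a1 (_ - _)]linearB [p a1 (_ *: _)]linearZ/= scalerBr addrA subrK scalerA [chi a2 _ * _]mulrC.
move=> g2 g1; apply: le_trans (rnormD _ _) _; rewrite rnormZr.
have k2 : rnorm (chi a2 (t, b)) <= rnorm a2 by rewrite -lecR -!rnormE chi_le.
have half (x : R) : 0 <= x -> x * (e / (2 * (x + 1))) <= e / 2.
  move=> x0; have x1 : 0 < x + 1 by lra.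
  have -> : x * (e / (2 * (x + 1))) = e / 2 * (x / (x + 1)) by field; rewrite gt_eqF.
  by rewrite ler_piMr ?divr_ge0 ?(ltW e0)// ler_pdivrMr// mul1r lerDl.
have : rnorm (p a1 (p a2 v - chi a2 (t, b) *: v)) <= e / 2 * rnorm v.
  apply: le_trans (rop_rnorm _ _) _; apply: le_trans (ler_wpM2l n1 g2) _.
  by rewrite mulrA ler_wpM2r// half.
have : rnorm (chi a2 (t, b)) * rnorm (p a1 v - chi a1 (t, b) *: v) <= e / 2 * rnorm v.
  apply: le_trans (ler_pM (rnorm_ge0 _) (rnorm_ge0 _) k2 g1) _.
  by rewrite mulrA ler_wpM2r// half.
lra.
Qed.

(** The approximation is stable under limits, combinations and products, so it
    has to be checked on the generators only; for functions it is
    [eigen_estimate]. *)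
Lemma approx_eigen_all a : approx_eigen a.
Proof.
apply: (crossed_product_ind cp (S := approx_eigen)).
- move=> {}a acl e e0; have e4 : 0 < (e / 4)%:C :> R[i] by rewrite ltcR divr_gt0.
  have e2 : 0 < e / 2 by rewrite divr_gt0.
  have [c [hc]] := acl _ (nbhsx_ballx a _ e4).
  rewrite -ball_normE /ball_/= rnormE ltcR => ac.
  have [d d0 hd] := hc _ e2; exists d => // v vz vU; have := hd v vz vU.
  have v0 := rnorm_ge0 v.
  have -> : p a v - chi a (t, b) *: v =
      p (a - c) v + (p c v - chi c (t, b) *: v) + chi (c - a) (t, b) *: v.
    by rewrite chiB ropB scalerBl !addrA subrK subrK.
  move=> h; apply: le_trans (rnormD _ _) _; rewrite rnormZr.
  have := rnormD (p (a - c) v) (p c v - chi c (t, b) *: v).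
  have k1 : rnorm (p (a - c) v) <= e / 4 * rnorm v.
    by apply: le_trans (rop_rnorm _ _) _; rewrite ler_wpM2r// ltW.
  have k2 : rnorm (chi (c - a) (t, b)) * rnorm v <= e / 4 * rnorm v.
    rewrite ler_wpM2r//; apply: (@le_trans _ _ (rnorm (c - a))).
      by rewrite -lecR -!rnormE chi_le.
    by rewrite /rnorm distrC; exact: ltW.
  lra.
- exact: approx_eigen_comb.
- move=> e e0; exists 1 => // v _ _.
  by rewrite rop1 chi1 scale1r subrr rnorm0 mulr_ge0 ?rnorm_ge0// ltW.
- move=> f c hc; apply: approx_eigenM => // e e0.
  have e2 : 0 < e ^+ 2 / 2 by rewrite divr_gt0// exprn_gt0.
  have [C C0 hC] := eigen_estimate cov p f (disk_sign R b) e2.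
  have C1 : 0 < C + 1 by lra.
  pose d := Num.sqrt (e ^+ 2 / 2 / (C + 1)).
  have d2 : d ^+ 2 = e ^+ 2 / 2 / (C + 1) by rewrite sqr_sqrtr// divr_ge0// ltW.
  exists d => [|v vz _]; first by rewrite sqrtr_gt0 divr_gt0.
  rewrite chi_iota; have := hC v; rewrite disk_sign_val !rnormE -!rmorphXn -!rmorphM -rmorphD lecR.
  set X := rnorm (p (iota f) v - _); set Y := rnorm (p (iota (disk_coord R)) v - _) in vz *.
  have v0 := rnorm_ge0 v; have X0 : 0 <= X := rnorm_ge0 _; have Y0 : 0 <= Y := rnorm_ge0 _.
  have Y2 : Y ^+ 2 <= d ^+ 2 * rnorm v ^+ 2.
    by rewrite -exprMn ler_pXn2r// nnegrE mulr_ge0// sqrtr_ge0.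
  have CY : C * Y ^+ 2 <= e ^+ 2 / 2 * rnorm v ^+ 2.
    apply: le_trans (ler_wpM2l C0 Y2) _; rewrite mulrA ler_wpM2r ?sqr_ge0// d2.
    have -> : C * (e ^+ 2 / 2 / (C + 1)) = e ^+ 2 / 2 * (C / (C + 1)).
      by field; rewrite gt_eqF.
    by rewrite ler_piMr ?(ltW e2)// ler_pdivrMr// mul1r lerDl.
  move=> XX; rewrite -(@ler_pXn2r _ 2) ?nnegrE ?mulr_ge0 ?(ltW e0)// exprMn.
  lra.
- move=> c hc; apply: approx_eigenM => // e e0; exists e => // v _.
  by rewrite chi_U.
- move=> c hc; apply: approx_eigenM => // e e0; exists e => // v _ vU.
  rewrite chi_star chi_U; apply: le_trans vU.
  have tt : set_val t * (set_val t)^*%R = 1 by rewrite -normCK circle_norm expr1n.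
  have -> : p (cstar U) v - (set_val t)^*%R *: v =
      - (set_val t)^*%R *: p (cstar U) (p U v - set_val t *: v).
    rewrite [p _ (_ - _)]linearB [p _ (_ *: _)]linearZ/= -ropM (cov_unitaryl cov) rop1 scaleNr scalerBr scalerA.
    by rewrite mulrC tt scale1r opprB.
  rewrite rnormZr rnormN rnorm_conj {1}/rnorm circle_norm mul1r.
  by rewrite /rnorm (ropUstar_norm cov).
Qed.

Lemma approx_eigen_ker a :
  (forall d : R, 0 < d -> exists2 v : H, v <> 0 &
    rnorm (p (iota (disk_coord R)) v - (-1) ^+ b *: v) <= d * rnorm v /\
    rnorm (p U v - set_val t *: v) <= d * rnorm v) ->
  (forall v, p a v = 0) -> chi a (t, b) = 0.
Proof.
move=> hv pa; apply: rnorm_eq0; apply/eqP; rewrite eq_le rnorm_ge0 andbT.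
apply/ler_addgt0Pr => e e0; rewrite add0r.
have [d d0 hd] := approx_eigen_all a e0.
have [v v0 [vz vU]] := hv _ d0; have := hd v vz vU.
by rewrite pa sub0r rnormN rnormZr ler_pM2r// rnorm_gt0V.
Qed.

End OneRepresentation.

End ApproximateEigenvectors.

Section WavePackets.
Variables (R : realType) (r : R) (rr : -1 < r < 1) (r0 : r != 0).
Local Notation phi := (moebius rr).
Local Notation phiz := (iterz phi).
Local Notation CX := (continuousType (disk R) R[i]).
Variables (A : cstarAlg R) (iota : CX -> A) (U : A).
Hypothesis cp : is_crossed_product phi iota U.
Local Notation pi_rep := (pi_rep cp).
Local Notation chi := (chi cp).
Local Notation H := (hilbert_l2Z R).

Section Packet.
Variables (t : circle R) (lo : int).
Local Notation tV := ((set_val t)^*%R : R[i]).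

Let ttV : set_val t * tV = 1.
Proof. by rewrite -normCK circle_norm expr1n. Qed.

(** Under the unitary minus [t] this sum telescopes to two boundary terms, while
    its norm is the square root of [N]. *)
Fixpoint packet (N : nat) : l2Z R :=
  if N is M.+1 then packet M + tV ^+ M *: l2basis R (lo + M%:Z) else 0.

Lemma packetS N : packet N.+1 = packet N + tV ^+ N *: l2basis R (lo + N%:Z).
Proof. by []. Qed.

Lemma packet_outside N k : (forall i, (i < N)%N -> k != lo + i%:Z) -> (packet N : l2Z R) k = 0.
Proof.
elim: N => // N IH kN; rewrite packetS l2DE l2ZE l2basisE IH => [|i iN]; last by apply: kN; exact: ltnW.
by rewrite (negbTE (kN N _))// mulr0 addr0.
Qed.

Lemma packet_norm N : rnorm (packet N) ^+ 2 = N%:R.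
Proof.
elim: N => [|N IH]; first by rewrite rnorm0 expr0n.
have E (u : l2Z R) : (rnorm u)%:C ^+ 2 = hdot H u u.
  by rewrite -rnormE; exact: (esym (hdot_norm (h := H) u)).
apply: (@complexI R); rewrite rmorphXn/= E.
have o : hdot H (packet N) (l2basis R (lo + N%:Z)) = 0.
  rewrite l2dot_basis packet_outside// => i iN; rewrite (inj_eq (addrI _)).
  by rewrite eqz_nat gtn_eqF.
have o' : hdot H (l2basis R (lo + N%:Z)) (packet N) = 0 by rewrite hdotC o conjC0.
rewrite linearDl !linearDr/= !linearZl_LR/= !linearZr_LR/= o o' l2basis_orthonormal eqxx/=.
rewrite !mulr0 addr0 add0r -E -rmorphXn IH mulr1.
have -> : (tV ^+ N)^*%R *: tV ^+ N = 1.
  rewrite -[LHS]/((tV ^+ N)^*%R * tV ^+ N) rmorphXn/= conjCK -exprMn ttV expr1n.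
  by [].
by rewrite -[N.+1]addn1 natrD rmorphD.
Qed.

Lemma packet_shift N (p : representation A H) : (forall v, p U v = l2shift v) ->
  p U (packet N) - set_val t *: packet N =
  set_val t *: (tV ^+ N *: l2basis R (lo + N%:Z) - l2basis R lo).
Proof.
move=> pU; elim: N => [|N IH].
  by rewrite linear0 scaler0 subrr expr0 scale1r addr0 subrr scaler0.
rewrite packetS [p U (_ + _)]linearD [p U (_ *: _)]linearZ/= [p U (l2basis _ _)]pU shift_basis scalerDr opprD addrACA IH.
rewrite !scalerBr !scalerA exprS mulrA ttV mul1r.
have -> : lo + N%:Z + 1 = lo + N.+1%:Z by rewrite -addrA -PoszD addn1.
by rewrite addrC -[set_val t * tV ^+ N]/(_) [_ - _ + _]addrA subrK.
Qed.

End Packet.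

(** The packet is placed where the orbit is within [d] of the fixed point, and
    its length makes the two boundary terms negligible. *)
Lemma pi_approx_eigenvectors x t (b : bool) (d : R) : x \in punctured_disk R -> 0 < d ->
  exists2 v : H, v <> 0 &
    rnorm (pi_rep x (iota (disk_coord R)) v - (-1) ^+ b *: v) <= d * rnorm v /\
    rnorm (pi_rep x U v - set_val (t : circle R) *: v) <= d * rnorm v.
Proof.
move=> xP d0; have [pf pU] := pi_repP cp x.
pose N := (Num.Def.archi_bound ((2 / d) ^+ 2)).+1.
have [lo hlo] := @far_iterates R r rr r0 x b d N xP d0.
pose v := packet t lo N; have vN : rnorm v ^+ 2 = N%:R by exact: packet_norm.
have v2 : 2 <= d * rnorm v.
  rewrite mulrC -ler_pdivrMr// -(@ler_pXn2r _ 2) ?nnegrE ?rnorm_ge0 ?divr_ge0 ?(ltW d0)//.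
  rewrite vN; apply/ltW; apply: lt_trans (archi_boundP _) _; first by rewrite sqr_ge0.
  by rewrite ltr_nat.
exists v.
  by move=> v0; move: v2; rewrite v0 rnorm0 mulr0; lra.
split; last first.
  rewrite (packet_shift _ _ _ pU); apply: le_trans v2.
  rewrite rnormZr {1}/rnorm circle_norm mul1r.
  apply: le_trans (rnormB _ _) _; rewrite rnormZr.
  have e1 n : rnorm (l2basis R n : H) = 1.
    by apply: (@complexI R); rewrite -rnormE; exact: l2basis_norm.
  have -> : rnorm (((set_val t)^*%R) ^+ N) = 1 by rewrite /rnorm normrX norm_conjC circle_norm expr1n.
  by rewrite !e1 mul1r.
have hz k : rnorm ((v : l2Z R) k * (set_val (phiz k x) - (-1) ^+ b)) <= d * rnorm ((v : l2Z R) k).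
  rewrite rnormM mulrC; have [[i iN ->]|no] := pselect (exists2 i, (i < N)%N & k = lo + i%:Z).
    by rewrite ler_wpM2r ?rnorm_ge0// hlo.
  rewrite packet_outside ?rnorm0 ?mulr0// => i iN; apply/eqP => ki.
  by apply: no; exists i.
rewrite -lecR -rnormE; apply: l2_norm_le => [|n]; first by rewrite mulr_ge0 ?rnorm_ge0 ?(ltW d0).
rewrite exprMn -l2sq_rnorm.
apply: (@le_trans _ _ (d ^+ 2 * zseries (fun k => sqnorm ((v : l2Z R) k)) n)); last first.
  by rewrite ler_wpM2l ?sqr_ge0 ?l2sq_ge.
rewrite -[leRHS]/((d ^+ 2) *: (zseries (fun k => sqnorm ((v : l2Z R) k)) n : R^o)) -zseriesZ.
apply: le_zseries => k; rewrite !sqnorm_rnorm l2BE l2ZE pf.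
rewrite -[leRHS]/(d ^+ 2 * _) -exprMn ler_pXn2r ?nnegrE ?mulr_ge0 ?rnorm_ge0 ?(ltW d0)//.
by have := hz k; rewrite mulrBr mulrC [_ * (-1) ^+ b]mulrC.
Qed.

(** Every orbit accumulates at both fixed points, so the kernel of [pi_x] is
    contained in those of the characters. *)
Lemma pi_ker_chi x t b a : x \in punctured_disk R ->
  (forall v, pi_rep x a v = 0) -> chi a (t, b) = 0.
Proof.
move=> xP; apply: approx_eigen_ker => d d0; exact: pi_approx_eigenvectors.
Qed.

End WavePackets.

(** * Closed sets of the spectrum *)

Lemma closed_zeros (R : realType) (X : topologicalType) (g : X -> R[i]) :
  continuous g -> closed [set x | g x = 0].
Proof.
have cl0 : closed [set (0 : R[i])].
  apply: (@closed_eq_continuous R R[i] R[i] id (fun=> 0)); last exact: cst_continuous.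
  by move=> x; exact: cvg_id.
by move=> /continuous_closedP/(_ _ cl0).
Qed.

Section SpectrumHomeomorphism.
Variables (R : realType) (r : R) (rr : -1 < r < 1) (r0 : r != 0).
Local Notation phi := (moebius rr).
Local Notation phiz := (iterz phi).
Local Notation CX := (continuousType (disk R) R[i]).
Variables (A : cstarAlg R) (iota : CX -> A) (U : A).
Hypothesis cp : is_crossed_product phi iota U.
Let cov := cp_covariant cp.
Local Notation pi_rep := (pi_rep cp).
Local Notation chi := (chi cp).
Local Notation model_ker := (model_ker r0 cp).
Implicit Types (F : set (spectrum_model phi)) (m : spectrum_model phi).

(** Hull-kernel closed sets, read on the model. *)
Definition hull_closed F :=
  forall m, (forall a, (forall m', F m' -> model_ker m' a) -> model_ker m a) -> F m.

Lemma model_ker_repr c a : model_ker (inl c) a <-> forall v, pi_rep (set_val (repr c)) a v = 0.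
Proof. by []. Qed.

Lemma iota_not_ker c (f : CX) : f (set_val (repr c)) <> 0 -> ~ model_ker (inl c) (iota f).
Proof.
move=> fc /model_ker_repr /(_ (l2basis R 0)) h; apply: fc.
have [pf _] := pi_repP cp (set_val (repr c)).
have := congr1 (fun u : l2Z R => u 0) h; rewrite pf l2basisE eqxx mulr1.
by [].
Qed.

Lemma iota_ker_orbit (x : punctured_disk R) (f : CX) :
  (forall y : punctured_disk R, orbit_class phi y = orbit_class phi x -> f (set_val y) = 0) ->
  model_ker (inl (orbit_class phi x)) (iota f).
Proof.
move=> fx; apply/model_ker_orbit => v; apply: l2_ext => n.
have [pf _] := pi_repP cp (set_val x); rewrite pf.
have yP := iterz_punctured rr n (punctured_mem x).
rewrite -[phiz n (set_val x)]/(set_val (SigSub yP)) fx ?mul0r//.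
by apply/esym/orbit_classP; exists n.
Qed.

Lemma closed_orbits_preimage (K : set (orbit_space phi)) :
  closed K <-> closed (orbit_class phi @^-1` K).
Proof.
split=> cK; first by move/continuous_closedP : (@pi_continuous _ {eq_quot same_orbit phi}%qT); apply.
by rewrite -[K]setCK; apply: open_closedC; move/closed_openC : cK.
Qed.

Lemma hull_closed_characters F : hull_closed F -> (forall c, ~ F (inl c)) ->
  closed [set tb | F (inr tb)].
Proof.
move=> hF noF [t b] tbK; apply: hF => a ha; apply/model_ker_chi.
have clK := closed_zeros (@chi_continuous _ _ _ _ _ _ cp a).
apply: (clK (t, b)) => V /tbK[[t' b'] [Ft' Vt']].
exists (t', b'); split => //=; apply/model_ker_chi; exact: ha.
Qed.

Lemma hull_closed_orbits F : hull_closed F -> closed [set c | F (inl c)].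
Proof.
move=> hF; apply/closed_orbits_preimage => x xK; apply: hF => a ha.
apply/model_ker_orbit/pi_rep_eq0 => n k.
have cc : continuous (fun y : punctured_disk R => coef cp n k a (set_val y)).
  move=> y; apply: (@continuous_comp _ _ _ (@set_val _ (punctured_disk R)) (coef cp n k a)).
    exact: initial_continuous.
  exact: coef_continuous.
have clK := closed_zeros cc.
apply: (clK x) => V /xK[y [Fy Vy]]; exists y; split => //=.
by rewrite /coef; have /model_ker_orbit -> := ha _ Fy.
Qed.

(** As soon as a closed set meets the orbit space it contains all the
    characters, by [pi_ker_chi]. *)
Lemma hull_closed_frakC F : hull_closed F -> frakC_closed F.
Proof.
move=> hF; have [[c Fc]|noF] := pselect (exists c, F (inl c)); last first.
  left; exists [set tb | F (inr tb)].
    by apply: hull_closed_characters => // c Fc; apply: noF; exists c.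
  apply/seteqP; split => [[c Fc|tb Ftb]|_ [tb Ftb <-]//]; last by exists tb.
  by case: noF; exists c.
right; exists [set c | F (inl c)]; first exact: hull_closed_orbits.
have Finr tb : F (inr tb).
  apply: hF => a ha; case: tb => t b; apply/model_ker_chi.
  apply: (pi_ker_chi r0 _ _ (punctured_mem (repr c))); exact: (ha _ Fc).
apply/seteqP; split => [[d Fd|tb _]|_ [[d Fd <-]//|[tb _ <-]]].
- by left; exists d.
- by right; exists tb.
- exact: Finr.
Qed.

(** The positive part of [d^2 - |U - t0|^2], which exists as the sum of an
    element and its absolute value, separates a character from those whose
    value at [U] is at distance at least [d]. *)
Lemma separating_element (t0 : circle R) (d : R) : 0 < d ->
  exists a : A, (forall b, chi a (t0, b) <> 0) /\
    forall t b, d <= rnorm (set_val t - set_val t0) -> chi a (t, b) = 0.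
Proof.
move=> d0; pose w := U - set_val t0 *: cone A.
pose h := (d ^+ 2)%:C *: cone A - cstar w ** w.
have hs : cstar h = h.
  rewrite cstarB cstarZ cstar1 cstarM cstarK; congr (_ *: _ - _).
  by rewrite geC0_conj// lecR sqr_ge0.
pose N := rnorm h + 1; have N0 : 0 < N by have := rnorm_ge0 h; rewrite /N; lra.
pose k := (N^-1)%:C *: h.
have ks : cstar k = k by rewrite cstarZ hs geC0_conj// lecR invr_ge0 ltW.
have k1 : `|k| <= 1.
  rewrite rnormE rnormZr rnormr ger0_norm ?invr_ge0 ?(ltW N0)// -[1]/(1%:C) lecR.
  by rewrite ler_pdivrMl// mulr1 /N lerDl.
have subT : star_subalgebra [set: A] by [].
have [y [_ ys y1 yE]] := cabs closedT subT (I : setT k) ks k1.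
have kE t b : chi k (t, b) = (N^-1 * (d ^+ 2 - rnorm (set_val t - set_val t0) ^+ 2))%:C.
  rewrite chiZ chiB chiZ chiM chi_star chiB chiZ chi1 chi_U !mulr1.
  by rewrite [_^*%R * _]mulrC -normCK rnormE -rmorphXn -rmorphB -rmorphM.
have sE t b : chi (cone A - y) (t, b) = `|chi k (t, b)|.
  have yr : chi y (t, b) \is Num.real by apply/CrealP; rewrite -chi_star ys.
  have s0 : 0 <= chi (cone A - y) (t, b).
    rewrite chiB chi1 subr_ge0 (le_trans (real_ler_norm yr))//.
    exact: le_trans (chi_le _ _ _) y1.
  have kr : chi k (t, b) \is Num.real by apply/CrealP; rewrite -chi_star ks.
  apply/eqP; rewrite -(@eqrXn2 _ 2)// expr2 -chiM yE chiM -expr2.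
  by rewrite real_normK.
exists (k + (cone A - y)); split=> [b|t b dt].
  rewrite chiD sE kE subrr rnorm0 expr0n subr0 ger0_norm; last first.
    by rewrite lecR mulr_ge0 ?invr_ge0 ?sqr_ge0 ?(ltW N0).
  move=> /eqP; rewrite -mulr2n mulrn_eq0/= fmorph_eq0 mulf_eq0 invr_eq0.
  by rewrite gt_eqF//= expf_eq0 gt_eqF.
rewrite chiD sE kE ler0_norm ?subrr//.
by rewrite lecR mulr_ge0_le0 ?invr_ge0 ?(ltW N0)// subr_le0 ler_pXn2r ?nnegrE ?rnorm_ge0 ?(ltW d0).
Qed.

(** Points outside are separated by elements of the algebra: a function
    vanishing at the fixed points detects an orbit, and a function of the
    unitary times [1 + z] or [1 - z] detects a character. *)
Lemma frakC_hull_closed F : frakC_closed F -> hull_closed F.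
Proof.
move=> [[K cK ->]|[K cK ->]] m hm.
  case: m hm => [c|[t0 b0]] hm.
    have [f [fc fb _]] := nbhs_bump (punctured_mem (repr c)) filterT.
    case: (@iota_not_ker c f fc); apply: hm => _ [[t b] _ <-].
    by apply/model_ker_chi; rewrite chi_iota.
  exists (t0, b0) => //; apply: contrapT => nK.
  have oK : nbhs (t0, b0) (~` K).
    by apply: open_nbhs_nbhs; split => //; exact: closed_openC.
  have [d d0 dK] : exists2 d : R, 0 < d &
      forall t, rnorm (set_val t - set_val t0) < d -> ~ K (t, b0).
    case: oK => -[P Q] /= [t0P b0Q] PQ.
    have [d d0 dP] := nbhs_subsetP t0P; exists d => // t td.
    apply: (PQ (t, b0)); split; last exact: nbhs_singleton.
    by apply: dP; rewrite rnormE ltcR.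
  have [a [at0 aK]] := separating_element t0 d0.
  pose f : CX := ctsD (cts1 R _) (ctsZ ((-1) ^+ b0) (disk_coord R)).
  have fE b : f (disk_sign R b) = 1 + (-1) ^+ b0 * (-1) ^+ b.
    by rewrite ctsDE ctsZE cts1E.
  have /model_ker_chi : model_ker (inr (t0, b0)) (iota f ** a).
    apply: hm => _ [[t b] Kt <-]; apply/model_ker_chi; rewrite chiM chi_iota fE.
    have [bb|bb] := eqVneq b b0; last first.
      rewrite -signr_addb (_ : b0 (+) b) ?expr1 ?subrr ?mul0r//.
      by move: bb; case: (b); case: (b0).
    rewrite aK ?mulr0// leNgt; apply/negP => /dK; rewrite -bb.
    exact.
  rewrite chiM chi_iota fE -expr2 sqrr_sign => /eqP; rewrite mulf_eq0 => /orP[|/eqP]//.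
    by rewrite -mulr2n pnatr_eq0.
  exact: at0.
case: m hm => [c|tb] hm; last by right; exists tb.
left; exists c => //; apply: contrapT => nK.
have oV : open (~` (orbit_class phi @^-1` K)).
  by apply: closed_openC; apply/closed_orbits_preimage.
have [W oW WK] : exists2 W : set (disk R), open W & set_val @^-1` W = ~` (orbit_class phi @^-1` K) by [].
have WE (y : punctured_disk R) : W (set_val y) -> ~ K (orbit_class phi y).
  by move=> Wy; have : (set_val @^-1` W) y by []; rewrite WK.
have Wc : W (set_val (repr c)).
  have : (~` (orbit_class phi @^-1` K)) (repr c).
    by rewrite /= (_ : orbit_class phi (repr c) = c)//; exact: reprK.
  by rewrite -WK.
have [f [fc fb fW]] := nbhs_bump (punctured_mem (repr c)) (open_nbhs_nbhs (conj oW Wc)).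
case: (@iota_not_ker c f fc); apply: hm => _ [[d Kd <-]|[[t b] _ <-]]; last first.
  by apply/model_ker_chi; rewrite chi_iota.
have dE : orbit_class phi (repr d) = d by exact: reprK.
rewrite -dE; apply: iota_ker_orbit => y; rewrite dE => yd.
by apply: contrapT => /fW /WE; rewrite yd.
Qed.

End SpectrumHomeomorphism.

(** * The homeomorphism *)

Theorem theorem3p16 (R : realType) (phi : continuousType (disk R) (disk R))
    (A : cstarAlg R) (iota : continuousType (disk R) R[i] -> A) (U : A) :
  hyperbolic_automorphism phi ->
  (forall b : bool, phi (disk_sign R b) = disk_sign R b) ->
  is_crossed_product phi iota U ->
  exists q : spectrum A -> spectrum_model phi,
    [/\ is_q iota U q,
        forall q' : spectrum A -> spectrum_model phi, is_q iota U q' -> q' = q &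
        homeomorphism (@jacobson_closed R A) (@frakC_closed R phi) q].
Proof.
move=> hyp fixed cp.
have [r [rr [r0 phiE]]] := hyperbolic_normal_form hyp fixed.
subst phi; exists (spec_param r0 cp); split.
- exact: spec_param_is_q.
- exact: is_q_unique.
- split; first exact: spec_param_bij.
  move=> F; rewrite jacobson_closed_model; split.
    exact: frakC_hull_closed.
  exact: hull_closed_frakC.
Qed.
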